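(* Let $(M,\omega)$ be a closed symplectic manifold and $\mathcal{AM}$ the space of smooth associated metrics on $M$. The almost complex structure $\mathbf J$ on the manifold $\mathcal{AM}$, given by $\mathbf J_g(h)=hJ$ for $h\in T_g\mathcal{AM}$, is integrable. Moreover, the corresponding complex structure coincides with the complex structure on $\mathcal{AM}$ obtained from the global parametrization $$\Psi_{AM}:\mathcal P_{J_0}\longrightarrow\mathcal{AM},\qquad P\mapsto g=g_0(1+P)(1-P)^{-1},$$ where the model space $\mathrm{End}_{SJ_0}(TM)$ carries the complex structure $A\mapsto AJ_0$.
   Context: An almost complex structure $J$ on $M$ is positive associated if $\omega(JX,JY)=\omega(X,Y)$ and $\omega(X,JX)>0$ for $X\ne0$; its associated metric is $g(X,Y)=\omega(X,JY)$, and $J$ is determined by $g$. $\mathcal{AM}$ is the space of all smooth associated metrics; it is an infinite-dimensional smooth ILH (inverse limit of Hilbert) manifold, and $T_g\mathcal{AM}$ consists of all smooth symmetric 2-forms $h$ on $M$ that are anti-Hermitian: $h(JX,JY)=-h(X,Y)$, where $J$ corresponds to $g$. The 2-form $hJ$ is $(hJ)(X,Y)=h(X,JY)$; it is again symmetric and anti-Hermitian. $J_0$ is a fixed positive associated almost complex structure with associated metric $g_0$; $\mathrm{End}_{SJ_0}(TM)$ is the space of smooth $g_0$-symmetric endomorphisms of $TM$ anticommuting with $J_0$; $\mathcal P_{J_0}=\{P\in\mathrm{End}_{SJ_0}(TM): 1-P^2>0\}$ is an open set in it. The metric $g=g_0(1+P)(1-P)^{-1}$ is $g(X,Y)=g_0(X,(1+P)(1-P)^{-1}Y)$,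 and $\Psi_{AM}$ is a global parametrization (bijective chart) of $\mathcal{AM}$. *)

(* Defs.v *)
From mathcomp Require Import all_boot all_order all_algebra.
From mathcomp Require Import all_classical all_reals all_analysis.
Import Order.TTheory GRing.Theory Num.Theory.
Import numFieldNormedType.Exports.

Set Implicit Arguments.
Unset Strict Implicit.
Unset Printing Implicit Defensive.

Local Open Scope classical_set_scope.
Local Open Scope ring_scope.

Section SmoothFunctions.
Context {R : realType} {m : nat} {W : normedModType R}.

(* pderiv [:: a_1; ...; a_k] f = d_{a_1} ... d_{a_k} f *)
Definition pderiv (s : seq 'I_m) (f : 'rV[R]_m -> W) : 'rV[R]_m -> W :=
  foldr (fun a g y => 'D_(delta_mx 0 a) g y) f s.

Definition smooth_on (U : set 'rV[R]_m) (f : 'rV[R]_m -> W) : Prop :=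
  forall (s : seq 'I_m) (y : 'rV[R]_m), U y ->
    {for y, continuous (pderiv s f)} /\
    forall a, derivable (pderiv s f) y (delta_mx 0 a).

End SmoothFunctions.

(* [chart_at x] is a preferred chart at [x]; it is extra data carrying no
   condition besides covering, and is used below to trivialize T_x M. *)
Record closedManifold (R : realType) (m : nat) := ClosedManifold {
  mpoint :> topologicalType;
  mcompact : compact [set: mpoint];
  mhausdorff : hausdorff_space mpoint;
  atlas : Type;
  cdom : atlas -> set mpoint;
  chart : atlas -> mpoint -> 'rV[R]_m;
  cinv : atlas -> 'rV[R]_m -> mpoint;
  chart_at : mpoint -> atlas;
  cdom_open : forall i, open (cdom i);
  cimg_open : forall i, open (chart i @` cdom i);
  chartK : forall i x, cdom i x -> cinv i (chart i x) = x;
  chart_continuous : forall i x, cdom i x -> {for x, continuous (chart i)};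
  cinv_continuous : forall i y, (chart i @` cdom i) y ->
    {for y, continuous (cinv i)};
  chart_atP : forall x, cdom (chart_at x) x;
  transition_smooth : forall i j,
    smooth_on (chart i @` (cdom i `&` cdom j)) (chart j \o cinv i)
}.

(* T_x M is identified with the column vectors 'cV_m by means of the chart
   [chart_at x], so that a field of endomorphisms of TM, as well as a field of
   bilinear forms on TM, is a function M -> 'M_m; nothing is asked about how
   [chart_at x] depends on x. Smoothness and the C^oo topology are read in the
   charts of the atlas. *)

Section Tensors.
Context {R : realType} {m : nat} {M : closedManifold R m}.

Definition cimg (i : atlas M) : set 'rV[R]_m := chart i @` cdom i.

Definition tensor : Type := M -> 'M[R]_m.

(* Change of coordinates of tangent vectors at x from chart i to chart j. The
   transpose is there because [jacobian] acts on row vectors. *)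
Definition dtrans (i j : atlas M) (x : M) : 'M[R]_m :=
  (jacobian (chart j \o cinv i) (chart i x))^T.

Definition loc_endo (i : atlas M) (A : tensor) (y : 'rV[R]_m) : 'M[R]_m :=
  let x := cinv i y in
  dtrans (chart_at x) i x *m A x *m dtrans i (chart_at x) x.

Definition loc_form (i : atlas M) (B : tensor) (y : 'rV[R]_m) : 'M[R]_m :=
  let x := cinv i y in
  (dtrans i (chart_at x) x)^T *m B x *m dtrans i (chart_at x) x.

Definition smooth_endo (A : tensor) : Prop :=
  forall i, smooth_on (cimg i) (loc_endo i A).

Definition smooth_form (B : tensor) : Prop :=
  forall i, smooth_on (cimg i) (loc_form i B).

Definition bil (b : 'M[R]_m) (X Y : 'cV[R]_m) : R := (X^T *m b *m Y) 0 0.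

Definition symmetric_form (B : tensor) : Prop :=
  forall x X Y, bil (B x) X Y = bil (B x) Y X.

Definition closed_form (B : tensor) : Prop :=
  forall (i : atlas M) (y : 'rV[R]_m), cimg i y -> forall a b c : 'I_m,
    'D_(delta_mx 0 a) (fun z => loc_form i B z b c) y +
    'D_(delta_mx 0 b) (fun z => loc_form i B z c a) y +
    'D_(delta_mx 0 c) (fun z => loc_form i B z a b) y = 0.

Definition symplectic (w : tensor) : Prop :=
  [/\ smooth_form w,
      forall x X Y, bil (w x) X Y = - bil (w x) Y X,
      forall x X, (forall Y, bil (w x) X Y = 0) -> X = 0
    & closed_form w].

End Tensors.

Arguments tensor {R m} M.

(* [lcs] is a subspace [lc_in] of a vector space, with the locally convex
   topology of the family [lc_norm] of seminorms on it. The seminorms are only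
   meaningful on [lc_in], hence the membership conditions below. *)

Record lcs (R : realType) := Lcs {
  lc_vec :> lmodType R;
  lc_in : set lc_vec;
  lc_idx : Type;
  lc_norm : lc_idx -> lc_vec -> R
}.

Section Calculus.
Context {R : realType}.
Implicit Types E F : lcs R.

Definition lball E (l : seq (lc_idx E)) (e : R) (x : E) : set E :=
  [set y | lc_in y /\ \sum_(j <- l) lc_norm j (y - x) < e].

Definition lopen E (U : set E) : Prop :=
  U `<=` @lc_in R E /\
  forall x, U x -> exists l, exists2 e : R, 0 < e & lball l e x `<=` U.

Definition lcontinuous E F (U : set E) (f : E -> F) : Prop :=
  forall x, U x -> forall l (e : R), 0 < e ->
    exists k, exists2 d : R, 0 < d &
      forall y, U y -> lball k d x y -> lball l e (f x) (f y).

(* w = lim_{t -> 0} (f (x + t v) - f x) / t *)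
Definition is_dderive E F (U : set E) (f : E -> F) (x v : E) (w : F) : Prop :=
  lc_in w /\
  forall l (e : R), 0 < e -> exists2 d : R, 0 < d &
    forall t : R, t != 0 -> `|t| < d -> U (x + t *: v) ->
      lball l e w (t^-1 *: (f (x + t *: v) - f x)).

Definition lprod E F : lcs R :=
  @Lcs R (lc_vec E * lc_vec F)%type
    [set z | lc_in z.1 /\ lc_in z.2]
    (lc_idx E + lc_idx F)%type
    (fun j z => match j with
                | inl a => lc_norm a z.1
                | inr b => lc_norm b z.2
                end).

(* C^k maps in the sense of Michal, Bastiani, Hamilton and Milnor: the
   directional derivative df : U x E -> F exists and is C^(k-1) (jointly). *)
Fixpoint Ck (k : nat) E F (U : set E) (f : E -> F) {struct k} : Prop :=
  [/\ forall x, U x -> lc_in (f x), lcontinuous U f &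
      if k is k'.+1 then
        exists df : E -> E -> F,
          (forall x v, U x -> lc_in v -> is_dderive U f x v (df x v)) /\
          @Ck k' (lprod E E) F [set z | U z.1 /\ lc_in z.2]
                 (fun z => df z.1 z.2)
      else True].

Definition lsmooth E F (U : set E) (f : E -> F) : Prop :=
  forall k, Ck k U f.

(* Holomorphic maps for a complex structure I on E: smooth maps with
   complex-linear derivative. *)
Definition holomorphic E (I : E -> E) (U : set E) (f : E -> E) : Prop :=
  lsmooth U f /\
  forall x v w, U x -> lc_in v ->
    is_dderive U f x v w -> is_dderive U f x (I v) (I w).

End Calculus.

(* X is a submanifold of F modelled on E, with tangent spaces T g for g in X.
   Charts of X are given by the inverse maps: pairs (D, Phi) where D is open in
   E and Phi is a bijection of D onto an open subset of X. *)

Section ComplexStructures.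
Context {R : realType} {E : lcs R} (I : E -> E) {F : lcs R}.
Context (X : set F) (T : F -> set F) (J : F -> F -> F).

(* Phi is smooth as a map into F, it is a homeomorphism onto an open subset of
   X, its inverse extends locally to a smooth map defined on an open subset of
   F, and the range of its differential at a is T (Phi a). *)
Definition smooth_param (D : set E) (Phi : E -> F) : Prop :=
  [/\ lopen D, lsmooth D Phi, Phi @` D `<=` X,
      forall a, D a -> exists (O : set F) (r : F -> E),
        [/\ lopen O, O (Phi a), lsmooth O r, X `&` O `<=` Phi @` D &
            forall b, D b -> O (Phi b) -> r (Phi b) = b]
    & forall a, D a ->
        [set h | exists2 b, lc_in b & is_dderive D Phi a b h] = T (Phi a)].

Definition almost_complex : Prop :=
  forall g h, X g -> T g h -> T g (J g h) /\ J g (J g h) = - h.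

(* dPhi (I b) = J (dPhi b) *)
Definition J_holomorphic (D : set E) (Phi : E -> F) : Prop :=
  forall a b h, D a -> lc_in b ->
    is_dderive D Phi a b h -> is_dderive D Phi a (I b) (J (Phi a) h).

Definition integrable_acs : Prop :=
  almost_complex /\
  forall g, X g -> exists (D : set E) (Phi : E -> F),
    [/\ smooth_param D Phi, J_holomorphic D Phi & (Phi @` D) g].

(* The complex structure (maximal holomorphic atlas) defined by J. *)
Definition acs_atlas : set (set E * (E -> F)) :=
  [set c | smooth_param c.1 c.2 /\ J_holomorphic c.1 c.2].

Definition holomorphic_transition (c c' : set E * (E -> F)) : Prop :=
  let U := [set a | c.1 a /\ (c'.2 @` c'.1) (c.2 a)] in
  lopen U /\
  exists tau : E -> E, holomorphic I U tau /\
    forall a, U a -> c'.1 (tau a) /\ c'.2 (tau a) = c.2 a.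

(* The complex structure (maximal holomorphic atlas) generated by the single
   global parametrization (D0, Psi) of X. *)
Definition param_atlas (D0 : set E) (Psi : E -> F) : set (set E * (E -> F)) :=
  [set c | [/\ lopen c.1, {in c.1 &, injective c.2}, c.2 @` c.1 `<=` X,
      holomorphic_transition c (D0, Psi)
    & holomorphic_transition (D0, Psi) c]].

End ComplexStructures.

Arguments integrable_acs {R} E I F X T J.
Arguments acs_atlas {R} E I F X T J.
Arguments param_atlas {R} E I F X D0 Psi.

Section AssociatedMetrics.
Context {R : realType} {m : nat} {M : closedManifold R m}.
Variable w : tensor M.

Definition pos_assoc (J : tensor M) : Prop :=
  [/\ smooth_endo J,
      forall x, J x *m J x = - 1%:M,
      forall x X Y, bil (w x) (J x *m X) (J x *m Y) = bil (w x) X Y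
    & forall x X, X != 0 -> 0 < bil (w x) X (J x *m X)].

(* The matrix of (X, Y) |-> B (X, A Y) is B *m A. *)
Definition form_endo (B A : tensor M) : tensor M := fun x => B x *m A x.

Definition assoc_metric (J : tensor M) : tensor M := form_endo w J.

Definition AM : set (tensor M) :=
  [set g | exists2 J, pos_assoc J & assoc_metric J = g].

(* The J such that g = w(., J .); it is unique for g in AM. *)
Definition acs_of (g : tensor M) : tensor M :=
  xget 0 [set J | pos_assoc J /\ assoc_metric J = g].

Definition TAM (g : tensor M) : set (tensor M) :=
  [set h | [/\ smooth_form h, symmetric_form h &
    forall x X Y,
      bil (h x) (acs_of g x *m X) (acs_of g x *m Y) = - bil (h x) X Y]].

Definition bigJ (g h : tensor M) : tensor M := form_endo h (acs_of g).

(* Seminorms of the C^oo topology (the inverse limit of the Sobolev topologies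
   of an ILH structure): chart, compact set in its image, and multi-index of a
   partial derivative. *)
Definition Coo_idx : Type :=
  { k : atlas M * set 'rV[R]_m * seq 'I_m |
    compact k.1.2 /\ k.1.2 `<=` cimg k.1.1 }.

Definition Coo_norm (loc : atlas M -> tensor M -> 'rV[R]_m -> 'M[R]_m)
    (k : Coo_idx) (A : tensor M) : R :=
  let: (i, K, s) := sval k in
  sup [set `|pderiv s (loc i A) y| | y in K].

Definition sym_forms : lcs R :=
  @Lcs R (M -> 'M[R]_m)
    [set h | smooth_form h /\ symmetric_form h] Coo_idx (Coo_norm loc_form).

Variable J0 : tensor M.

Let g0 : tensor M := assoc_metric J0.

Definition End_S : lcs R :=
  @Lcs R (M -> 'M[R]_m)
    [set A | [/\ smooth_endo A,
        forall x X Y, bil (g0 x) (A x *m X) Y = bil (g0 x) X (A x *m Y)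
      & forall x, A x *m J0 x = - (J0 x *m A x)]]
    Coo_idx (Coo_norm loc_endo).

Definition mulJ0 (A : tensor M) : tensor M := fun x => A x *m J0 x.

Definition PJ0 : set (tensor M) :=
  [set P | @lc_in R End_S P /\
    forall x X, X != 0 -> 0 < bil (g0 x) X ((1%:M - P x *m P x) *m X)].

Definition Psi (P : tensor M) : tensor M :=
  form_endo g0 (fun x => (1%:M + P x) *m invmx (1%:M - P x)).

End AssociatedMetrics.

Arguments sym_forms {R m} M.

(* Main.v *)
Require Import Defs.
From HB Require Import structures.
From mathcomp Require Import all_boot all_order all_algebra.
From mathcomp Require Import all_classical all_reals all_analysis.
From mathcomp Require Import lra.
Import Order.TTheory GRing.Theory Num.Theory.
Import numFieldNormedType.Exports.

Set Implicit Arguments.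
Unset Strict Implicit.
Unset Printing Implicit Defensive.

Local Open Scope classical_set_scope.
Local Open Scope ring_scope.

(** Everything rests on the Cayley transform, applied fibre by fibre.

    Pointwise part. For P in PJ0 put u = (1 - P)^-1. Since P anticommutes with
    J0, the endomorphism J = J0 (1 + P) u equals (1 - P) J0 u: it is conjugate
    to J0, hence J^2 = -1. Moreover w J = g0 (1 + P) u = g0 (2 u - 1) is
    symmetric, and it is positive because it is congruent to g0 (1 - P^2); so J
    is positive associated and Psi P is its metric. Conversely an associated
    metric g = w J is Psi P for P = 1 - 2 (1 + A)^-1, A = g0^-1 g = - J0 J
    (lemmas cayley_inverse_in, cayley_inverse_pos, cayley_inverse_J). From
    Psi P = g0 (2 u - 1) one gets dPsi_P (V) = 2 g0 u V u. The relation
    u J = J0 u shows both that dPsi_P maps End_S onto the tangent space of AM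
    (dcayley_tangent, dcayley_surj) and that dPsi_P (V J0) = dPsi_P (V) J
    (dcayley_bigJ): the parametrization Psi is J-holomorphic.

    Smoothness. The map Psi is an affine map, followed by the inversion of
    tensors, followed by an affine map, and so is a left inverse of Psi defined
    on an open set of symmetric forms, g |-> retract ((1 + g0^-1 g)^-1). The
    affine maps are continuous because products of tensors are, by the Leibniz
    rule. Inversion is smooth (Ck_invT): the norms of all derivatives up to
    order n are submultiplicative up to a constant, which gives the continuity
    of A |-> A^-1 as in a Banach algebra, and the derivative - A^-1 B A^-1 is a
    polynomial in A^-1 and B. That PJ0 and the domains of these maps are open
    follows from the compactness of M (lopen_pointwise). Differentiability of
    the changes of charts is used only to invert their differentials (dtransK).

    Comparison of the two complex structures. This holds for any global
    J-holomorphic parametrization Psi (acs_atlas_eq_param_atlas). If Phi is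
    another J-holomorphic parametrization, the transitions between Phi and Psi
    are smooth, being locally r o Phi with r a smooth local left inverse of
    Psi; they are holomorphic because dPsi and dPhi intertwine J with the
    complex structure of the model and are injective. If conversely Phi has
    holomorphic transitions to and from Psi, then Phi = Psi o tau inherits the
    local inverses, the tangent spaces and the J-holomorphy of Psi. The tool is
    the chain rule for directional derivatives in locally convex spaces
    (is_dderive_comp, Ck_comp), which comes from the mean value inequality for
    a seminorm. *)

(** * Calculus in locally convex spaces *)

Section SeminormFamilies.
Context {R : realType}.

(** The data of an lcs carry no axioms; these make it a separated space, in which
    derivatives are unique. They are asked on the subspace lc_in only, the
    seminorms being meaningless outside of it. *)
Class seminormed (E : lcs R) : Prop := Seminormed {
  lc_in0 : @lc_in R E 0;
  lc_inD : forall x y : E, lc_in x -> lc_in y -> lc_in (x + y);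
  lc_inZ : forall (a : R) (x : E), lc_in x -> lc_in (a *: x);
  lc_normD : forall (j : lc_idx E) (x y : E), lc_in x -> lc_in y ->
    lc_norm j (x + y) <= lc_norm j x + lc_norm j y;
  lc_normZ : forall (j : lc_idx E) (a : R) (x : E), lc_in x ->
    lc_norm j (a *: x) = `|a| * lc_norm j x;
  lc_separated : forall x : E, lc_in x ->
    (forall j : lc_idx E, lc_norm j x = 0) -> x = 0
}.

Definition lnorm (E : lcs R) (l : seq (lc_idx E)) (x : E) : R :=
  \sum_(j <- l) lc_norm j x.

Section Lnorm.
Context {E : lcs R} {LE : seminormed E}.
Implicit Types (l : seq (lc_idx E)) (x y : E).

Lemma lc_inN x : lc_in x -> lc_in (- x).
Proof. by move=> hx; rewrite -scaleN1r; apply: lc_inZ. Qed.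

Lemma lc_inB x y : lc_in x -> lc_in y -> lc_in (x - y).
Proof. by move=> hx hy; apply: lc_inD => //; apply: lc_inN. Qed.

Lemma lnormZ l a x : lc_in x -> lnorm l (a *: x) = `|a| * lnorm l x.
Proof.
by move=> hx; rewrite /lnorm mulr_sumr; apply: eq_bigr => j _; rewrite lc_normZ.
Qed.

Lemma lnorm0 l : lnorm l (0 : E) = 0.
Proof. by rewrite -(scale0r 0) lnormZ ?normr0 ?mul0r//; exact: lc_in0. Qed.

Lemma lnormN l x : lc_in x -> lnorm l (- x) = lnorm l x.
Proof. by move=> hx; rewrite -scaleN1r lnormZ// normrN1 mul1r. Qed.

Lemma lnormD l x y : lc_in x -> lc_in y ->
  lnorm l (x + y) <= lnorm l x + lnorm l y.
Proof.
by move=> hx hy; rewrite /lnorm -big_split; apply: ler_sum => j _; apply: lc_normD.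
Qed.

Lemma lnormB l x y : lc_in x -> lc_in y ->
  lnorm l (x - y) <= lnorm l x + lnorm l y.
Proof.
by move=> hx hy; rewrite -(@lnormN l y)//; apply: lnormD => //; apply: lc_inN.
Qed.

Lemma lnorm_ge0 l x : lc_in x -> 0 <= lnorm l x.
Proof.
move=> hx; have := lnormB l hx hx; rewrite subrr lnorm0 -mulr2n.
by rewrite pmulrn_lge0.
Qed.

Lemma lnorm_cat l l' x : lnorm (l ++ l') x = lnorm l x + lnorm l' x.
Proof. by rewrite /lnorm big_cat. Qed.

Lemma lnorm1 j x : lnorm [:: j] x = lc_norm j x.
Proof. by rewrite /lnorm big_seq1. Qed.

Lemma lnorm_catl l l' x : lc_in x -> lnorm l x <= lnorm (l ++ l') x.
Proof. by move=> hx; rewrite lnorm_cat lerDl lnorm_ge0. Qed.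

Lemma lnorm_catr l l' x : lc_in x -> lnorm l' x <= lnorm (l ++ l') x.
Proof. by move=> hx; rewrite lnorm_cat lerDr lnorm_ge0. Qed.

Lemma lball_catl l l' e e' x y : lc_in x ->
  lball (l ++ l') (Num.min e e') x y -> lball l e x y.
Proof.
move=> hx [hy]; rewrite -/(lnorm _ _) lt_min => /andP[h _]; split => //.
by apply: le_lt_trans h; apply: lnorm_catl; apply: lc_inB.
Qed.

Lemma lball_catr l l' e e' x y : lc_in x ->
  lball (l ++ l') (Num.min e e') x y -> lball l' e' x y.
Proof.
move=> hx [hy]; rewrite -/(lnorm _ _) lt_min => /andP[_ h]; split => //.
by apply: le_lt_trans h; apply: lnorm_catr; apply: lc_inB.
Qed.

Lemma lopen_in : lopen (@lc_in R E).
Proof. by split=> // x hx; exists [::], 1 => // y []. Qed.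

Lemma lopen_segment (U : set E) x v : lopen U -> U x -> lc_in v ->
  exists2 d : R, 0 < d & forall t : R, `|t| < d -> U (x + t *: v).
Proof.
move=> [Uin hU] Ux hv; have [l [e e0 he]] := hU _ Ux.
have h1 : 0 < 1 + lnorm l v by rewrite ltr_pwDl// lnorm_ge0.
exists (e / (1 + lnorm l v)); first by rewrite divr_gt0.
move=> t; rewrite ltr_pdivlMr// => ht; apply: he; split.
  by apply: lc_inD; [exact: Uin|exact: lc_inZ].
rewrite -/(lnorm _ _) addrAC subrr add0r lnormZ//; apply: le_lt_trans ht.
by rewrite ler_wpM2l// lerDr.
Qed.

End Lnorm.

Section Product.
Context {E F : lcs R} {LE : seminormed E} {LF : seminormed F}.

Definition lefts (k : seq (lc_idx E + lc_idx F)) : seq (lc_idx E) :=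
  pmap (fun j => if j is inl a then Some a else None) k.
Definition rights (k : seq (lc_idx E + lc_idx F)) : seq (lc_idx F) :=
  pmap (fun j => if j is inr b then Some b else None) k.

Lemma lnorm_lprod (k : seq (lc_idx (lprod E F))) (z : lprod E F) :
  lnorm k z = lnorm (lefts k) z.1 + lnorm (rights k) z.2.
Proof.
rewrite /lnorm; elim: k => [|[a|b] k IH] /=; first by rewrite !big_nil addr0.
  by rewrite !big_cons IH/= addrA.
by rewrite !big_cons IH/= addrCA.
Qed.

Definition lseqX (k : seq (lc_idx E)) (k' : seq (lc_idx F)) :
  seq (lc_idx (lprod E F)) := map inl k ++ map inr k'.

Lemma lnorm_lseqX k k' (z : lprod E F) :
  lnorm (lseqX k k') z = lnorm k z.1 + lnorm k' z.2.
Proof. by rewrite lnorm_cat /lnorm !big_map. Qed.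

#[export] Instance lprod_seminormed : seminormed (lprod E F).
Proof.
split=> /=.
- by split; exact: lc_in0.
- by move=> x y [? ?] [? ?]; split; exact: lc_inD.
- by move=> a x [? ?]; split; exact: lc_inZ.
- by move=> [j|j] x y [? ?] [? ?]; exact: lc_normD.
- by move=> [j|j] a x [? ?]; exact: lc_normZ.
- move=> [x y] [hx hy] h; congr pair; apply: lc_separated => // j.
    exact: h (inl j).
  exact: h (inr j).
Qed.

Lemma lball_lprod k k' d (x y : lprod E F) : lc_in x ->
  lball (lseqX k k') d x y -> lball k d x.1 y.1 /\ lball k' d x.2 y.2.
Proof.
move=> [hx1 hx2] [[hy1 hy2] h].
have {}h : lnorm (lseqX k k') (y - x) < d := h.
move: h; rewrite lnorm_lseqX /= => h; split; split => //.
  by apply: le_lt_trans h; rewrite lerDl lnorm_ge0//; apply: lc_inB.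
by apply: le_lt_trans h; rewrite lerDr lnorm_ge0//; apply: lc_inB.
Qed.

Lemma lopen_lprod (U : set E) (V : set F) : lopen U -> lopen V ->
  @lopen R (lprod E F) [set z | U z.1 /\ V z.2].
Proof.
move=> [Uin hU] [Vin hV]; split=> [z [/Uin ? /Vin]//|[x y] /= [Ux Vy]].
have [l [e e0 he]] := hU _ Ux; have [l' [e' e0' he']] := hV _ Vy.
exists (lseqX l l'), (Num.min e e'); first by rewrite lt_min e0 e0'.
have hin : @lc_in R (lprod E F) (x, y) by split; [exact: Uin|exact: Vin].
move=> z /(lball_lprod hin)[[hz1 h1] [hz2 h2]]; split; [apply: he|apply: he'].
  by split=> //; move: h1; rewrite lt_min => /andP[].
by split=> //; move: h2; rewrite lt_min => /andP[].
Qed.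

End Product.
End SeminormFamilies.

Section MeanValue.
Context {R : realType}.

(** At the supremum b of the s with d 0 s <= c s, the local estimate first extends
    the inequality to b itself, then beyond b unless b = 1. *)
Lemma unit_segment_mvt (d : R -> R -> R) (c : R) :
  (forall r s t, 0 <= r <= 1 -> 0 <= s <= 1 -> 0 <= t <= 1 ->
    d r t <= d r s + d s t) ->
  (forall s, 0 <= s <= 1 -> exists2 e : R, 0 < e &
    forall t, 0 <= t <= 1 -> `|t - s| < e ->
      d s t <= c * `|t - s| /\ d t s <= c * `|t - s|) ->
  d 0 1 <= c.
Proof.
move=> dtri dloc.
pose S := [set s : R | 0 <= s <= 1 /\ d 0 s <= c * s].
have S0 : S 0.
  split; first by rewrite lexx ler01.
  have [|e e0 /(_ 0)] := dloc 0; first by rewrite lexx ler01.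
  by rewrite subrr normr0 lexx ler01 => /(_ isT e0) [].
have Sub : has_ubound S by exists 1 => s [/andP[]].
have Ssup : has_sup S by split; [exists 0|].
set b := sup S.
have b0 : 0 <= b by apply: ub_le_sup.
have b1 : b <= 1 by apply: ge_sup; [exists 0|move=> s [/andP[]]].
have b01 : 0 <= b <= 1 by rewrite b0 b1.
have [e e0 he] := dloc b b01.
have [s Ss] := sup_adherent e0 Ssup; rewrite -/b => sb.
have sle : s <= b by apply: ub_le_sup.
have [s01 ds] := Ss.
have db : d 0 b <= c * b.
  apply: (le_trans (dtri 0 s b _ _ _)) => //; first by rewrite lexx ler01.
  have [|_] := he s s01; first by rewrite distrC ger0_norm ?subr_ge0//; lra.
  by rewrite distrC ger0_norm ?subr_ge0// => h; lra.
have [b1'|b1'] := leP 1 b.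
  have eb : b = 1 by apply: le_anti; rewrite b1 b1'.
  by move: db; rewrite eb mulr1.
pose t := Num.min (b + e / 2) 1.
have tb : b < t by rewrite lt_min b1' andbT ltrDl divr_gt0.
have t01 : 0 <= t <= 1 by rewrite (le_trans b0 (ltW tb)) ge_min lexx orbT.
have te : t - b < e.
  have : t <= b + e / 2 by rewrite ge_min lexx.
  by lra.
have tS : S t.
  split=> //; apply: (le_trans (dtri 0 b t _ _ _)) => //; first by rewrite lexx ler01.
  have [|+ _] := he t t01; first by rewrite ger0_norm// subr_ge0 ltW.
  by rewrite ger0_norm ?subr_ge0 ?(ltW tb)// => h; lra.
by have := ub_le_sup Sub tS; rewrite leNgt tb.
Qed.

Context {E F : lcs R} {LE : seminormed E} {LF : seminormed F}.
Implicit Types (U : set E) (f : E -> F).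

Lemma is_dderiveZ U f x v w (t : R) : U x -> lc_in (f x) ->
  is_dderive U f x v w -> is_dderive U f x (t *: v) (t *: w).
Proof.
move=> Ux fx [hw hd]; split; first exact: lc_inZ.
move=> l e e0; have [->|t0] := eqVneq t 0.
  exists 1 => // s s0 _ _; rewrite !scale0r scaler0 addr0 subrr scaler0.
  by split; [exact: lc_in0|rewrite -/(lnorm _ _) subrr lnorm0].
have nt0 : 0 < `|t| by rewrite normr_gt0.
have et0 : 0 < e / `|t| by rewrite divr_gt0.
have [d d0 {}hd] := hd l _ et0.
exists (d / `|t|); first by rewrite divr_gt0.
move=> s s0 sd; rewrite scalerA => Us.
have [||hin hlt] := hd (s * t) _ _ Us; first by rewrite mulf_neq0.
  by rewrite normrM -ltr_pdivlMr.
have -> : s^-1 *: (f (x + (s * t) *: v) - f x) =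
    t *: ((s * t)^-1 *: (f (x + (s * t) *: v) - f x)).
  by rewrite scalerA; congr (_ *: _); rewrite invfM mulrCA divff ?mulr1.
split; first exact: lc_inZ.
rewrite -/(lnorm _ _) -scalerBr lnormZ; last exact: lc_inB.
by rewrite mulrC -ltr_pdivlMr.
Qed.

(** The function d s t = |f (x + t v) - f (x + s v) - (t - s) w| satisfies the
    triangle inequality, and its slope at s is at most |D s - w|. *)
Lemma mean_value U f x v (w : F) (D : R -> F) l c :
  (forall s, 0 <= s <= 1 -> U (x + s *: v)) ->
  (forall y, U y -> lc_in (f y)) ->
  (forall s, 0 <= s <= 1 -> is_dderive U f (x + s *: v) v (D s)) ->
  lc_in w -> (forall s, 0 <= s <= 1 -> lnorm l (D s - w) < c) ->
  lnorm l (f (x + v) - f x - w) <= c.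
Proof.
move=> Us Fin hD hw hc.
pose d s t := lnorm l (f (x + t *: v) - f (x + s *: v) - (t - s) *: w).
have -> : lnorm l (f (x + v) - f x - w) = d 0 1.
  by rewrite /d subr0 !scale1r scale0r addr0.
have fin s : 0 <= s <= 1 -> lc_in (f (x + s *: v)) by move=> /Us/Fin.
have din s t : 0 <= s <= 1 -> 0 <= t <= 1 ->
    lc_in (f (x + t *: v) - f (x + s *: v) - (t - s) *: w).
  by move=> /fin ? /fin ?; apply: lc_inB; [exact: lc_inB|exact: lc_inZ].
apply: unit_segment_mvt => [r s t hr hs ht|s hs].
  apply: le_trans (lnormD l (din _ _ hr hs) (din _ _ hs ht)).
  rewrite le_eqVlt; apply/orP; left; apply/eqP; congr lnorm.
  have -> : t - r = (s - r) + (t - s) by rewrite [RHS]addrC addrA subrK.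
  rewrite [RHS]addrACA -opprD -scalerDl; congr (_ - _).
  by rewrite [in RHS]addrC addrA subrK.
have [_ /(_ l (c - lnorm l (D s - w)))] := hD s hs.
rewrite subr_gt0 => /(_ (hc _ hs)) [e e0 he].
exists e => // t ht te.
suff dle : d s t <= c * `|t - s|.
  split=> //; rewrite (_ : d t s = d s t)// /d -lnormN; last exact: din.
  by rewrite opprD opprB -scaleNr opprB.
have [->|ts] := eqVneq t s.
  by rewrite /d !subrr normr0 mulr0 scale0r subrr lnorm0.
have ts0 : t - s != 0 by rewrite subr_eq0.
have xt : x + s *: v + (t - s) *: v = x + t *: v.
  by rewrite -addrA -scalerDl; have -> : s + (t - s) = t by rewrite addrC subrK.
have [|] := he (t - s) ts0 te; rewrite xt; first exact: Us.
set q := _ *: (_ - _) => qin; rewrite -/(lnorm _ _) => qlt.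
have -> : d s t = `|t - s| * lnorm l (q - w).
  rewrite -lnormZ; last exact: lc_inB.
  by rewrite scalerBr /q scalerA divff// scale1r.
rewrite mulrC ler_wpM2r//.
rewrite -(subrKA (D s)); apply: (le_trans (lnormD _ _ _)).
- by apply: lc_inB => //; case: (hD s hs).
- by apply: lc_inB => //; case: (hD s hs).
by apply: ltW; rewrite -ltrBrDr.
Qed.
End MeanValue.

Section Calculus.
Context {R : realType}.

Section Derivative.
Context {E F : lcs R} {LE : seminormed E} {LF : seminormed F}.
Implicit Types (U V : set E) (f : E -> F).

Lemma is_dderive_unique U f x v w w' : lopen U -> U x -> lc_in v ->
  is_dderive U f x v w -> is_dderive U f x v w' -> w = w'.
Proof.
move=> oU Ux hv [hw hd] [hw' hd'].
apply/eqP; rewrite -subr_eq0; apply/eqP.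
apply: lc_separated => [|j]; first exact: lc_inB.
rewrite -lnorm1; apply: le_anti; rewrite lnorm_ge0 ?andbT; last exact: lc_inB.
rewrite leNgt; apply/negP => n0.
have {}n0 : 0 < lnorm [:: j] (w - w') / 2 by rewrite divr_gt0.
have [d d0 {}hd] := hd [:: j] _ n0; have [d' d'0 {}hd'] := hd' [:: j] _ n0.
have [d2 d20 hU] := lopen_segment oU Ux hv.
pose t := Num.min d (Num.min d' d2) / 2.
have m0 : 0 < Num.min d (Num.min d' d2) by rewrite !lt_min d0 d'0 d20.
have t0 : 0 < t by rewrite divr_gt0.
have : t < Num.min d (Num.min d' d2) by rewrite /t ltr_pdivrMr// ltr_pMr// ltr1n.
rewrite !lt_min => /and3P[td td' td2].
have nt : `|t| = t by rewrite gtr0_norm.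
have Ut : U (x + t *: v) by apply: hU; rewrite nt.
have [||] := hd t _ _ Ut; rewrite ?nt ?gt_eqF//.
have [||] := hd' t _ _ Ut; rewrite ?nt ?gt_eqF//.
set q := _ *: _ => qin q1 _ q2.
have {}q1 : lnorm [:: j] (q - w') < lnorm [:: j] (w - w') / 2 := q1.
have {}q2 : lnorm [:: j] (q - w) < lnorm [:: j] (w - w') / 2 := q2.
have : lnorm [:: j] (q - w' - (q - w)) <=
    lnorm [:: j] (q - w') + lnorm [:: j] (q - w).
  by apply: lnormB; exact: lc_inB.
by rewrite opprB [X in lnorm _ X]addrC subrKA; lra.
Qed.

Lemma is_dderive_sub U V f x v w :
  V `<=` U -> is_dderive U f x v w -> is_dderive V f x v w.
Proof.
move=> VU [hw hd]; split=> // l e /(hd l)[d d0 {}hd].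
by exists d => // t t0 td /VU; apply: hd.
Qed.

Lemma is_dderive_near V U f x v w : lopen V -> V x -> lc_in v ->
  is_dderive V f x v w -> is_dderive U f x v w.
Proof.
move=> oV Vx hv [hw hd]; split=> // l e /(hd l)[d d0 {}hd].
have [d2 d20 hV] := lopen_segment oV Vx hv.
exists (Num.min d d2) => [|t t0]; rewrite lt_min ?d0// => /andP[td td2] _.
by apply: hd => //; apply: hV.
Qed.

Lemma is_dderive_ext U f g x v w : (forall y, U y -> f y = g y) -> U x ->
  is_dderive U f x v w -> is_dderive U g x v w.
Proof.
move=> fg Ux [hw hd]; split=> // l e /(hd l)[d d0 {}hd].
by exists d => // t t0 td Ut; rewrite -!fg//; apply: hd.
Qed.

Lemma lcontinuous_ext U f g : (forall y, U y -> f y = g y) ->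
  lcontinuous U f -> lcontinuous U g.
Proof.
move=> fg cf x Ux l e e0; have [k [d d0 hd]] := cf x Ux l e e0.
by exists k, d => // y Uy xy; rewrite -!fg//; apply: hd.
Qed.

Lemma lcontinuous_sub U V f : V `<=` U -> lcontinuous U f -> lcontinuous V f.
Proof.
move=> VU cf x Vx l e e0; have [k [d d0 hd]] := cf x (VU _ Vx) l e e0.
by exists k, d => // y /VU Uy xy; apply: hd.
Qed.

Lemma lcontinuous_near U f : U `<=` @lc_in R E ->
  (forall x, U x -> exists V, [/\ lopen V, V x & lcontinuous V f]) ->
  lcontinuous U f.
Proof.
move=> Uin h x Ux l e e0; have [V [[Vin oV] Vx cV]] := h x Ux.
have [k [d d0 hd]] := cV x Vx l e e0; have [k' [d' d'0 hd']] := oV x Vx.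
exists (k ++ k'), (Num.min d d'); first by rewrite lt_min d0.
move=> y Uy xy; apply: hd; first by apply/hd'/(lball_catr (Uin _ Ux) xy).
exact: lball_catl (Uin _ Ux) xy.
Qed.

End Derivative.

Lemma lcontinuous_comp (E F G : lcs R) (U : set E) (V : set F)
    (f : E -> F) (g : F -> G) : (forall x, U x -> V (f x)) ->
  lcontinuous U f -> lcontinuous V g -> lcontinuous U (g \o f).
Proof.
move=> UV cf cg x Ux l e e0.
have [k [d d0 hd]] := cg _ (UV _ Ux) l e e0.
have [k' [d' d'0 hd']] := cf _ Ux k d d0.
by exists k', d' => // y Uy xy; apply: hd; [exact: UV|exact: hd'].
Qed.

Lemma Ck_lc_in (k : nat) (E F : lcs R) (U : set E) (f : E -> F) :
  Ck k U f -> forall x, U x -> lc_in (f x).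
Proof. by case: k => [|k] []. Qed.

Lemma Ck_continuous (k : nat) (E F : lcs R) (U : set E) (f : E -> F) :
  Ck k U f -> lcontinuous U f.
Proof. by case: k => [|k] []. Qed.

Lemma Ck_pred (k : nat) (E F : lcs R) (U : set E) (f : E -> F) :
  Ck k.+1 U f -> Ck k U f.
Proof.
elim: k => [|k IH] in E F U f *; first by case.
move=> [h1 h2 [df [h3 h4]]]; split=> //; exists df; split=> //.
exact: IH h4.
Qed.

Lemma Ck_leq (k n : nat) (E F : lcs R) (U : set E) (f : E -> F) :
  (n <= k)%N -> Ck k U f -> Ck n U f.
Proof.
elim: k => [|k IH]; first by rewrite leqn0 => /eqP->.
rewrite leq_eqVlt => /predU1P[->//|]; rewrite ltnS => nk /Ck_pred; exact: IH.
Qed.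

Lemma Ck_sub (k : nat) (E F : lcs R) (U V : set E) (f : E -> F) :
  V `<=` U -> Ck k U f -> Ck k V f.
Proof.
elim: k => [|k IH] in E F U V f *; move=> VU.
  by move=> [h1 h2 _]; split=> // [x /VU/h1//|]; apply: lcontinuous_sub h2.
move=> [h1 h2 [df [h3 h4]]]; split=> [x /VU/h1//||].
  exact: lcontinuous_sub h2.
exists df; split=> [x v /VU Ux hv|]; first exact: is_dderive_sub (h3 x v Ux hv).
by apply: IH h4 => z [/VU ? ?]; split.
Qed.

Lemma Ck_ext (k : nat) (E F : lcs R) (U : set E) (f g : E -> F) :
  (forall y, U y -> f y = g y) -> Ck k U f -> Ck k U g.
Proof.
case: k => [|k] fg [h1 h2 h].
  split=> // [x Ux|]; first by rewrite -fg//; apply: h1.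
  exact: lcontinuous_ext h2.
split; first by move=> x Ux; rewrite -fg//; apply: h1.
  exact: lcontinuous_ext h2.
case: h => df [h3 h4]; exists df; split=> // x v Ux hv.
by apply: is_dderive_ext (h3 x v Ux hv).
Qed.

(** Local derivatives glue, because they are unique. *)
Lemma Ck_near (k : nat) (E F : lcs R) (LE : seminormed E)
    (LF : seminormed F) (U : set E) (f : E -> F) : U `<=` @lc_in R E ->
  (forall x, U x -> exists V, [/\ lopen V, V x, V `<=` U & Ck k V f]) ->
  Ck k U f.
Proof.
elim: k => [|k IH] in E LE U f *; move=> Uin h.
  split=> // [x /h[V [_ Vx _ /Ck_lc_in]]|]; first exact.
  apply: lcontinuous_near => // x /h[V [oV Vx _ cV]]; exists V; split => //.
  exact: Ck_continuous cV.
split=> [x /h[V [_ Vx _ /Ck_lc_in]]||]; first exact.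
  apply: lcontinuous_near => // x /h[V [oV Vx _ cV]]; exists V; split => //.
  exact: Ck_continuous cV.
pose df x v := xget 0 [set w | is_dderive U f x v w].
have dfP x v w : U x -> lc_in v -> is_dderive U f x v w -> df x v = w.
  move=> Ux hv hw; rewrite /df; case: xgetP => [w' _ hw'|/(_ w)//].
  have [V [oV Vx VU _]] := h x Ux.
  exact: is_dderive_unique oV Vx hv (is_dderive_sub VU hw')
    (is_dderive_sub VU hw).
exists df; split=> [x v Ux hv|].
  have [V [oV Vx VU [_ _ [dV [hV _]]]]] := h x Ux.
  have dU : is_dderive U f x v (dV x v).
    exact: is_dderive_near _ oV Vx hv (hV _ _ Vx hv).
  by rewrite (dfP x v _ Ux hv dU).
apply: IH => [z [/Uin ? ?]|]; first by split.
move=> [x v] /= [Ux hv]; have [V [oV Vx VU [_ _ [dV [hV cV]]]]] := h x Ux.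
exists [set z | V z.1 /\ lc_in z.2]; split=> //.
- exact: lopen_lprod oV lopen_in.
- by move=> z /= [/VU].
apply: Ck_ext cV => -[y u] /= [Vy hu].
by rewrite (dfP y u _ (VU _ Vy) hu (is_dderive_near U oV Vy hu (hV _ _ Vy hu))).
Qed.
End Calculus.

Section ChainRule.
Context {R : realType}.

Lemma lcontinuous_pair (E F G : lcs R) {LE : seminormed E} {LF : seminormed F}
    {LG : seminormed G} (U : set E) (f : E -> F) (g : E -> G) :
  U `<=` @lc_in R E ->
  (forall x, U x -> lc_in (f x)) -> (forall x, U x -> lc_in (g x)) ->
  lcontinuous U f -> lcontinuous U g ->
  lcontinuous U (fun x => (f x, g x) : lprod F G).
Proof.
move=> Uin fin gin cf cg x Ux l e e0.
have e20 : 0 < e / 2 by rewrite divr_gt0.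
have [k [d d0 hd]] := cf _ Ux (lefts l) _ e20.
have [k' [d' d'0 hd']] := cg _ Ux (rights l) _ e20.
exists (k ++ k'), (Num.min d d'); first by rewrite lt_min d0.
move=> y Uy xy.
have [hf fl] := hd y Uy (lball_catl (Uin _ Ux) xy).
have [hg gl] := hd' y Uy (lball_catr (Uin _ Ux) xy).
split; first by split.
rewrite -/(lnorm _ _) lnorm_lprod /=.
by rewrite (splitr e); apply: ltrD.
Qed.

Lemma is_dderive_pair (E F G : lcs R) {LE : seminormed E} {LF : seminormed F}
    {LG : seminormed G} (U : set E) (f : E -> F) (g : E -> G) x v w w' :
  is_dderive U f x v w -> is_dderive U g x v w' ->
  is_dderive U (fun x => (f x, g x) : lprod F G) x v (w, w').
Proof.
move=> [hw hd] [hw' hd']; split=> // l e e0.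
have e20 : 0 < e / 2 by rewrite divr_gt0.
have [d d0 {}hd] := hd (lefts l) _ e20.
have [d' d'0 {}hd'] := hd' (rights l) _ e20.
exists (Num.min d d'); first by rewrite lt_min d0.
move=> t t0; rewrite lt_min => /andP[td td'] Ut.
have [hf fl] := hd t t0 td Ut.
have [hg gl] := hd' t t0 td' Ut.
split; first by split.
rewrite -/(lnorm _ _) lnorm_lprod /=.
by rewrite (splitr e); apply: ltrD.
Qed.

Lemma Ck_pair (k : nat) (E F G : lcs R) {LE : seminormed E}
    {LF : seminormed F} {LG : seminormed G} (U : set E) (f : E -> F)
    (g : E -> G) : U `<=` @lc_in R E -> Ck k U f -> Ck k U g ->
  Ck k U (fun x => (f x, g x) : lprod F G).
Proof.
elim: k => [|k IH] in E LE U f g *; move=> Uin cf cg.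
  split=> // [x Ux|].
    by split; [exact: Ck_lc_in cf _ Ux|exact: Ck_lc_in cg _ Ux].
  apply: lcontinuous_pair => //; [exact: Ck_lc_in cf|exact: Ck_lc_in cg
    |exact: Ck_continuous cf|exact: Ck_continuous cg].
split=> // [x Ux||].
- by split; [exact: Ck_lc_in cf _ Ux|exact: Ck_lc_in cg _ Ux].
- apply: lcontinuous_pair => //; [exact: Ck_lc_in cf|exact: Ck_lc_in cg
    |exact: Ck_continuous cf|exact: Ck_continuous cg].
case: cf => _ _ [df [hf cf]]; case: cg => _ _ [dg [hg cg]].
exists (fun x v => (df x v, dg x v)); split=> [x v Ux hv|].
  by apply: is_dderive_pair; [exact: hf|exact: hg].
by apply: (IH (lprod E E)) => // z [/Uin].
Qed.

Record clinear (E F : lcs R) (L : E -> F) : Prop := CLinear {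
  cl_in : forall x, lc_in x -> lc_in (L x);
  clD : forall x y, L (x + y) = L x + L y;
  clZ : forall a x, L (a *: x) = a *: L x;
  cl_bound : forall l, exists k, exists2 C : R, 0 <= C &
    forall x, lc_in x -> lnorm l (L x) <= C * lnorm k x
}.

Section Linear.
Context {E F : lcs R} {LE : seminormed E} {LF : seminormed F}.
Variables (L : E -> F) (cL : clinear L).

Lemma clB x y : L (x - y) = L x - L y.
Proof. by rewrite (clD cL) -scaleN1r (clZ cL) scaleN1r. Qed.

Lemma clinear_continuous U : U `<=` @lc_in R E -> lcontinuous U L.
Proof.
move=> Uin x Ux l e e0; have [k [C C0 hC]] := cl_bound cL l.
have C1 : 0 < C + 1 by rewrite ltr_wpDl.
exists k, (e / (C + 1)); first by rewrite divr_gt0.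
move=> y Uy [_]; rewrite -/(lnorm _ _) ltr_pdivlMr// mulrC => h.
split; first by apply/(cl_in cL)/Uin.
have hxy : lc_in (y - x) by apply: lc_inB; exact: Uin.
rewrite -/(lnorm _ _) -clB; apply: (le_lt_trans (hC _ hxy)).
by apply: le_lt_trans h; rewrite ler_wpM2r ?lnorm_ge0// lerDl.
Qed.

Lemma is_dderive_clinear U x v : lc_in v -> is_dderive U L x v (L v).
Proof.
move=> hv; split=> [|l e e0]; first exact: cl_in.
exists 1 => // t t0 _ _.
have -> : t^-1 *: (L (x + t *: v) - L x) = L v.
  rewrite -clB addrAC subrr add0r (clZ cL) scalerA mulVf// scale1r.
  by [].
split; first exact: cl_in.
by rewrite -/(lnorm _ _) subrr lnorm0.
Qed.
End Linear.

Lemma clinear_snd (E F : lcs R) {LE : seminormed E} {LF : seminormed F} :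
  clinear (snd : lprod E F -> F).
Proof.
split=> // [x []//|l].
exists (map inr l), 1 => // x [hx1 hx2].
by rewrite mul1r [leRHS]/lnorm big_map.
Qed.

Lemma clinear_fst (E F : lcs R) {LE : seminormed E} {LF : seminormed F} :
  clinear (fst : lprod E F -> E).
Proof.
split=> // [x []//|l].
exists (map inl l), 1 => // x [hx1 hx2].
by rewrite mul1r [leRHS]/lnorm big_map.
Qed.

Lemma clinear_comp (E F G : lcs R) {LE : seminormed E} {LF : seminormed F}
    {LG : seminormed G} (L : E -> F) (L' : F -> G) :
  clinear L -> clinear L' -> clinear (L' \o L).
Proof.
move=> cL cL'; split=> [x hx|x y|a x|l] /=.
- exact/(cl_in cL')/(cl_in cL).
- by rewrite (clD cL) (clD cL').
- by rewrite (clZ cL) (clZ cL').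
have [k' [C' C'0 hC']] := cl_bound cL' l.
have [k [C C0 hC]] := cl_bound cL k'.
exists k, (C' * C); first by rewrite mulr_ge0.
move=> x hx; apply: (le_trans (hC' _ (cl_in cL hx))).
by rewrite -mulrA ler_wpM2l// hC.
Qed.

Lemma clinear_pair (E F G : lcs R) {LE : seminormed E} {LF : seminormed F}
    {LG : seminormed G} (L : E -> F) (L' : E -> G) :
  clinear L -> clinear L' -> clinear (fun x => (L x, L' x) : lprod F G).
Proof.
move=> cL cL'; split=> [x hx|x y|a x|l] /=.
- by split; [apply/(cl_in cL)|apply/(cl_in cL')].
- by rewrite (clD cL) (clD cL').
- by rewrite (clZ cL) (clZ cL').
have [k [C C0 hC]] := cl_bound cL (lefts l).
have [k' [C' C'0 hC']] := cl_bound cL' (rights l).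
exists (k ++ k'), (C + C'); first by rewrite addr_ge0.
move=> x hx; rewrite lnorm_lprod/= mulrDl lerD//.
  by apply: (le_trans (hC _ hx)); rewrite ler_wpM2l// lnorm_catl.
by apply: (le_trans (hC' _ hx)); rewrite ler_wpM2l// lnorm_catr.
Qed.

Lemma clinear_add (F : lcs R) {LF : seminormed F} :
  clinear (fun z : lprod F F => z.1 + z.2).
Proof.
split=> [x [? ?]|x y|a x|l] /=.
- exact: lc_inD.
- by rewrite addrACA.
- by rewrite scalerDr.
exists (lseqX l l), 1 => // x [hx1 hx2].
by rewrite mul1r lnorm_lseqX; apply: lnormD.
Qed.

Lemma Ck_clinear (k : nat) (E F : lcs R) {LE : seminormed E}
    {LF : seminormed F} (L : E -> F) (U : set E) : U `<=` @lc_in R E ->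
  clinear L -> Ck k U L.
Proof.
elim: k => [|k IH] in E LE L U *; move=> Uin cL.
  split=> // [x /Uin/(cl_in cL)//|]; exact: clinear_continuous.
split=> // [x /Uin/(cl_in cL)//||]; first exact: clinear_continuous.
exists (fun _ v => L v); split=> [x v Ux hv|]; first exact: is_dderive_clinear.
apply: (IH (lprod E E) _ (L \o snd)) => [z [/Uin ? ?]|]; first by split.
exact: clinear_comp clinear_snd cL.
Qed.

(** Write f (x + t v) = y + t u_t with y = f x and u_t -> u. By the mean value
    inequality, g (y + t u_t) - g y - t dg (y, u) is bounded by t times the
    oscillation of dg near (y, u), which tends to 0. *)
Lemma is_dderive_comp (E F G : lcs R) {LF : seminormed F} {LG : seminormed G}
    (U : set E) (V : set F) (f : E -> F) (g : F -> G) x v u w :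
  lopen V -> Ck 1 V g -> (forall x, U x -> V (f x)) -> U x ->
  is_dderive U f x v u -> is_dderive V g (f x) u w ->
  is_dderive U (g \o f) x v w.
Proof.
move=> oV [gin _ [dg [hdg [_ cdg _]]]] UV Ux [hu fd] hw.
have Vin := oV.1; have Vy := UV _ Ux.
set y := f x in hw Vy *.
have -> : w = dg y u by exact: is_dderive_unique oV Vy hu hw (hdg _ _ Vy hu).
split=> [|l e e0]; first by case: (hdg y u Vy hu).
have e20 : 0 < e / 2 by rewrite divr_gt0.
have yu : [set z | V z.1 /\ lc_in z.2] ((y, u) : lprod F F) by split.
have [k [d d0 {}cdg]] := cdg _ yu l _ e20.
pose k1 := lefts k; pose k2 := rights k.
have [kV [dV dV0 hV]] := oV.2 y Vy.
pose k3 := k1 ++ k2 ++ kV.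
(* On this ball around (y, u) the derivative of g oscillates by less than e/2;
   r bounds the seminorms of the increments t u_t along the segment. *)
pose r := Num.min (d / 2) dV.
have r0 : 0 < r by rewrite lt_min dV0 andbT divr_gt0.
have [d' d'0 {}fd] := fd k3 r r0.
have c0 : 0 < r + lnorm k3 u by rewrite ltr_wpDr// lnorm_ge0.
exists (Num.min d' (Num.min 1 (r / (r + lnorm k3 u)))).
  by rewrite !lt_min d'0 ltr01 divr_gt0.
move=> t t0; rewrite !lt_min => /and3P[td' t1]; rewrite ltr_pdivlMr// => tr Ut.
have := fd t t0 td' Ut; rewrite -/y; set ut := _ *: _ => -[utin utr].
have {}utr : lnorm k3 (ut - u) < r := utr.
have fE : f (x + t *: v) = y + t *: ut.
  by rewrite /ut scalerA divff// scale1r [RHS]addrC subrK.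
have utk : lnorm k3 ut < r + lnorm k3 u.
  have : lnorm k3 (ut - u + u) <= lnorm k3 (ut - u) + lnorm k3 u.
    by apply: lnormD => //; exact: lc_inB.
  by rewrite subrK => /le_lt_trans; apply; rewrite ltrD2r.
have seg s : 0 <= s <= 1 -> lc_in (s *: (t *: ut)) /\ lnorm k3 (s *: (t *: ut)) < r.
  move=> /andP[s0 s1]; split; first by do 2 apply: lc_inZ.
  rewrite lnormZ; last exact: lc_inZ.
  rewrite lnormZ// (ger0_norm s0).
  apply: le_lt_trans tr; apply: (@le_trans _ _ (`|t| * lnorm k3 ut)).
    by rewrite ler_piMl// mulr_ge0// lnorm_ge0.
  by rewrite ler_wpM2l// ltW.
have le1 z : lc_in z -> lnorm k1 z <= lnorm k3 z by move=> ?; apply: lnorm_catl.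
have le2 z : lc_in z -> lnorm k2 z <= lnorm k3 z.
  by move=> ?; apply: le_trans (lnorm_catr _ _ _) => //; apply: lnorm_catl.
have leV z : lc_in z -> lnorm kV z <= lnorm k3 z.
  by move=> ?; apply: le_trans (lnorm_catr _ _ _) => //; apply: lnorm_catr.
have segV s : 0 <= s <= 1 -> V (y + s *: (t *: ut)).
  move=> /seg[hs ls]; apply: hV; split; first by apply: lc_inD => //; exact: Vin.
  rewrite -/(lnorm _ _) addrAC subrr add0r; apply: le_lt_trans (leV _ hs) _.
  by apply: lt_le_trans ls _; rewrite ge_min lexx orbT.
have osc s : 0 <= s <= 1 ->
    lc_in (dg (y + s *: (t *: ut)) ut) /\
    lnorm l (dg (y + s *: (t *: ut)) ut - dg y u) < e / 2.
  move=> s01; have [hs ls] := seg s s01; have Vs := segV s s01.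
  apply: (cdg (y + s *: (t *: ut), ut)) => //.
  split; first by split=> //; apply: Vin.
  rewrite -/(lnorm _ _) lnorm_lprod /= addrAC subrr add0r (splitr d); apply: ltrD.
    apply: le_lt_trans (le1 _ hs) _; apply: lt_le_trans ls _.
    by rewrite ge_min lexx.
  have utu : lc_in (ut - u) by exact: lc_inB.
  apply: le_lt_trans (le2 _ utu) _; apply: lt_le_trans utr _.
  by rewrite ge_min lexx.
have gyt : lc_in (g (y + t *: ut)) by rewrite -fE; apply/gin/UV.
have gy : lc_in (g y) by apply: gin.
have dgin : lc_in (dg y u) by case: (hdg y u Vy hu).
rewrite /= fE -/y; split; first by apply/lc_inZ/lc_inB.
have nt0 : 0 < `|t| by rewrite normr_gt0.
have key : lnorm l (g (y + t *: ut) - g y - t *: dg y u) <= `|t| * (e / 2).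
  apply: (@mean_value _ _ _ _ V g y (t *: ut) (t *: dg y u)
    (fun s => t *: dg (y + s *: (t *: ut)) ut)) => //.
  - move=> s s01; apply: is_dderiveZ; [exact: segV|exact/gin/segV|].
    by apply: hdg => //; exact: segV.
  - exact: lc_inZ.
  move=> s s01; have [oin olt] := osc s s01.
  by rewrite -scalerBr lnormZ ?ltr_pM2l//; exact: lc_inB.
have -> : \sum_(j <- l) lc_norm j (t^-1 *: (g (y + t *: ut) - g y) - dg y u) =
  `|t|^-1 * lnorm l (g (y + t *: ut) - g y - t *: dg y u).
  rewrite -normfV -lnormZ; last by apply/lc_inB; [exact: lc_inB|exact: lc_inZ].
  by rewrite scalerBr (scalerA _ t) mulVf// scale1r.
rewrite mulrC ltr_pdivrMr//; apply: le_lt_trans key _.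
by rewrite mulrC ltr_pM2r// ltr_pdivrMr// ltr_pMr// ltr1n.
Qed.

(** The derivative of g o f is the composition of dg with the pair (f, df), to
    which the induction hypothesis applies. *)
Lemma Ck_comp (k : nat) (E F G : lcs R) {LE : seminormed E}
    {LF : seminormed F} {LG : seminormed G}
    (U : set E) (V : set F) (f : E -> F) (g : F -> G) :
  lopen U -> lopen V -> (forall x, U x -> V (f x)) ->
  Ck k U f -> Ck k V g -> Ck k U (g \o f).
Proof.
elim: k => [|k IH] in E F G LE LF LG U V f g *; move=> oU oV UV cf cg.
  split=> // [x /UV/(Ck_lc_in cg)//|].
  exact: lcontinuous_comp UV (Ck_continuous cf) (Ck_continuous cg).
have [_ _ [df [hf cdf]]] := cf; have [_ _ [dg [hg cdg]]] := cg.
split=> // [x /UV/(Ck_lc_in cg)//||].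
  exact: lcontinuous_comp UV (Ck_continuous cf) (Ck_continuous cg).
have dfin x v : U x -> lc_in v -> lc_in (df x v) by move=> Ux /(hf x v Ux)[].
exists (fun x v => dg (f x) (df x v)); split=> [x v Ux hv|].
  apply: (is_dderive_comp oV _ UV Ux (hf _ _ Ux hv)); first exact: Ck_leq cg.
  by apply: hg; [exact: UV|exact: dfin].
have oU2 : @lopen R (lprod E E) [set z | U z.1 /\ lc_in z.2].
  exact: lopen_lprod oU lopen_in.
pose ff (z : lprod E E) : lprod F F := (f z.1, df z.1 z.2).
apply: (IH (lprod E E) (lprod F F) G _ _ _ _
  [set z | V z.1 /\ lc_in z.2] ff (fun z => dg z.1 z.2)) => //.
- exact: lopen_lprod oV lopen_in.
- by move=> z [Uz hz]; split; [exact: UV|exact: dfin].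
apply: Ck_pair => //; first exact: oU2.1.
apply: (IH (lprod E E) E F _ _ _ _ U fst f) => //; first by move=> z [].
  by apply: Ck_clinear; [exact: oU2.1|exact: clinear_fst].
exact: Ck_pred cf.
Qed.

End ChainRule.

Section Bilinear.
Context {R : realType}.

Record cbilinear (E F G : lcs R) (B : E -> F -> G) : Prop := CBilinear {
  cb_in : forall x y, lc_in x -> lc_in y -> lc_in (B x y);
  cbDl : forall x x' y, B (x + x') y = B x y + B x' y;
  cbDr : forall x y y', B x (y + y') = B x y + B x y';
  cbZl : forall a x y, B (a *: x) y = a *: B x y;
  cbZr : forall a x y, B x (a *: y) = a *: B x y;
  cb_bound : forall l, exists k k', exists2 C : R, 0 <= C &
    forall x y, lc_in x -> lc_in y ->
      lnorm l (B x y) <= C * (lnorm k x * lnorm k' y)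
}.

Lemma Ck_clinear_comp (k : nat) (E F G : lcs R) {LE : seminormed E}
    {LF : seminormed F} {LG : seminormed G} (U : set E) (f : E -> F)
    (L : F -> G) : lopen U -> clinear L -> Ck k U f ->
  Ck k U (fun x => L (f x)).
Proof.
move=> oU cL cf; apply: (Ck_comp oU lopen_in (Ck_lc_in cf) cf).
exact: Ck_clinear.
Qed.

Lemma Ck_add (k : nat) (E F : lcs R) {LE : seminormed E} {LF : seminormed F}
    (U : set E) (f g : E -> F) :
  lopen U -> Ck k U f -> Ck k U g -> Ck k U (fun x => f x + g x).
Proof.
move=> oU cf cg.
exact: (Ck_clinear_comp oU clinear_add (Ck_pair oU.1 cf cg)).
Qed.

Section OneMap.
Context {E F G : lcs R} {LE : seminormed E} {LF : seminormed F}
  {LG : seminormed G} (B : E -> F -> G) (cB : cbilinear B).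

Lemma cbBl x x' y : B (x - x') y = B x y - B x' y.
Proof. by rewrite (cbDl cB) -scaleN1r (cbZl cB) scaleN1r. Qed.

Lemma cbBr x y y' : B x (y - y') = B x y - B x y'.
Proof. by rewrite (cbDr cB) -scaleN1r (cbZr cB) scaleN1r. Qed.

Lemma cbilinear_continuous :
  lcontinuous (@lc_in R (lprod E F)) (fun z : lprod E F => B z.1 z.2).
Proof.
move=> [x y] [/= hx hy] l e e0.
have [k [k' [C C0 hC]]] := cb_bound cB l.
have nx : 0 <= lnorm k x by apply: lnorm_ge0.
have ny : 0 <= lnorm k' y by apply: lnorm_ge0.
pose c := C * (lnorm k x + lnorm k' y + 1) + 1.
have c0 : 0 < c by rewrite ltr_wpDl// mulr_ge0// !addr_ge0.
exists (lseqX k k'), (Num.min 1 (e / c)).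
  by rewrite lt_min ltr01 divr_gt0.
have hxy : @lc_in R (lprod E F) (x, y) by split.
move=> [x' y'] _ /(lball_lprod hxy)/= [[hx' nx'] [hy' ny']].
have {}nx' : lnorm k (x' - x) < Num.min 1 (e / c) := nx'.
have {}ny' : lnorm k' (y' - y) < Num.min 1 (e / c) := ny'.
split; first exact: cb_in.
change (lnorm l (B x' y' - B x y) < e).
have dx : lc_in (x' - x) by exact: lc_inB.
have dy : lc_in (y' - y) by exact: lc_inB.
have -> : B x' y' - B x y = B (x' - x) y' + B x (y' - y).
  by rewrite cbBl cbBr subrKA.
have b1 : lnorm l (B (x' - x) y') <= C * (lnorm k (x' - x) * (lnorm k' y + 1)).
  apply: (le_trans (hC _ _ dx hy')); rewrite ler_wpM2l// ler_wpM2l ?lnorm_ge0//.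
  have : lnorm k' (y + (y' - y)) <= lnorm k' y + lnorm k' (y' - y) by exact: lnormD.
  rewrite (addrC y) subrK => /le_trans; apply; rewrite lerD2l ltW//.
  by move: ny'; rewrite lt_min => /andP[].
have b2 : lnorm l (B x (y' - y)) <= C * (lnorm k x * lnorm k' (y' - y)).
  exact: hC.
have b3 : lnorm l (B (x' - x) y' + B x (y' - y)) <=
    lnorm l (B (x' - x) y') + lnorm l (B x (y' - y)).
  by apply: lnormD; apply: cb_in.
apply: (le_lt_trans b3); apply: (le_lt_trans (lerD b1 b2)).
have ec0 : 0 < e / c by rewrite divr_gt0.
move: nx' ny'; rewrite !lt_min => /andP[_ nx'] /andP[_ ny'].
apply: (@le_lt_trans _ _ (C * (lnorm k x + lnorm k' y + 1) * (e / c))).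
  rewrite -mulrDr -mulrA ler_wpM2l//.
  have -> : lnorm k x + lnorm k' y + 1 = (lnorm k' y + 1) + lnorm k x.
    by lra.
  rewrite mulrDl; apply: lerD; last by rewrite ler_wpM2l// ltW.
  by rewrite mulrC ler_wpM2l ?addr_ge0// ltW.
rewrite mulrA ltr_pdivrMr// mulrC ltr_pM2l//.
by rewrite /c ltrDl.
Qed.

Lemma is_dderive_cbilinear U x y v w : lc_in x -> lc_in y ->
  lc_in v -> lc_in w ->
  is_dderive U (fun z : lprod E F => B z.1 z.2) (x, y) (v, w) (B v y + B x w).
Proof.
move=> hx hy hv hw; have hB := cb_in cB.
split=> [|l e e0]; first by apply: lc_inD; exact: hB.
have n0 : 0 <= lnorm l (B v w) by apply/lnorm_ge0/hB.
have n1 : 0 < lnorm l (B v w) + 1 by rewrite ltr_wpDl.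
exists (e / (lnorm l (B v w) + 1)); first by rewrite divr_gt0.
move=> t t0; rewrite ltr_pdivlMr// => te _ /=.
have -> : t^-1 *: (B (x + t *: v) (y + t *: w) - B x y) =
    B v y + B x w + t *: B v w.
  rewrite (cbDl cB) !(cbDr cB) !(cbZl cB) !(cbZr cB).
  rewrite -[X in X - _]addrA [X in X - _]addrC addrK !scalerDr !scalerA.
  by rewrite mulrA mulVf// mul1r !scale1r addrCA addrA.
split; first by apply: lc_inD; [apply: lc_inD; exact: hB|exact/lc_inZ/hB].
change (lnorm l (B v y + B x w + t *: B v w - (B v y + B x w)) < e).
rewrite [X in lnorm _ X]addrAC subrr add0r lnormZ; last exact: hB.
by apply: le_lt_trans te; rewrite ler_wpM2l// lerDl.
Qed.
End OneMap.

(** The derivative B (v, y) + B (x, w) is a sum of compositions of B itself with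
    continuous linear maps. *)
Lemma Ck_cbilinear (k : nat) (E F G : lcs R) {LE : seminormed E}
    {LF : seminormed F} {LG : seminormed G} (B : E -> F -> G) :
  cbilinear B ->
  Ck k (@lc_in R (lprod E F)) (fun z : lprod E F => B z.1 z.2).
Proof.
move=> cB; have hB := cb_in cB.
elim: k => [|k IH].
  by split=> // [[x y] [/= ? ?]|]; [exact: hB|exact: cbilinear_continuous].
split=> [[x y] [/= ? ?]||]; [exact: hB|exact: cbilinear_continuous|].
exists (fun z h => B h.1 z.2 + B z.1 h.2); split.
  by move=> [x y] [v w] [/= ? ?] [/= ? ?]; exact: is_dderive_cbilinear.
pose EF := lprod E F.
have oU : @lopen R (lprod EF EF) [set z | lc_in z.1 /\ lc_in z.2].
  exact: lopen_in.
apply: (@Ck_add _ (lprod EF EF)) => //.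
  apply: (@Ck_comp _ _ (lprod EF EF) EF G _ _ _ _ (@lc_in R EF)
    (fun z => (z.2.1, z.1.2)) (fun z => B z.1 z.2)); [exact: oU|exact: lopen_in|..].
  - by move=> [[? ?] [? ?]] [[? ?] [? ?]].
  - apply: Ck_clinear => //; apply: clinear_pair.
      exact: (clinear_comp clinear_snd clinear_fst).
    exact: (clinear_comp clinear_fst clinear_snd).
  exact: IH.
apply: (@Ck_comp _ _ (lprod EF EF) EF G _ _ _ _ (@lc_in R EF)
    (fun z => (z.1.1, z.2.2)) (fun z => B z.1 z.2)); [exact: oU|exact: lopen_in|..].
- by move=> [[? ?] [? ?]] [[? ?] [? ?]].
- apply: Ck_clinear => //; apply: clinear_pair.
    exact: (clinear_comp clinear_fst clinear_fst).
  exact: (clinear_comp clinear_snd clinear_snd).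
exact: IH.
Qed.

Lemma Ck_cbilinear_comp (k : nat) (D E F G : lcs R) {LD : seminormed D}
    {LE : seminormed E} {LF : seminormed F} {LG : seminormed G} (U : set D)
    (f : D -> E) (g : D -> F) (B : E -> F -> G) :
  lopen U -> cbilinear B -> Ck k U f -> Ck k U g ->
  Ck k U (fun x => B (f x) (g x)).
Proof.
move=> oU cB cf cg.
apply: (Ck_comp oU lopen_in _ (Ck_pair oU.1 cf cg) (Ck_cbilinear k cB)).
by move=> x Ux; split; [exact: Ck_lc_in cf _ Ux|exact: Ck_lc_in cg _ Ux].
Qed.

End Bilinear.

(** * Complex structures defined by parametrizations *)

Lemma lsmooth_dderive {R : realType} (E G : lcs R) (U : set E) (f : E -> G) x v : lsmooth U f ->
  U x -> lc_in v -> exists w, is_dderive U f x v w.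
Proof.
by move=> /(_ 1%N)[_ _ [df [hdf _]]] Ux hv; exists (df x v); exact: hdf.
Qed.

Lemma lopen_preimage {R : realType} (E G : lcs R) {LE : seminormed E}
    {LG : seminormed G} (D : set E) (f : E -> G)
    (Om : set G) :
  lopen D -> lcontinuous D f -> lopen Om -> lopen [set a | D a /\ Om (f a)].
Proof.
move=> [Din oD] cf [Oin oO]; split=> [a [/Din//]|a [Da Oa]].
have [l [e e0 he]] := oD a Da; have [l' [e' e'0 he']] := oO _ Oa.
have [k [d d0 hd]] := cf a Da l' e' e'0.
exists (l ++ k), (Num.min e d); first by rewrite lt_min e0.
move=> b hb; have Db : D b by apply/he/(lball_catl (Din _ Da) hb).
by split=> //; apply/he'/hd => //; exact: lball_catr (Din _ Da) hb.
Qed.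

Section ComplexStructures.
Context {R : realType} {E F : lcs R} {LE : seminormed E} {LF : seminormed F}.
Variables (I : E -> E) (hI : forall v, lc_in v -> lc_in (I v)).
Variables (X : set F) (T : F -> set F) (J : F -> F -> F).

Lemma smooth_param_inj (D : set E) (Phi : E -> F) :
  smooth_param X T D Phi -> {in D &, injective Phi}.
Proof.
move=> [_ _ _ hr _] a b /set_mem Da /set_mem Db ab.
have [Om [r [_ Oa _ _ rK]]] := hr a Da.
by rewrite -(rK a Da Oa) ab rK// -ab.
Qed.

(** Differentiate r o Phi = id. *)
Lemma smooth_param_retract (D : set E) (Phi : E -> F) (Om : set F)
    (r : F -> E) a b h : lopen D -> lsmooth D Phi -> lopen Om -> Om (Phi a) ->
  lsmooth Om r -> (forall b, D b -> Om (Phi b) -> r (Phi b) = b) ->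
  D a -> lc_in b -> is_dderive D Phi a b h -> is_dderive Om r (Phi a) h b.
Proof.
move=> oD sPhi oO Oa sr rK Da hb dh.
have [w dr] := lsmooth_dderive sr Oa dh.1.
pose W := [set a | D a /\ Om (Phi a)].
have oW : lopen W by exact: lopen_preimage oD (Ck_continuous (sPhi 0%N)) oO.
have Wa : W a by [].
have dW : is_dderive W (r \o Phi) a b w.
  apply: (is_dderive_comp oO (sr 1%N) _ Wa _ dr); first by move=> x [].
  by apply: is_dderive_sub dh => x [].
have cid : clinear (@id E).
  by split=> // l; exists l, 1 => // x _; rewrite mul1r.
suff -> : b = w by [].
apply: (is_dderive_unique (f := id) oW Wa hb); first exact: is_dderive_clinear.
by apply: is_dderive_ext dW => // x [Dx Ox]; exact: rK.
Qed.

(** The local left inverse provided by a parametrization is differentiable, so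
    that the differential of a parametrization is injective. *)
Lemma smooth_param_dinj (D : set E) (Phi : E -> F) a b b' h :
  smooth_param X T D Phi -> D a -> lc_in b -> lc_in b' ->
  is_dderive D Phi a b h -> is_dderive D Phi a b' h -> b = b'.
Proof.
move=> [oD sPhi _ hr _] Da hb hb' dh dh'.
have [Om [r [oO Oa sr _ rK]]] := hr a Da.
pose proof (smooth_param_retract oD sPhi oO Oa sr rK Da hb dh) as db.
pose proof (smooth_param_retract oD sPhi oO Oa sr rK Da hb' dh') as db'.
exact: is_dderive_unique oO Oa dh.1 db db'.
Qed.

(** Near a point a with Phi a = Phi' a' the transition is r o Phi, where r is a
    local left inverse of Phi' at a'. *)
Lemma smooth_transition (D D' : set E) (Phi Phi' : E -> F) :
  smooth_param X T D Phi -> smooth_param X T D' Phi' ->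
  let U := [set a | D a /\ (Phi' @` D') (Phi a)] in
  lopen U /\ exists tau : E -> E, lsmooth U tau /\
    forall a, U a -> D' (tau a) /\ Phi' (tau a) = Phi a.
Proof.
move=> [oD sPhi PhiX _ _] [oD' _ _ hr' _] U.
have loc a : U a -> exists (V : set E) (r : F -> E),
    [/\ lopen V, V a, V `<=` U, lsmooth V (r \o Phi) &
      forall b a', V b -> D' a' -> Phi' a' = Phi b -> r (Phi b) = a'].
  move=> [Da [a' Da' aa']].
  have [Om [r [oO Oa sr OX rK]]] := hr' a' Da'.
  pose proof (lopen_preimage oD (Ck_continuous (sPhi 0%N)) oO) as oV.
  exists [set b | D b /\ Om (Phi b)], r; split=> //.
  - by split=> //; rewrite -aa'.
  - move=> b [Db Ob]; split=> //; apply: OX; split=> //.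
    by apply: PhiX; exists b.
  - move=> k; apply: (Ck_comp oV oO _ _ (sr k)); first by move=> x [].
    by apply: Ck_sub (sPhi k) => x [].
  - by move=> b c [Db Ob] Dc cb; rewrite -cb; apply: rK => //; rewrite cb.
split.
  split=> [a [/(oD.1)//]|a /loc[V [r [[_ oV] Va VU _ _]]]].
  have [l [e e0 he]] := oV a Va.
  by exists l, e => // b /he/VU.
pose tau a := xget 0 [set a' | D' a' /\ Phi' a' = Phi a].
have tauP a : U a -> D' (tau a) /\ Phi' (tau a) = Phi a.
  move=> [Da [a' Da' aa']]; rewrite /tau.
  by case: xgetP => [c _ []//|/(_ a')[]].
exists tau; split=> // k; apply: Ck_near => [a [/(oD.1)]//|a /loc].
move=> [V [r [oV Va VU sr rK]]]; exists V; split=> //.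
apply: Ck_ext (sr k) => b Vb /=.
by have [Dt bt] := tauP _ (VU _ Vb); exact: rK.
Qed.

(** If Phi' o tau = Phi then dPhi' (dtau (I v)) = dPhi (I v) = J (dPhi v) =
    J (dPhi' (dtau v)) = dPhi' (I (dtau v)), and dPhi' is injective. *)
Lemma J_holomorphic_transition (D D' U : set E) (Phi Phi' : E -> F)
    (tau : E -> E) : U `<=` D -> lopen U ->
  J_holomorphic I J D Phi -> smooth_param X T D' Phi' ->
  J_holomorphic I J D' Phi' -> lsmooth U tau ->
  (forall a, U a -> D' (tau a) /\ Phi' (tau a) = Phi a) ->
  holomorphic I U tau.
Proof.
move=> UD oU hPhi spPhi' hPhi' stau tauP; split=> // x v w Ux hv dw.
have [oD' sPhi' _ _ _] := spPhi'.
have UD' y : U y -> D' (tau y) by case/tauP.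
have comp u u' h : lc_in u -> is_dderive U tau x u u' ->
    is_dderive D' Phi' (tau x) u' h -> is_dderive D Phi x u h.
  move=> hu du dh; apply: (is_dderive_near D oU Ux hu).
  pose proof (is_dderive_comp oD' (sPhi' 1%N) UD' Ux du dh) as cmp; move: cmp.
  by apply: is_dderive_ext => // y /tauP[].
have [h dh] := lsmooth_dderive sPhi' (UD' _ Ux) dw.1.
have dI := hPhi x v h (UD _ Ux) hv (comp _ _ _ hv dw dh).
have dI' := hPhi' _ w h (UD' _ Ux) dw.1 dh.
have [w2 dw2] := lsmooth_dderive stau Ux (hI hv).
have [h2 dh2] := lsmooth_dderive sPhi' (UD' _ Ux) dw2.1.
have h2E : h2 = J (Phi x) h.
  apply: (is_dderive_unique oU Ux (hI hv)).
    exact: is_dderive_sub UD (comp _ _ _ (hI hv) dw2 dh2).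
  exact: is_dderive_sub UD dI.
suff -> : I w = w2 by [].
apply: (smooth_param_dinj spPhi' (UD' _ Ux) (hI dw.1) dw2.1 dI').
by rewrite (tauP _ Ux).2 -h2E.
Qed.

Lemma holomorphic_transition_smooth_param (D D' : set E) (Phi Phi' : E -> F) :
  smooth_param X T D Phi -> J_holomorphic I J D Phi ->
  smooth_param X T D' Phi' -> J_holomorphic I J D' Phi' ->
  holomorphic_transition I (D, Phi) (D', Phi').
Proof.
move=> sp hPhi sp' hPhi'; pose proof (smooth_transition sp sp') as [oU [tau [stau tauP]]].
split=> //; exists tau; split=> //.
by apply: J_holomorphic_transition oU hPhi sp' hPhi' stau tauP => x [].
Qed.

(** Here Phi = Psi o tau and Psi = Phi o tau'. A local left inverse of Phi is
    tau' o r, with r one of Psi; dPhi and dPsi have the same range because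
    dtau and dtau' are inverse to each other. *)
Lemma smooth_param_transfer (D0 D : set E) (Psi Phi : E -> F) :
  smooth_param X T D0 Psi -> J_holomorphic I J D0 Psi -> Psi @` D0 = X ->
  lopen D -> {in D &, injective Phi} -> Phi @` D `<=` X ->
  holomorphic_transition I (D, Phi) (D0, Psi) ->
  holomorphic_transition I (D0, Psi) (D, Phi) ->
  smooth_param X T D Phi /\ J_holomorphic I J D Phi.
Proof.
move=> [oD0 sPsi _ hr0 rg0] hPsi PsiX oD injPhi PhiX.
move=> [_ [tau [[stau htau] tauP]]] [oU' [tau' [[stau' htau'] tauP']]].
have UE : [set a | D a /\ (Psi @` D0) (Phi a)] = D.
  apply/seteqP; split=> [a []//|a Da]; split=> //.
  by rewrite PsiX; apply: PhiX; exists a.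
rewrite /= UE in stau htau.
have {}tauP a : D a -> D0 (tau a) /\ Psi (tau a) = Phi a.
  by move=> Da; apply: tauP; rewrite /= -UE in Da.
pose U' := [set a | D0 a /\ (Phi @` D) (Psi a)].
rewrite /= -/U' in oU' stau' htau'.
have {}tauP' a : U' a -> D (tau' a) /\ Phi (tau' a) = Psi a by apply: tauP'.
have inj a b : D a -> D b -> Phi a = Phi b -> a = b.
  by move=> Da Db; apply: injPhi; exact/mem_set.
have tauD a : D a -> D0 (tau a) by case/tauP.
have tauU' a : D a -> U' (tau a).
  by move=> Da; have [? e] := tauP a Da; split=> //; rewrite e; exists a.
have U'D P : U' P -> D (tau' P) by case/tauP'.
have tauK a : D a -> tau' (tau a) = a.
  move=> Da; have [D1 e1] := tauP' _ (tauU' _ Da).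
  by apply: inj => //; rewrite e1 (tauP a Da).2.
have sPhi : lsmooth D Phi.
  move=> k; pose proof (Ck_comp oD oD0 tauD (stau k) (sPsi k)) as cmp; move: cmp.
  by apply: Ck_ext => a /tauP[].
have dPhi a b w h : D a -> lc_in b -> is_dderive D tau a b w ->
    is_dderive D0 Psi (tau a) w h -> is_dderive D Phi a b h.
  move=> Da hb dw dh; pose proof (is_dderive_comp oD0 (sPsi 1%N) tauD Da dw dh) as cmp; move: cmp.
  by apply: is_dderive_ext => // c /tauP[].
have rangeT a h : D a ->
    (exists2 b, lc_in b & is_dderive D Phi a b h) <->
    (exists2 v, lc_in v & is_dderive D0 Psi (tau a) v h).
  move=> Da; split=> [[b hb dh]|[v hv dh]].
    have [w dw] := lsmooth_dderive stau Da hb.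
    have [h' dh'] := lsmooth_dderive sPsi (tauD _ Da) dw.1.
    exists w; first exact: dw.1.
    by rewrite (is_dderive_unique oD Da hb dh (dPhi _ _ _ _ Da hb dw dh')).
  have Ua := tauU' _ Da.
  have [b db] := lsmooth_dderive stau' Ua hv; exists b; first exact: db.1.
  have [h' dh'] := lsmooth_dderive sPhi Da db.1.
  suff -> : h = h' by [].
  apply: (is_dderive_unique oU' Ua hv).
    by apply: is_dderive_sub dh => P [].
  have : is_dderive U' (Phi \o tau') (tau a) v h'.
    by apply: (is_dderive_comp oD (sPhi 1%N) U'D Ua db); rewrite tauK.
  by apply: is_dderive_ext => // P /tauP'[].
split; last first.
  move=> a b h Da hb dh; have [w dw] := lsmooth_dderive stau Da hb.
  have [h' dh'] := lsmooth_dderive sPsi (tauD _ Da) dw.1.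
  pose proof (is_dderive_unique oD Da hb dh (dPhi _ _ _ _ Da hb dw dh')) as hh'.
  rewrite -{}hh' in dh'.
  apply: (dPhi _ _ (I w)) => //; first exact: hI.
    by apply: htau => //; rewrite -UE in Da.
  by rewrite -(tauP a Da).2; apply: hPsi => //; [exact: tauD|exact: dw.1].
split=> // [a Da|a Da].
  have [Om [r [oO Oa sr OX rK]]] := hr0 _ (tauD _ Da).
  rewrite (tauP a Da).2 in Oa.
  have ra : r (Phi a) = tau a.
    by rewrite -(tauP a Da).2 rK//; [exact: tauD|rewrite (tauP a Da).2].
  exists [set g | Om g /\ U' (r g)], (tau' \o r); split=> //.
  - exact: lopen_preimage oO (Ck_continuous (sr 0%N)) oU'.
  - by split=> //; rewrite ra; exact: tauU'.
  - move=> k; apply: (Ck_comp _ oU' _ _ (stau' k)); last 1 first.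
    + by apply: Ck_sub (sr k) => g [].
    + exact: lopen_preimage oO (Ck_continuous (sr 0%N)) oU'.
    + by move=> g [].
  - move=> g [Xg [Og Ug]]; have [P DP Pg] := OX _ (conj Xg Og).
    move: Ug; rewrite -Pg rK//; last by rewrite Pg.
    by case.
  move=> b Db [Ob Ub] /=.
  have [P DP Pg] : (Psi @` D0) (Phi b) by rewrite PsiX; apply: PhiX; exists b.
  rewrite -Pg rK//; last by rewrite Pg.
  have UP : U' P by split=> //; rewrite Pg; exists b.
  have [DP' eP'] := tauP' P UP.
  by apply: inj => //; rewrite eP'.
rewrite -(tauP a Da).2 -(rg0 _ (tauD _ Da)).
by apply/seteqP; split=> h; rewrite /= -?rangeT// => /rangeT; exact.
Qed.

Lemma acs_atlas_eq_param_atlas (D0 : set E) (Psi : E -> F) :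
  smooth_param X T D0 Psi -> J_holomorphic I J D0 Psi -> Psi @` D0 = X ->
  acs_atlas E I F X T J = param_atlas E I F X D0 Psi.
Proof.
move=> sp0 h0 PsiX; apply/seteqP; split=> -[D Phi] /=.
  move=> [/= sp hPhi]; split=> /=.
  - by case: sp.
  - exact: smooth_param_inj sp.
  - by case: sp.
  - exact: holomorphic_transition_smooth_param.
  - exact: holomorphic_transition_smooth_param.
move=> [/= oD inj PhiX t t'].
exact: (smooth_param_transfer sp0 h0 PsiX oD inj PhiX t t').
Qed.

End ComplexStructures.

(** * Matrix norms *)

Section MatrixNorm.
Context {R : realType}.

Lemma mx_entry_le m n (A : 'M[R]_(m, n)) i j : `|A i j| <= `|A|.
Proof. by rewrite [leRHS]/Num.Def.normr/= mx_normrE; exact: (le_bigmax _ _ (i, j)). Qed.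

Lemma mx_norm_le m n (A : 'M[R]_(m, n)) e :
  0 <= e -> (forall i j, `|A i j| <= e) -> `|A| <= e.
Proof.
move=> e0 h; rewrite [leLHS]/Num.Def.normr/= mx_normrE.
by apply: bigmax_le => // -[i j] _; exact: h.
Qed.

Lemma mx_norm_mulmx m n p (A : 'M[R]_(m, n)) (B : 'M[R]_(n, p)) :
  `|A *m B| <= n%:R * (`|A| * `|B|).
Proof.
apply: mx_norm_le => [|i j]; first by rewrite !mulr_ge0.
rewrite mxE; apply: (le_trans (ler_norm_sum _ _ _)).
apply: (@le_trans _ _ (\sum_(k < n) `|A| * `|B|)).
  by apply: ler_sum => k _; rewrite normrM ler_pM ?mx_entry_le.
by rewrite sumr_const card_ord mulr_natl.
Qed.

Lemma mx_norm_trmx m n (A : 'M[R]_(m, n)) : `|A^T| = `|A|.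
Proof.
apply: le_anti; apply/andP; split; apply: mx_norm_le => // i j.
  by rewrite mxE mx_entry_le.
by rewrite -[A i j](mxE trmx_key (fun i j => A j i)) mx_entry_le.
Qed.

End MatrixNorm.

(** * Differentiability from continuous partial derivatives *)

Section PartialDerivatives.
Context {R : realType}.

(** A normed space as a locally convex space, through which the mean value
    inequality applies to maps of normed spaces. *)
Definition normed_lcs (V : normedModType R) : lcs R :=
  @Lcs R V setT unit (fun _ x => `|x|).

#[export] Instance normed_lcs_seminormed (V : normedModType R) :
  seminormed (normed_lcs V).
Proof.
split=> //= [_ x y _ _|_ a x _|x _ /(_ tt)/normr0_eq0//].
  exact: ler_normD.
exact: normrZ.
Qed.

Lemma lnorm_normed (V : normedModType R) (l : seq unit) (x : V) :
  @lnorm R (normed_lcs V) l x = `|x| * (size l)%:R.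
Proof. by rewrite /lnorm big_const_seq count_predT iter_addr addr0 mulr_natr. Qed.

Lemma derivable_is_dderive (V W : normedModType R) (U : set V) (f : V -> W)
    x v : derivable f x v ->
  @is_dderive R (normed_lcs V) (normed_lcs W) U f x v ('D_v f x).
Proof.
move=> /cvgrPdist_lt df; split=> // l e e0.
have n0 : 0 < (size l)%:R + 1 :> R by rewrite ltr_wpDl.
have := df (e / ((size l)%:R + 1)) (divr_gt0 e0 n0).
rewrite -[lim _]/('D_v f x) => /nbhs_ballP[d /= d0 hd].
exists d => // t t0 td _; split=> //.
have {hd} := hd t; rewrite /ball /= sub0r normrN => /(_ td t0).
rewrite distrC ltr_pdivlMr// [t *: v + x]addrC => h.
rewrite -/(@lnorm R (normed_lcs W) _ _) lnorm_normed.
by apply: le_lt_trans h; rewrite ler_wpM2l// lerDl.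
Qed.

Lemma mean_value_normed (V W : normedModType R) (f : V -> W) x v (w : W) c :
  (forall s, 0 <= s <= 1 -> derivable f (x + s *: v) v) ->
  (forall s, 0 <= s <= 1 -> `|'D_v f (x + s *: v) - w| < c) ->
  `|f (x + v) - f x - w| <= c.
Proof.
move=> df hc.
have -> : `|f (x + v) - f x - w| =
    @lnorm R (normed_lcs W) [:: tt] (f (x + v) - f x - w).
  by rewrite lnorm_normed mulr1.
apply: (@mean_value R (normed_lcs V) (normed_lcs W) _ setT f x v w
  (fun s => 'D_v f (x + s *: v))) => // s s01.
  by apply: derivable_is_dderive; apply: df.
by rewrite lnorm_normed mulr1; apply: hc.
Qed.

Lemma differentiable_approx (V W : normedModType R) (f : V -> W)
    (df : {linear V -> W}) x : continuous df ->
  (forall e : R, 0 < e ->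
    \forall h \near (0 : V), `|f (x + h) - f x - df h| <= e * `|h|) ->
  differentiable f x.
Proof.
move=> cdf h.
have hf : f \o shift x = cst (f x) + df +o_ 0 id.
  apply/eqaddoP => e e0; near=> y.
  rewrite [leLHS](_ : _ = `|f (x + y) - f x - df y|); first by near: y; exact: h.
  by congr (`|_|); rewrite -[LHS]/(f (y + x) - (f x + df y)) opprD addrA [y + x]addrC.
by apply/diff_locallyP; rewrite (diff_unique cdf hf).
Unshelve. all: by end_near. Qed.

Lemma derivableZv (V W : normedModType R) (f : V -> W) x v (c : R) :
  derivable f x v -> derivable f x (c *: v) /\ 'D_(c *: v) f x = c *: 'D_v f x.
Proof.
move=> dv.
have [->|c0] := eqVneq c 0.
  by rewrite !scale0r; split; [exact: derivable0|exact: derive0].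
suff h : (fun h => h^-1 *: (f (h *: (c *: v) + x) - f x)) @ 0^' --> c *: 'D_v f x.
  by split; [apply/cvg_ex; eexists; exact: h|exact/cvg_lim].
apply/cvgrPdist_lt => e e0.
have c1 : 0 < `|c| by rewrite normr_gt0.
have /cvgrPdist_lt/(_ _ (divr_gt0 e0 c1)) := dv.
rewrite -[lim _]/('D_v f x) => /nbhs_ballP[d /= d0 hd].
apply/nbhs_ballP; exists (d / `|c|) => /=; first exact: divr_gt0.
move=> t; rewrite /ball /= sub0r normrN ltr_pdivlMr// => td t0.
have := hd (t * c); rewrite /ball /= sub0r normrN normrM => /(_ td).
rewrite mulf_neq0// => /(_ isT); rewrite scalerA ltr_pdivlMr//.
apply: le_lt_trans; rewrite [leRHS]mulrC -normrZ [in leRHS]scalerBr scalerA invfM.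
by rewrite mulrCA divff// mulr1.
Qed.

(** The partial increments along the coordinates telescope; each of them is
    estimated by the mean value inequality. *)
Lemma partial_increments m (W : normedModType R) (f : 'rV[R]_m -> W) x (e d : R) :
  0 < e ->
  (forall y, `|y - x| < d -> forall a : 'I_m,
     derivable f y (delta_mx 0 a) /\
     `|'D_(delta_mx 0 a) f y - 'D_(delta_mx 0 a) f x| < e) ->
  forall h : 'rV[R]_m, `|h| < d ->
  `|f (x + h) - f x - \sum_a h 0 a *: 'D_(delta_mx 0 a) f x| <= m%:R * (e * `|h|).
Proof.
move=> e0 hf h hd.
pose p k : 'rV[R]_m := \row_a (if (a < k)%N then h 0 a else 0).
have hle (a : 'I_m) : `|h 0 a| <= `|h|.
  exact: mx_entry_le.
suff key k : (k <= m)%N -> `|f (x + p k) - f x -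
    \sum_(a < m | (a < k)%N) h 0 a *: 'D_(delta_mx 0 a) f x| <= k%:R * (e * `|h|).
  have := key m (leqnn _).
  have -> : p m = h by apply/rowP => a; rewrite mxE ltn_ord.
  by rewrite (eq_bigl predT)// => a; rewrite ltn_ord.
elim: k => [_|k IH km].
  have -> : p 0 = 0 by apply/rowP => a; rewrite !mxE.
  by rewrite big_pred0// addr0 !subrr normr0 mul0r.
pose a := Ordinal km; set D := 'D_(delta_mx 0 a) f x.
have pS : p k.+1 = p k + h 0 a *: delta_mx 0 a.
  apply/rowP => b; rewrite !mxE eqxx /= -(inj_eq val_inj) /= ltnS leq_eqVlt.
  case: (ltngtP b k) => [_|_|bk] /=; rewrite ?mulr0 ?addr0//.
  by rewrite add0r mulr1 (_ : b = a)//; exact/val_inj.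
have sumS : \sum_(b < m | (b < k.+1)%N) h 0 b *: 'D_(delta_mx 0 b) f x =
    \sum_(b < m | (b < k)%N) h 0 b *: 'D_(delta_mx 0 b) f x + h 0 a *: D.
  rewrite (bigD1 a) ?ltnSn//= addrC; congr (_ + _); apply: eq_bigl => b.
  by rewrite ltnS leq_eqVlt -(inj_eq val_inj) /=; case: ltngtP.
have psmall s : 0 <= s <= 1 -> `|p k + s *: (h 0 a *: delta_mx 0 a)| <= `|h|.
  move=> /andP[s0 s1].
  apply: mx_norm_le => // i b; rewrite !mxE ord1 eqxx /=; case: eqVneq => [->|ba] /=.
    rewrite ltnn add0r mulr1 normrM (ger0_norm s0).
    by apply: le_trans (hle a); rewrite ler_piMl.
  by rewrite !mulr0 addr0; case: ifP => // _; rewrite normr0.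
have -> : f (x + p k.+1) - f x - \sum_(b < m | (b < k.+1)%N) h 0 b *: 'D_(delta_mx 0 b) f x
   = (f (x + p k + h 0 a *: delta_mx 0 a) - f (x + p k) - h 0 a *: D) +
     (f (x + p k) - f x - \sum_(b < m | (b < k)%N) h 0 b *: 'D_(delta_mx 0 b) f x).
  by rewrite pS sumS [RHS]addrACA subrKA -opprD addrA [X in _ = _ - X]addrC.
apply: (le_trans (ler_normD _ _)).
rewrite -[k.+1%:R]natr1 mulrDl mul1r addrC lerD//; first exact: IH (ltnW km).
have near s : 0 <= s <= 1 ->
    `|x + p k + s *: (h 0 a *: delta_mx 0 a) - x| < d.
  move=> s01; rewrite addrAC [x + p k]addrC addrK.
  exact: le_lt_trans (psmall s s01) hd.
have [h0|h0] := eqVneq (h 0 a) 0.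
  by rewrite h0 !scale0r addr0 !subrr normr0 mulr_ge0// ltW.
have h0' : 0 < `|h 0 a| by rewrite normr_gt0.
apply: (@le_trans _ _ (`|h 0 a| * e)); last first.
  by rewrite mulrC ler_wpM2l// ltW.
apply: mean_value_normed => s /near/hf/(_ a)[dv clo].
  exact: (derivableZv _ dv).1.
by rewrite (derivableZv _ dv).2 -scalerBr normrZ ltr_pM2l.
Qed.

(** The error m e |h| of the linear approximation is o(h), since e bounds the
    oscillation of the partial derivatives on a small ball. *)
Lemma continuous_partial_differentiable m (W : normedModType R) (U : set 'rV[R]_m)
    (f : 'rV[R]_m -> W) x : open U -> U x ->
  (forall a y, U y -> derivable f y (delta_mx 0 a)) ->
  (forall a, {for x, continuous ('D_(delta_mx 0 a) f)}) ->
  differentiable f x.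
Proof.
move=> oU Ux df cdf.
pose L := fun h : 'rV[R]_m => \sum_a h 0 a *: 'D_(delta_mx 0 a) f x.
have Llin : linear L.
  move=> c u v; rewrite /L scaler_sumr -big_split/=; apply: eq_bigr => a _.
  by rewrite !mxE scalerDl scalerA.
pose Ll : {linear 'rV[R]_m -> W} := HB.pack L (GRing.isLinear.Build _ _ _ _ _ Llin).
have cL : continuous Ll.
  move=> y; apply: (cvg_big add_continuous (F := nbhs y)) => a _.
  by apply: cvgZr_tmp; exact: coord_continuous.
apply: (differentiable_approx (df := Ll)) => // e e0.
pose e' := e / (m%:R + 1).
have m0 : 0 < m%:R + 1 :> R by rewrite ltr_wpDl.
have e'0 : 0 < e' by rewrite divr_gt0.
have : \forall y \near x, U y /\ forall a, `|'D_(delta_mx 0 a) f y - 'D_(delta_mx 0 a) f x| < e'.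
  near=> y; split; first by near: y; exact: open_nbhs_nbhs.
  near: y; apply: filter_forall => a.
  by near do rewrite distrC; apply: cvgr_dist_lt => //; exact: cdf.
move=> /nbhs_ballP[d /= d0 hd].
apply/nbhs_ballP; exists d => // h; rewrite -ball_normE /= sub0r normrN => hh.
apply: (le_trans (@partial_increments m W f x e' d e'0 _ h hh)).
  move=> y yx a; have [|Uy ?] := hd y; first by rewrite -ball_normE /= distrC.
  by split=> //; apply: df.
rewrite mulrA ler_wpM2r// /e' mulrCA ler_piMr ?ltW//.
by rewrite ltr_pdivrMr// mul1r ltrDl.
Unshelve. all: by end_near. Qed.

Lemma jacobian_inverse n (f g : 'rV[R]_n -> 'rV[R]_n) x :
  differentiable f x -> differentiable g (f x) ->
  (\forall y \near x, g (f y) = y) ->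
  jacobian f x *m jacobian g (f x) = 1%:M.
Proof.
move=> df dg gf; apply/row_matrixP => a; rewrite !rowE mulmx1 mulmxA.
apply: (etrans (esym (deriveEjacobian _ dg))); apply: (etrans (deriveE _ dg)).
rewrite -(deriveEjacobian (delta_mx 0 a) df) (deriveE _ df).
have dgf : differentiable (g \o f) x by exact: differentiable_comp.
apply: (etrans (esym (congr1 (@^~ (delta_mx 0 a)) (diff_comp df dg)))).
apply: (etrans (esym (deriveE _ dgf))).
by rewrite (near_eq_derive (g := id)) ?derive_id.
Qed.

End PartialDerivatives.

(** * Smooth matrix-valued functions *)

Section MatrixLimits.
Context {R : realType}.

Lemma cvg_mxP {T} {F : set_system T} {FF : Filter F} m n (f : T -> 'M[R]_(m, n))
    (A : 'M[R]_(m, n)) :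
  (f @ F --> A) <-> (forall i j, (fun x => f x i j) @ F --> A i j).
Proof.
split=> [h i j|h].
  exact: (cvg_comp f (fun M : 'M[R]_(m, n) => M i j) h (@coord_continuous R m n i j A)).
apply/cvgrPdist_lt => e e0; have e20 : 0 < e / 2 by rewrite divr_gt0.
have : \forall x \near F, forall i j, `|A i j - f x i j| < e / 2.
  apply: filter_forall => i; apply: filter_forall => j.
  by move/cvgrPdist_lt : (h i j) => /(_ _ e20).
apply: filterS => x hx.
apply: (@le_lt_trans _ _ (e / 2)); last by rewrite ltr_pdivrMr// ltr_pMr// ltr1n.
by apply: mx_norm_le => [|i j]; rewrite ?mxE ltW// !mxE.
Qed.

Lemma cvg_mulmx {T} {F : set_system T} {FF : Filter F} m n p
    (f : T -> 'M[R]_(m, n)) (g : T -> 'M[R]_(n, p)) (A : 'M[R]_(m, n))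
    (B : 'M[R]_(n, p)) :
  f @ F --> A -> g @ F --> B -> (fun x => f x *m g x) @ F --> A *m B.
Proof.
move=> /cvg_mxP hf /cvg_mxP hg; apply/cvg_mxP => i j; rewrite mxE.
under eq_cvg do rewrite mxE.
by apply: (cvg_big add_continuous) => k _; apply: cvgM.
Qed.

Lemma cvg_trmx {T} {F : set_system T} {FF : Filter F} m n
    (f : T -> 'M[R]_(m, n)) (A : 'M[R]_(m, n)) :
  f @ F --> A -> (fun x => (f x)^T) @ F --> A^T.
Proof.
move=> /cvg_mxP hf; apply/cvg_mxP => i j; rewrite mxE.
by under eq_cvg do rewrite mxE; exact: hf.
Qed.

Lemma cvg_det {T} {F : set_system T} {FF : Filter F} n (f : T -> 'M[R]_n)
    (A : 'M[R]_n) :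
  f @ F --> A -> (fun x => \det (f x)) @ F --> \det A.
Proof.
move=> /cvg_mxP hf; apply: (cvg_big add_continuous) => s _.
apply: cvgM; first exact: cvg_cst.
by apply: (cvg_big mul_continuous) => i _.
Qed.

Lemma cvg_near_unitmx {T} {F : set_system T} {FF : Filter F} n (f : T -> 'M[R]_n)
    (A : 'M[R]_n) :
  f @ F --> A -> A \in unitmx -> \forall x \near F, f x \in unitmx.
Proof.
move=> /cvg_det hf; rewrite unitmxE unitfE => A0.
have /cvgrPdist_lt/(_ `|\det A|) := hf; rewrite normr_gt0 => /(_ A0).
apply: filterS => x; rewrite unitmxE unitfE; apply: contraTneq => ->.
by rewrite subr0 ltxx.
Qed.

(** Near A the inverse is given by Cramer's formula. *)
Lemma cvg_invmx {T} {F : set_system T} {FF : Filter F} n (f : T -> 'M[R]_n)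
    (A : 'M[R]_n) :
  f @ F --> A -> A \in unitmx -> (fun x => invmx (f x)) @ F --> invmx A.
Proof.
move=> hf Au.
rewrite [X in _ --> X]/invmx Au.
apply: cvg_trans (_ : (fun x => (\det (f x))^-1 *: \adj (f x)) @ F --> _).
  apply: near_eq_cvg; near=> x; rewrite /invmx ifT//.
  by near: x; exact: cvg_near_unitmx hf Au.
apply: cvgZ.
  by apply: cvgV; [move: Au; rewrite unitmxE unitfE|exact: cvg_det].
apply/cvg_mxP => i j; rewrite mxE; under eq_cvg do rewrite mxE.
apply: cvgM; first exact: cvg_cst.
apply: cvg_det; apply/cvg_mxP => k l; rewrite !mxE.
by under eq_cvg do rewrite !mxE; move/cvg_mxP: hf; exact.
Unshelve. all: by end_near. Qed.

End MatrixLimits.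

Section MatrixDerivative.
Context {R : realType} {V : normedModType R}.
Implicit Types (y v : V).

Lemma derivable_line_cvg (W : normedModType R) (f : V -> W) y v :
  derivable f y v -> (fun h : R => f (h *: v + y)) @ 0^' --> f y.
Proof.
move=> df.
have hh : (fun h : R => h) @ 0^' --> (0 : R).
  by apply: cvg_within_filter; exact: cvg_id.
rewrite -[X in _ --> X](add0r (f y)).
apply: cvg_trans (_ : (fun h : R =>
    h *: (h^-1 *: (f (h *: v + y) - f y)) + f y) @ 0^' --> _).
  apply: near_eq_cvg; near=> h; rewrite scalerA divff ?scale1r ?subrK//.
  by near: h; exact: nbhs_dnbhs_neq.
apply: cvgD; last exact: cvg_cst.
by rewrite -[X in _ --> X](scale0r ('D_v f y)); apply: cvgZ.
Unshelve. all: by end_near. Qed.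

Lemma is_derive_cvg (W : normedModType R) (f : V -> W) y v (w : W) :
  (fun h : R => h^-1 *: (f (h *: v + y) - f y)) @ 0^' --> w ->
  derivable f y v /\ 'D_v f y = w.
Proof. by move=> h; split; [apply/cvg_ex; exists w|exact/cvg_lim]. Qed.

Lemma derive_mulmx m n p (f : V -> 'M[R]_(m, n)) (g : V -> 'M[R]_(n, p)) y v :
  derivable f y v -> derivable g y v ->
  derivable (fun z => f z *m g z) y v /\
  'D_v (fun z => f z *m g z) y = 'D_v f y *m g y + f y *m 'D_v g y.
Proof.
move=> df dg; apply: is_derive_cvg.
rewrite (_ : (fun h => _) = fun h : R =>
    (h^-1 *: (f (h *: v + y) - f y)) *m g (h *: v + y) +
    f y *m (h^-1 *: (g (h *: v + y) - g y))).
  apply: cvgD; apply: cvg_mulmx => //; first exact: derivable_line_cvg.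
  exact: cvg_cst.
apply/funext => h; rewrite -scalemxAl -scalemxAr -scalerDr; congr (_ *: _).
by rewrite mulmxBl mulmxBr subrKA.
Qed.

Lemma derive_invmx n (f : V -> 'M[R]_n) y v :
  derivable f y v -> f y \in unitmx -> {for y, continuous f} ->
  derivable (fun z => invmx (f z)) y v /\
  'D_v (fun z => invmx (f z)) y = - (invmx (f y) *m 'D_v f y *m invmx (f y)).
Proof.
move=> df fu cf; apply: is_derive_cvg.
have cl := derivable_line_cvg df.
apply: cvg_trans (_ : (fun h : R => - (invmx (f (h *: v + y)) *m
    (h^-1 *: (f (h *: v + y) - f y)) *m invmx (f y))) @ 0^' --> _).
  apply: near_eq_cvg; near=> h.
  have hu : f (h *: v + y) \in unitmx by near: h; exact: cvg_near_unitmx cl fu.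
  rewrite -scalemxAr -scalemxAl -scalerN; congr (_ *: _).
  by rewrite mulmxBr mulVmx// mulmxBl mul1mx -mulmxA mulmxV// mulmx1 opprB.
apply: cvgN; apply: cvg_mulmx; last exact: cvg_cst.
by apply: cvg_mulmx => //; exact: cvg_invmx.
Unshelve. all: by end_near. Qed.

Lemma derive_linear (W W' : normedModType R) (L : {linear W -> W'})
    (f : V -> W) y v : continuous L -> derivable f y v ->
  derivable (fun z => L (f z)) y v /\ 'D_v (fun z => L (f z)) y = L ('D_v f y).
Proof.
move=> cL df; apply: is_derive_cvg.
rewrite (_ : (fun h => _) = fun h : R => L (h^-1 *: (f (h *: v + y) - f y))).
  have df' : (fun h : R => h^-1 *: (f (h *: v + y) - f y)) @ 0^' --> 'D_v f y.
    exact: df.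
  exact: (cvg_comp _ L df' (cL _)).
by apply/funext => h; rewrite [RHS]linearZ_LR; congr (_ *: _); rewrite linearB.
Qed.

Lemma derive_add (W : normedModType R) (f g : V -> W) y v :
  derivable f y v -> derivable g y v ->
  derivable (fun z => f z + g z) y v /\
  'D_v (fun z => f z + g z) y = 'D_v f y + 'D_v g y.
Proof. by move=> df dg; split; [exact: derivableD|exact: deriveD]. Qed.

Lemma derive_sum_seq (W : normedModType R) (I : eqType) (l : seq I)
    (f : I -> V -> W) y v :
  (forall i, i \in l -> derivable (f i) y v) ->
  derivable (fun z => \sum_(i <- l) f i z) y v /\
  'D_v (fun z => \sum_(i <- l) f i z) y = \sum_(i <- l) 'D_v (f i) y.
Proof.
elim: l => [|i l IH] h.
  rewrite big_nil (_ : (fun z => _) = cst 0).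
    by split; [exact: derivable_cst|exact: derive_cst].
  by apply/funext => z; rewrite big_nil.
have [d1 e1] := IH (fun j jl => h j (mem_behead (s := i :: l) jl)).
have [d2 e2] := derive_add (h i (mem_head _ _)) d1.
rewrite (_ : (fun z => _) = fun z => f i z + \sum_(j <- l) f j z).
  by rewrite big_cons -e1.
by apply/funext => z; rewrite big_cons.
Qed.

End MatrixDerivative.

Section Smooth.
Context {R : realType} {m : nat}.
Local Notation V := 'rV[R]_m.

Definition smooth_upto {W : normedModType R} (n : nat) (U : set V) (f : V -> W) :=
  forall (s : seq 'I_m) y, (size s <= n)%N -> U y ->
    {for y, continuous (pderiv s f)} /\
    forall a, derivable (pderiv s f) y (delta_mx 0 a).

Lemma smooth_onP {W : normedModType R} (U : set V) (f : V -> W) :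
  smooth_on U f <-> forall n, smooth_upto n U f.
Proof.
split=> [h n s y _|h s y]; first exact: h.
exact: (h (size s)).
Qed.

Lemma smooth_on_upto {W : normedModType R} n (U : set V) (f : V -> W) :
  smooth_on U f -> smooth_upto n U f.
Proof. by move=> sf s y _; exact: sf. Qed.

Lemma pderiv_eq {W : normedModType R} (U : set V) (f g : V -> W) s :
  open U -> (forall y, U y -> f y = g y) ->
  forall y, U y -> pderiv s f y = pderiv s g y.
Proof.
move=> oU fg; elim: s => [|a s IH] //= y Uy.
apply: near_eq_derive; near=> z; apply: IH.
by near: z; exact: open_nbhs_nbhs.
Unshelve. all: by end_near. Qed.

Lemma continuous_derivable_eq {W : normedModType R} (U : set V) (f g : V -> W) y :
  open U -> (forall y, U y -> f y = g y) -> U y ->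
  {for y, continuous f} /\ (forall a, derivable f y (delta_mx 0 a)) ->
  {for y, continuous g} /\ (forall a, derivable g y (delta_mx 0 a)).
Proof.
move=> oU fg Uy [cf df].
have fgn : {near y, f =1 g}.
  by near=> z; apply: fg; near: z; exact: open_nbhs_nbhs.
split=> [|a]; last exact: near_eq_derivable (df a).
change (g @ nbhs y --> g y); rewrite -(fg y Uy); apply: cvg_trans cf.
exact: near_eq_cvg.
Unshelve. all: by end_near. Qed.

Lemma smooth_upto_eq {W : normedModType R} n (U : set V) (f g : V -> W) :
  open U -> (forall y, U y -> f y = g y) ->
  smooth_upto n U f -> smooth_upto n U g.
Proof.
move=> oU fg sf s y sn Uy.
apply: (continuous_derivable_eq oU (pderiv_eq s oU fg)) => //; exact: sf.
Qed.

Lemma smooth_on_eq {W : normedModType R} (U : set V) (f g : V -> W) :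
  open U -> (forall y, U y -> f y = g y) -> smooth_on U f -> smooth_on U g.
Proof.
by move=> oU fg /smooth_onP h; apply/smooth_onP => n; exact: smooth_upto_eq (h n).
Qed.

Lemma smooth_uptoS {W : normedModType R} n (U : set V) (f : V -> W) :
  smooth_upto 0 U f -> (forall a, smooth_upto n U ('D_(delta_mx 0 a) f)) ->
  smooth_upto n.+1 U f.
Proof.
move=> f0 df s y; case/lastP: s => [_ Uy|s a]; first exact: f0.
by rewrite size_rcons ltnS => sn Uy; rewrite /pderiv foldr_rcons; apply: df.
Qed.

Lemma smooth_upto_derive {W : normedModType R} n (U : set V) (f : V -> W) a :
  smooth_upto n.+1 U f -> smooth_upto n U ('D_(delta_mx 0 a) f).
Proof.
move=> sf s y sn Uy; have := sf (rcons s a) y.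
by rewrite size_rcons ltnS /pderiv foldr_rcons => /(_ sn Uy).
Qed.

Lemma pderiv_cst {W : normedModType R} s (c : W) :
  exists c', pderiv s (cst c : V -> W) = cst c'.
Proof.
elim: s => [|a s [c' IH]]; first by exists c.
exists 0; apply/funext => y; rewrite [LHS]/pderiv /= -/(pderiv s _) IH.
exact: derive_cst.
Qed.

Lemma smooth_on_cst {W : normedModType R} (U : set V) (c : W) :
  smooth_on U (cst c).
Proof.
move=> s y _; have [c' ->] := pderiv_cst s c.
by split=> [|a]; [exact: cst_continuous|exact: derivable_cst].
Qed.

Section Closure.
Variables (U : set V) (oU : open U).

Lemma pderiv_add {W : normedModType R} n (f g : V -> W) s y :
  smooth_upto n U f -> smooth_upto n U g -> (size s <= n)%N -> U y ->
  pderiv s (fun z => f z + g z) y = pderiv s f y + pderiv s g y.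
Proof.
move=> sf sg; elim: s y => [|a s IH] //= y sn Uy.
have sn' := ltnW sn.
rewrite (near_eq_derive (g := fun z => pderiv s f z + pderiv s g z)).
  by rewrite (derive_add ((sf s y sn' Uy).2 a) ((sg s y sn' Uy).2 a)).2.
near=> z; apply: IH => //.
by near: z; exact: open_nbhs_nbhs.
Unshelve. all: by end_near. Qed.

Lemma smooth_upto_add {W : normedModType R} n (f g : V -> W) :
  smooth_upto n U f -> smooth_upto n U g -> smooth_upto n U (fun z => f z + g z).
Proof.
move=> sf sg s y sn Uy.
apply: (continuous_derivable_eq oU (f := fun z => pderiv s f z + pderiv s g z)) => //.
  by move=> z Uz; rewrite (pderiv_add sf sg).
have [cf df] := sf s y sn Uy; have [cg dg] := sg s y sn Uy.
split=> [|a]; last exact: (derive_add (df a) (dg a)).1.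
change ((fun z => pderiv s f z + pderiv s g z) @ nbhs y -->
  pderiv s f y + pderiv s g y).
exact: cvgD cf cg.
Qed.

Lemma pderiv_linear {W W' : normedModType R} (L : {linear W -> W'}) n
    (f : V -> W) s y :
  continuous L -> smooth_upto n U f -> (size s <= n)%N -> U y ->
  pderiv s (fun z => L (f z)) y = L (pderiv s f y).
Proof.
move=> cL sf; elim: s y => [|a s IH] //= y sn Uy.
have sn' := ltnW sn.
rewrite (near_eq_derive (g := fun z => L (pderiv s f z))).
  by rewrite (derive_linear cL ((sf s y sn' Uy).2 a)).2.
near=> z; apply: IH => //.
by near: z; exact: open_nbhs_nbhs.
Unshelve. all: by end_near. Qed.

Lemma smooth_upto_linear {W W' : normedModType R} (L : {linear W -> W'}) n
    (f : V -> W) :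
  continuous L -> smooth_upto n U f -> smooth_upto n U (fun z => L (f z)).
Proof.
move=> cL sf s y sn Uy.
apply: (continuous_derivable_eq oU (f := fun z => L (pderiv s f z))) => //.
  by move=> z Uz; rewrite (pderiv_linear cL sf).
have [cf df] := sf s y sn Uy.
split=> [|a]; last exact: (derive_linear cL (df a)).1.
exact: (cvg_comp (pderiv s f) L cf (cL _)).
Qed.

(** The ways of distributing the factors of an iterated partial derivative over
    the two factors of a product. *)
Fixpoint splits (s : seq 'I_m) : seq (seq 'I_m * seq 'I_m) :=
  if s is a :: s' then
    [seq (a :: p.1, p.2) | p <- splits s'] ++
    [seq (p.1, a :: p.2) | p <- splits s']
  else [:: ([::], [::])].

Lemma splits_size s p :
  p \in splits s -> (size p.1 <= size s)%N /\ (size p.2 <= size s)%N.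
Proof.
elim: s p => [|a s IH] p; first by rewrite inE => /eqP->.
rewrite mem_cat => /orP[] /mapP[q /IH[q1 q2] ->] /=; split=> //.
  by rewrite ltnW.
by rewrite ltnW.
Qed.

Lemma pderiv_mulmx n p q r (f : V -> 'M[R]_(p, q)) (g : V -> 'M[R]_(q, r)) s y :
  smooth_upto n U f -> smooth_upto n U g -> (size s <= n)%N -> U y ->
  pderiv s (fun z => f z *m g z) y =
    \sum_(t <- splits s) pderiv t.1 f y *m pderiv t.2 g y.
Proof.
move=> sf sg; elim: s y => [|a s IH] y sn Uy; first by rewrite big_seq1.
have sn' := ltnW sn.
rewrite /= (near_eq_derive (g := fun z =>
    \sum_(t <- splits s) pderiv t.1 f z *m pderiv t.2 g z)); last first.
  by near=> z; apply: IH => //; near: z; exact: open_nbhs_nbhs.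
have D t : t \in splits s ->
    derivable (fun z => pderiv t.1 f z *m pderiv t.2 g z) y (delta_mx 0 a) /\
    'D_(delta_mx 0 a) (fun z => pderiv t.1 f z *m pderiv t.2 g z) y =
    pderiv (a :: t.1) f y *m pderiv t.2 g y +
    pderiv t.1 f y *m pderiv (a :: t.2) g y.
  move=> /splits_size[t1 t2].
  by apply: derive_mulmx; [apply: (sf _ _ (leq_trans t1 sn') Uy).2|
     apply: (sg _ _ (leq_trans t2 sn') Uy).2].
rewrite (derive_sum_seq (fun t ts => (D t ts).1)).2.
rewrite big_cat !big_map /= -big_split /=.
by apply: eq_big_seq => t /D[_ ->].
Unshelve. all: by end_near. Qed.

Lemma smooth_upto_mulmx n p q r (f : V -> 'M[R]_(p, q)) (g : V -> 'M[R]_(q, r)) :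
  smooth_upto n U f -> smooth_upto n U g -> smooth_upto n U (fun z => f z *m g z).
Proof.
move=> sf sg s y sn Uy.
apply: (continuous_derivable_eq oU (f := fun z =>
    \sum_(t <- splits s) pderiv t.1 f z *m pderiv t.2 g z)) => //.
  by move=> z Uz; rewrite (pderiv_mulmx sf sg).
have sz (t : seq 'I_m * seq 'I_m) : t \in splits s -> (size t.1 <= n)%N /\ (size t.2 <= n)%N.
  by move=> /splits_size[t1 t2]; split; [exact: leq_trans t1 sn|exact: leq_trans t2 sn].
split=> [|a].
  change ((fun z => \sum_(t <- splits s) pderiv t.1 f z *m pderiv t.2 g z) @
    nbhs y --> \sum_(t <- splits s) pderiv t.1 f y *m pderiv t.2 g y).
  rewrite big_seq; under eq_cvg do rewrite big_seq.
  apply: (cvg_big add_continuous (F := nbhs y)) => t /sz[t1 t2].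
  by apply: cvg_mulmx; [exact: (sf _ _ t1 Uy).1|exact: (sg _ _ t2 Uy).1].
apply: (derive_sum_seq _).1 => t /sz[t1 t2].
by apply: (derive_mulmx _ _).1; [exact: (sf _ _ t1 Uy).2|exact: (sg _ _ t2 Uy).2].
Qed.

Lemma smooth_on_mulmx p q r (f : V -> 'M[R]_(p, q)) (g : V -> 'M[R]_(q, r)) :
  smooth_on U f -> smooth_on U g -> smooth_on U (fun z => f z *m g z).
Proof.
move=> /smooth_onP sf /smooth_onP sg; apply/smooth_onP => n.
exact: smooth_upto_mulmx.
Qed.

Lemma smooth_on_add {W : normedModType R} (f g : V -> W) :
  smooth_on U f -> smooth_on U g -> smooth_on U (fun z => f z + g z).
Proof.
move=> /smooth_onP sf /smooth_onP sg; apply/smooth_onP => n.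
exact: smooth_upto_add.
Qed.

Lemma smooth_on_linear {W W' : normedModType R} (L : {linear W -> W'})
    (f : V -> W) :
  continuous L -> smooth_on U f -> smooth_on U (fun z => L (f z)).
Proof.
move=> cL /smooth_onP sf; apply/smooth_onP => n.
exact: smooth_upto_linear.
Qed.

(** The derivatives of the inverse are polynomial in the inverse and in the
    derivatives of f, which gains one order of smoothness at a time. *)
Lemma smooth_on_invmx p (f : V -> 'M[R]_p) :
  smooth_on U f -> (forall y, U y -> f y \in unitmx) ->
  smooth_on U (fun z => invmx (f z)).
Proof.
move=> /smooth_onP sf fu; apply/smooth_onP => n.
have D y a : U y -> derivable (fun z => invmx (f z)) y (delta_mx 0 a) /\
    'D_(delta_mx 0 a) (fun z => invmx (f z)) y =
    - (invmx (f y) *m 'D_(delta_mx 0 a) f y *m invmx (f y)).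
  move=> Uy; have [cf df] := sf 0%N [::] y isT Uy.
  exact: derive_invmx (df a) (fu _ Uy) cf.
have base : smooth_upto 0 U (fun z => invmx (f z)).
  move=> s y; rewrite leqn0 => /nilP -> Uy; split=> [|a]; last exact: (D y a Uy).1.
  change ((fun z => invmx (f z)) @ nbhs y --> invmx (f y)).
  exact: cvg_invmx (sf 0%N [::] y isT Uy).1 (fu _ Uy).
elim: n => [|n IH]; first exact: base.
apply: smooth_uptoS => [|a]; first exact: base.
have scst : smooth_upto n U (cst (- 1)%:M : V -> 'M[R]_p).
  by move: n {IH}; apply/smooth_onP; exact: smooth_on_cst.
have sprod := smooth_upto_mulmx (smooth_upto_mulmx IH
  (smooth_upto_derive a (sf n.+1))) IH.
apply: (smooth_upto_eq oU _ (smooth_upto_mulmx scst sprod)) => y Uy.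
by rewrite (D y a Uy).2 mul_scalar_mx scaleN1r.
Qed.

End Closure.
End Smooth.

(** * Tensors on a manifold *)

Section Frames.
Context {R : realType} {m : nat} {M : closedManifold R m}.
Local Notation V := 'rV[R]_m.

Lemma cimg_cinv (i : atlas M) y : cimg i y -> cdom i (cinv i y).
Proof. by move=> [x dx <-]; rewrite chartK. Qed.

Lemma cinvK (i : atlas M) y : cimg i y -> chart i (cinv i y) = y.
Proof. by move=> [x dx <-]; rewrite chartK. Qed.

Lemma open_cimg (i : atlas M) : open (cimg i).
Proof. exact: cimg_open. Qed.

Lemma overlap_open (i j : atlas M) : open (chart i @` (cdom i `&` cdom j)).
Proof.
rewrite openE => _ [x [dix djx] <-].
have ci : cimg i (chart i x) by exists x.
have h1 : \forall y \near chart i x, cimg i y.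
  by apply: open_nbhs_nbhs; split=> //; exact: cimg_open.
have h2 : \forall y \near chart i x, cdom j (cinv i y).
  apply: (cinv_continuous ci); rewrite chartK//.
  by apply: open_nbhs_nbhs; split=> //; exact: cdom_open.
rewrite /interior /=; near=> y.
have cy : cimg i y by near: y.
exists (cinv i y); last exact: cinvK.
by split; [exact: cimg_cinv|near: y].
Unshelve. all: by end_near. Qed.

Lemma transition_differentiable (i j : atlas M) x : cdom i x -> cdom j x ->
  differentiable (chart j \o cinv i) (chart i x).
Proof.
move=> dix djx; have oU := @overlap_open i j.
have Ux : (chart i @` (cdom i `&` cdom j)) (chart i x) by exists x.
apply: (continuous_partial_differentiable oU Ux) => [a y Uy|a].
  exact: (transition_smooth [::] Uy).2.
exact: (transition_smooth [:: a] Ux).1.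
Qed.

(** The changes of charts i to j and j to i are inverse to each other near
    chart i x, hence so are their differentials. *)
Lemma dtransK (i j : atlas M) x : cdom i x -> cdom j x ->
  dtrans j i x *m dtrans i j x = 1%:M.
Proof.
move=> dix djx; rewrite /dtrans -trmx_mul -[RHS]trmx1; congr (_ ^T).
set f := chart j \o cinv i; set g := chart i \o cinv j.
have df : differentiable f (chart i x) := transition_differentiable dix djx.
have fx : f (chart i x) = chart j x by rewrite /f /= chartK.
have dg : differentiable g (f (chart i x)).
  by rewrite fx; exact: transition_differentiable.
rewrite -fx; apply: jacobian_inverse df dg _.
have : \forall y \near chart i x, (chart i @` (cdom i `&` cdom j)) y.
  by apply: open_nbhs_nbhs; split; [exact: overlap_open|exists x].
by apply: filterS => _ [z [diz djz] <-]; rewrite /g /f /= !chartK.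
Qed.

(** Tangent (true) and cotangent (false) vectors at x are both read in the
    preferred chart at x; frame b i x passes from there to the chart i and
    coframe b i x is its inverse. A tensor of type (a, b) is a field of maps
    from vectors of kind b to vectors of kind a. *)
Definition frame (b : bool) (i : atlas M) (x : M) : 'M[R]_m :=
  if b then dtrans (chart_at x) i x else (dtrans i (chart_at x) x)^T.
Definition coframe (b : bool) (i : atlas M) (x : M) : 'M[R]_m :=
  if b then dtrans i (chart_at x) x else (dtrans (chart_at x) i x)^T.

Lemma frameK b i x : cdom i x -> coframe b i x *m frame b i x = 1%:M.
Proof.
move=> dx; have d0 : cdom (chart_at x) x by exact: chart_atP.
case: b; first exact: dtransK.
by rewrite /coframe /frame -trmx_mul dtransK ?trmx1.
Qed.

Lemma coframeK b i x : cdom i x -> frame b i x *m coframe b i x = 1%:M.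
Proof. by move=> dx; apply: mulmx1C; exact: frameK. Qed.

Lemma frame_tr b i x : (frame b i x)^T = coframe (~~ b) i x.
Proof. by case: b; rewrite /frame /coframe /= ?trmxK. Qed.

Lemma coframe_tr b i x : (coframe b i x)^T = frame (~~ b) i x.
Proof. by case: b; rewrite /frame /coframe /= ?trmxK. Qed.

(* Only the inverse and the transpose of a frame are used from here on. *)
Opaque dtrans frame coframe.

Definition loc (a b : bool) (i : atlas M) (A : tensor M) (y : V) : 'M[R]_m :=
  let x := cinv i y in frame a i x *m A x *m coframe b i x.

Record smooth_tensor (a b : bool) (A : tensor M) : Prop := SmoothTensor {
  smooth_loc :> forall i, smooth_on (cimg i) (loc a b i A)
}.

Definition mulT (A B : tensor M) : tensor M := fun x => A x *m B x.
Definition trT (A : tensor M) : tensor M := fun x => (A x)^T.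
Definition invT (A : tensor M) : tensor M := fun x => invmx (A x).
Definition oneT : tensor M := fun=> 1%:M.

Lemma loc_mul a b c i A B y : cimg i y ->
  loc a c i (mulT A B) y = loc a b i A y *m loc b c i B y.
Proof.
move=> /cimg_cinv cy; rewrite /loc /mulT.
move: (frame a i _) (A _) (coframe b i _) (frame b i _) (frameK b cy) (B _).
move: (coframe c i _) => S P A' Q Q' QQ' B'.
by rewrite !mulmxA -(mulmxA _ Q) QQ' mulmx1.
Qed.

Lemma loc_add a b i (A B : tensor M) y :
  loc a b i (A + B) y = loc a b i A y + loc a b i B y.
Proof. by rewrite /loc -mulmxDl -mulmxDr. Qed.

Lemma loc_scale a b i (c : R) (A : tensor M) y :
  loc a b i (c *: A) y = c *: loc a b i A y.
Proof.
change (frame a i (cinv i y) *m (c *: A (cinv i y)) *m coframe b i (cinv i y) =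
  c *: loc a b i A y).
by rewrite -scalemxAr -scalemxAl.
Qed.

Lemma loc_tr a b i A y : loc (~~ b) (~~ a) i (trT A) y = (loc a b i A y)^T.
Proof.
by rewrite /loc /trT !trmx_mul frame_tr coframe_tr mulmxA.
Qed.

Lemma loc_one a i y : cimg i y -> loc a a i oneT y = 1%:M.
Proof. by move=> /cimg_cinv cy; rewrite /loc mulmx1 coframeK. Qed.

Lemma locK a b i (A : tensor M) x : cdom i x ->
  coframe a i x *m loc a b i A (chart i x) *m frame b i x = A x.
Proof.
move=> dx; have fa := frameK a dx; have fb := frameK b dx.
move: fa fb; rewrite /loc chartK//.
move: (frame a i x) (coframe a i x) (frame b i x) (coframe b i x) (A x).
move=> P P' Q Q' B PP QQ.
by rewrite !mulmxA PP mul1mx -mulmxA QQ mulmx1.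
Qed.

Lemma loc_unit a b i A y : cimg i y ->
  (loc a b i A y \in unitmx) = (A (cinv i y) \in unitmx).
Proof.
move=> /cimg_cinv cy; rewrite /loc !unitmx_mul.
have [h1 _] := mulmx1_unit (coframeK a cy).
have [_ h2] := mulmx1_unit (coframeK b cy).
by rewrite h1 h2 andbT.
Qed.

Lemma loc_inv a b i A y : cimg i y -> A (cinv i y) \in unitmx ->
  loc b a i (invT A) y = invmx (loc a b i A y).
Proof.
move=> cy Au; have Lu : loc a b i A y \in unitmx by rewrite loc_unit.
have e : loc a b i A y *m loc b a i (invT A) y = 1%:M.
  apply: (etrans (esym (@loc_mul a b a i A (invT A) y cy))).
  by rewrite -(loc_one a cy) /loc /mulT /invT mulmxV.
by rewrite -[LHS]mul1mx -(mulVmx Lu) -mulmxA e mulmx1.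
Qed.

Lemma smooth_mulT a b c A B : smooth_tensor a b A -> smooth_tensor b c B ->
  smooth_tensor a c (mulT A B).
Proof.
move=> sA sB; split=> i; apply: (smooth_on_eq (@open_cimg i)
   (f := fun y => loc a b i A y *m loc b c i B y)) => [y cy|].
  by apply/esym; exact: loc_mul.
exact: (smooth_on_mulmx (@open_cimg i) (sA i) (sB i)).
Qed.

Lemma smooth_addT a b (A B : tensor M) : smooth_tensor a b A ->
  smooth_tensor a b B -> smooth_tensor a b (A + B).
Proof.
move=> sA sB; split=> i; rewrite (_ : loc a b i _ = fun y => loc a b i A y + loc a b i B y).
  exact: (smooth_on_add (@open_cimg i) (sA i) (sB i)).
by apply/funext => y; rewrite loc_add.
Qed.

Lemma trmx_continuous n p : continuous (trmx : 'M[R]_(n, p) -> 'M[R]_(p, n)).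
Proof. move=> A; exact: (cvg_trmx (F := nbhs A) (f := id) cvg_id). Qed.

Lemma smooth_scaleT a b c (A : tensor M) :
  smooth_tensor a b A -> smooth_tensor a b (c *: A).
Proof.
move=> sA; split=> i; rewrite (_ : loc a b i _ = fun y => c *: loc a b i A y).
  apply: (smooth_on_linear (@open_cimg i) (L := *:%R c)).
    exact: scaler_continuous.
  exact: sA.
by apply/funext => y; rewrite loc_scale.
Qed.

Lemma smooth_trT a b (A : tensor M) :
  smooth_tensor a b A -> smooth_tensor (~~ b) (~~ a) (trT A).
Proof.
move=> sA; split=> i; rewrite (_ : loc _ _ i _ = fun y => (loc a b i A y)^T).
  apply: (smooth_on_linear (@open_cimg i) (L := trmx)).
    exact: trmx_continuous.
  exact: sA.
by apply/funext => y; rewrite loc_tr.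
Qed.

Lemma smooth_oneT a : smooth_tensor a a oneT.
Proof.
split=> i; apply: (smooth_on_eq (@open_cimg i) (f := cst 1%:M)) => [y cy|].
  by rewrite loc_one.
exact: smooth_on_cst.
Qed.

Lemma smooth_invT a b A : smooth_tensor a b A -> (forall x, A x \in unitmx) ->
  smooth_tensor b a (invT A).
Proof.
move=> sA Au; split=> i; apply: (smooth_on_eq (@open_cimg i)
   (f := fun y => invmx (loc a b i A y))) => [y cy|].
  by rewrite loc_inv.
by apply: (smooth_on_invmx (@open_cimg i) (sA i)) => y cy; rewrite loc_unit.
Qed.

Lemma smooth_zeroT a b : smooth_tensor a b (0 : tensor M).
Proof.
split=> i; apply: (smooth_on_eq (@open_cimg i) (f := cst 0)) => [y cy|].
  by rewrite /loc mulmx0 mul0mx.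
exact: smooth_on_cst.
Qed.

End Frames.

(** * The smooth topology on spaces of tensors *)

Section TensorSpaces.
Context {R : realType} {m : nat} {M : closedManifold R m}.
Local Notation V := 'rV[R]_m.
Local Notation idx := (@Coo_idx R m M).

(** The source and the target of Psi have this form, for subspaces P of the
    smooth tensors. *)
Definition tens (a b : bool) (P : set (tensor M)) : lcs R :=
  @Lcs R (M -> 'M[R]_m) P idx (Coo_norm (loc a b)).

Definition sup_on (K : set V) (f : V -> 'M[R]_m) : R := sup [set `|f y| | y in K].

Lemma sup_on_ge (K : set V) (f : V -> 'M[R]_m) y :
  compact K -> (forall y, K y -> {for y, continuous f}) -> K y ->
  `|f y| <= sup_on K f.
Proof.
move=> cK cf Ky; apply: ub_le_sup; last by exists y.
have cfK : compact (f @` K).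
  apply: continuous_compact => //; apply: continuous_in_subspaceT => z.
  by move=> /set_mem /cf.
have [B [_ hB]] := compact_bounded cfK.
exists (B + 1) => _ [z Kz <-]; apply: (hB (B + 1)); first by rewrite ltrDl.
by exists z.
Qed.

Lemma sup_on_le (K : set V) (f : V -> 'M[R]_m) c :
  0 <= c -> (forall y, K y -> `|f y| <= c) -> sup_on K f <= c.
Proof.
move=> c0 h; have [K0|/set0P[y Ky]] := eqVneq K set0.
  by rewrite /sup_on K0 image_set0 sup0.
by apply: ge_sup; [exists `|f y|, y|move=> _ [z Kz <-]; exact: h].
Qed.

Lemma sup_on_ge0 (K : set V) (f : V -> 'M[R]_m) :
  compact K -> (forall y, K y -> {for y, continuous f}) -> 0 <= sup_on K f.
Proof.
move=> cK cf; have [K0|/set0P[y Ky]] := eqVneq K set0.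
  by rewrite /sup_on K0 image_set0 sup0.
exact: le_trans (sup_on_ge cK cf Ky).
Qed.

Definition idx_chart (k : idx) : atlas M := (sval k).1.1.
Definition idx_compact (k : idx) : set V := (sval k).1.2.
Definition idx_deriv (k : idx) : seq 'I_m := (sval k).2.

Definition reidx (k : idx) (t : seq 'I_m) : idx :=
  exist _ (idx_chart k, idx_compact k, t) (svalP k).

Lemma Coo_normE a b (k : idx) (A : tensor M) : Coo_norm (loc a b) k A =
  sup_on (idx_compact k) (pderiv (idx_deriv k) (loc a b (idx_chart k) A)).
Proof. by case: k => [[[i K] s] ?]. Qed.

Lemma idx_compactP (k : idx) : compact (idx_compact k).
Proof. exact: (svalP k).1. Qed.

Lemma idx_cimg (k : idx) y : idx_compact k y -> cimg (idx_chart k) y.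
Proof. exact: (svalP k).2. Qed.

Lemma smooth_cont a b (A : tensor M) (k : idx) s y : smooth_tensor a b A ->
  idx_compact k y -> {for y, continuous (pderiv s (loc a b (idx_chart k) A))}.
Proof. by move=> sA /idx_cimg cy; exact: (sA _ s y cy).1. Qed.

Lemma Coo_norm_ge a b (k : idx) (A : tensor M) y : smooth_tensor a b A -> idx_compact k y ->
  `|pderiv (idx_deriv k) (loc a b (idx_chart k) A) y| <= Coo_norm (loc a b) k A.
Proof.
move=> sA Ky; rewrite Coo_normE.
have cf z : idx_compact k z ->
    {for z, continuous (pderiv (idx_deriv k) (loc a b (idx_chart k) A))}.
  exact: smooth_cont.
by apply: sup_on_ge; [exact: idx_compactP|exact: cf|exact: Ky].
Qed.

Lemma Coo_norm_le a b (k : idx) (A : tensor M) c : 0 <= c ->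
  (forall y, idx_compact k y ->
    `|pderiv (idx_deriv k) (loc a b (idx_chart k) A) y| <= c) ->
  Coo_norm (loc a b) k A <= c.
Proof. by move=> c0 h; rewrite Coo_normE; exact: sup_on_le. Qed.

Lemma Coo_norm_ge0 a b (k : idx) (A : tensor M) :
  smooth_tensor a b A -> 0 <= Coo_norm (loc a b) k A.
Proof.
move=> sA; rewrite Coo_normE; apply: sup_on_ge0; first exact: idx_compactP.
by move=> z Kz; apply: smooth_cont.
Qed.

Lemma pderiv_loc_add a b i s (A B : tensor M) y : smooth_tensor a b A -> smooth_tensor a b B ->
  cimg i y -> pderiv s (loc a b i (A + B)) y =
  pderiv s (loc a b i A) y + pderiv s (loc a b i B) y.
Proof.
move=> sA sB cy.
rewrite (_ : loc a b i _ = fun y => loc a b i A y + loc a b i B y).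
  by apply: (pderiv_add (@open_cimg _ _ _ i) (n := size s)) => //;
     apply: smooth_on_upto; [exact: sA|exact: sB].
by apply/funext => z; rewrite loc_add.
Qed.

Lemma pderiv_loc_scale a b i s c (A : tensor M) y : smooth_tensor a b A -> cimg i y ->
  pderiv s (loc a b i (c *: A)) y = c *: pderiv s (loc a b i A) y.
Proof.
move=> sA cy; rewrite (_ : loc a b i _ = fun y => c *: loc a b i A y).
  apply: (pderiv_linear (@open_cimg _ _ _ i) (L := *:%R c) (n := size s)) => //.
    exact: scaler_continuous.
  by apply: smooth_on_upto; exact: sA.
by apply/funext => z; rewrite loc_scale.
Qed.

Lemma pderiv_loc_tr a b i s (A : tensor M) y : smooth_tensor a b A -> cimg i y ->
  pderiv s (loc (~~ b) (~~ a) i (trT A)) y = (pderiv s (loc a b i A) y)^T.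
Proof.
move=> sA cy; rewrite (_ : loc _ _ i _ = fun y => (loc a b i A y)^T).
  apply: (pderiv_linear (@open_cimg _ _ _ i) (L := trmx) (n := size s)) => //.
    exact: trmx_continuous.
  by apply: smooth_on_upto; exact: sA.
by apply/funext => z; rewrite loc_tr.
Qed.

Lemma pderiv_loc_mul a b c i s (A B : tensor M) y : smooth_tensor a b A ->
  smooth_tensor b c B -> cimg i y -> pderiv s (loc a c i (mulT A B)) y =
  \sum_(t <- splits s) pderiv t.1 (loc a b i A) y *m pderiv t.2 (loc b c i B) y.
Proof.
move=> sA sB cy.
rewrite (pderiv_eq (g := fun y => loc a b i A y *m loc b c i B y) s
  (@open_cimg _ _ _ i))//.
  by apply: (pderiv_mulmx (@open_cimg _ _ _ i) (n := size s)) => //;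
     apply: smooth_on_upto; [exact: sA|exact: sB].
by move=> z cz; exact: loc_mul.
Qed.

Record tensor_space (a b : bool) (P : set (tensor M)) : Prop := TensorSpace {
  tspace_smooth : P `<=` smooth_tensor a b;
  tspace0 : P 0;
  tspaceD : forall A B : tensor M, P A -> P B -> P (A + B);
  tspaceZ : forall c (A : tensor M), P A -> P (c *: A)
}.

Lemma tens_seminormed a b P : tensor_space a b P -> seminormed (tens a b P).
Proof.
move=> hP; split; rewrite /=; [exact: tspace0 hP|exact: tspaceD hP|exact: tspaceZ hP|..].
- move=> k A B /(tspace_smooth hP) sA /(tspace_smooth hP) sB.
  apply: Coo_norm_le => [|y Ky]; first by rewrite addr_ge0 ?Coo_norm_ge0.
  rewrite pderiv_loc_add//; last exact: idx_cimg.
  apply: (le_trans (ler_normD _ _)).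
  by apply: lerD; apply: Coo_norm_ge.
- move=> k c A /(tspace_smooth hP) sA.
  have le d (B : tensor M) : smooth_tensor a b B ->
      Coo_norm (loc a b) k (d *: B) <= `|d| * Coo_norm (loc a b) k B.
    move=> sB; apply: Coo_norm_le => [|y Ky]; first by rewrite mulr_ge0// Coo_norm_ge0.
    rewrite pderiv_loc_scale//; last exact: idx_cimg.
    by rewrite normrZ ler_wpM2l//; apply: Coo_norm_ge.
  apply: le_anti; rewrite le//=.
  have [->|c0] := eqVneq c 0.
    rewrite scale0r normr0 mul0r; apply: Coo_norm_ge0; exact: smooth_zeroT.
  have nc0 : 0 < `|c| by rewrite normr_gt0.
  rewrite -ler_pdivlMl// -normfV.
  have := le c^-1 (c *: A) (smooth_scaleT c sA).
  by rewrite scalerA mulVf// scale1r.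
- move=> A /(tspace_smooth hP) sA h; apply/funext => x.
  have cx : cdom (chart_at x) x by exact: chart_atP.
  set i := chart_at x in cx; set y := chart i x.
  have cy : cimg i y by exists x.
  have pf : compact [set y] /\ [set y] `<=` cimg i.
    by split=> [|_ ->//]; exact: compact_set1.
  pose k : idx := exist _ (i, [set y], [::]) pf.
  have : `|loc a b i A y| <= 0.
    by rewrite -(h k); exact: (@Coo_norm_ge a b k A y sA erefl).
  rewrite normr_le0 => /eqP l0.
  by rewrite -(locK a b A cx) l0 mulmx0 mul0mx.
Qed.

Definition all_tens (a b : bool) : lcs R := tens a b (smooth_tensor a b).

Lemma smooth_tensor_space a b : tensor_space a b (smooth_tensor a b).
Proof.
by split; [|exact: smooth_zeroT|exact: smooth_addT|exact: smooth_scaleT].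
Qed.

#[export] Instance all_tens_seminormed a b : seminormed (all_tens a b) :=
  tens_seminormed (smooth_tensor_space a b).

Fixpoint words (n : nat) : seq (seq 'I_m) :=
  if n is n'.+1 then
    [::] :: [seq a :: t | a <- enum 'I_m, t <- words n']
  else [:: [::]].

Lemma mem_words n s : (size s <= n)%N -> s \in words n.
Proof.
elim: n s => [|n IH] [|a s]//=; rewrite inE ?eqxx// ltnS => /IH sn.
by rewrite orFb; apply: allpairs_f; rewrite ?mem_enum.
Qed.

Lemma size_words n s : s \in words n -> (size s <= n)%N.
Proof.
elim: n s => [|n IH] s; first by rewrite inE => /eqP->.
by rewrite inE => /orP[/eqP->//|/allpairsP[[a t] /= [_ /IH tn ->]]].
Qed.

Definition jet (k : idx) (n : nat) : seq idx := map (reidx k) (words n).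

(** Summing over all partial derivatives up to order n, unlike taking a single
    one, gives a norm that is submultiplicative up to a constant. *)
Definition jet_norm a b k n (A : tensor M) : R :=
  \sum_(j <- jet k n) Coo_norm (loc a b) j A.

Lemma jet_norm_ge0 a b k n (A : tensor M) : smooth_tensor a b A -> 0 <= jet_norm a b k n A.
Proof. by move=> sA; apply: sumr_ge0 => j _; exact: Coo_norm_ge0. Qed.

Lemma jet_norm_ge a b k n (A : tensor M) s : smooth_tensor a b A -> (size s <= n)%N ->
  Coo_norm (loc a b) (reidx k s) A <= jet_norm a b k n A.
Proof.
move=> sA /mem_words sn; rewrite /jet_norm /jet big_map.
rewrite (big_rem s)//= lerDl; apply: sumr_ge0 => t _; exact: Coo_norm_ge0.
Qed.

Lemma Coo_norm_reidx a b k (A : tensor M) :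
  Coo_norm (loc a b) (reidx k (idx_deriv k)) A = Coo_norm (loc a b) k A.
Proof. by rewrite !Coo_normE. Qed.

Definition jet_const n : R :=
  \sum_(s <- words n) \sum_(t <- splits s) m%:R.

Lemma jet_const_ge0 n : 0 <= jet_const n.
Proof. by apply: sumr_ge0 => s _; apply: sumr_ge0. Qed.

(** Leibniz rule: a word of length at most n is split into two such words. *)
Lemma jet_norm_mul a b c k n (A B : tensor M) : smooth_tensor a b A -> smooth_tensor b c B ->
  jet_norm a c k n (mulT A B) <=
    jet_const n * (jet_norm a b k n A * jet_norm b c k n B).
Proof.
move=> sA sB; rewrite /jet_norm /jet big_map -/(jet k n).
rewrite -!/(jet_norm _ _ _ _ _) /jet_const mulr_suml big_seq [leRHS]big_seq.
apply: ler_sum => s /size_words sn; rewrite mulr_suml.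
have pA := jet_norm_ge0 k n sA; have pB := jet_norm_ge0 k n sB.
apply: Coo_norm_le => [|y Ky].
  by apply: sumr_ge0 => t _; rewrite !mulr_ge0.
rewrite (pderiv_loc_mul _ sA sB) => //; last exact: (idx_cimg Ky).
apply: (le_trans (ler_norm_sum _ _ _)); rewrite big_seq [leRHS]big_seq.
apply: ler_sum => t /splits_size[t1 t2].
apply: (le_trans (mx_norm_mulmx _ _)); rewrite ler_wpM2l//.
apply: ler_pM => //.
  apply: le_trans (jet_norm_ge k sA (leq_trans t1 sn)).
  exact: (@Coo_norm_ge a b (reidx k t.1) A y sA Ky).
apply: le_trans (jet_norm_ge k sB (leq_trans t2 sn)).
exact: (@Coo_norm_ge b c (reidx k t.2) B y sB Ky).
Qed.

End TensorSpaces.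

Section TensorCalculus.
Context {R : realType} {m : nat} {M : closedManifold R m}.
Local Notation V := 'rV[R]_m.
Local Notation idx := (@Coo_idx R m M).
Local Notation jet_const := (@jet_const R m).

Lemma cb_bound_single (E F G : lcs R) {LE : seminormed E} {LF : seminormed F}
    (B : E -> F -> G) (hB : forall x y, lc_in x -> lc_in y -> lc_in (B x y)) :
  (forall j : lc_idx G, exists k k', exists2 C : R, 0 <= C &
    forall x y, lc_in x -> lc_in y ->
      lc_norm j (B x y) <= C * (lnorm k x * lnorm k' y)) ->
  forall l, exists k k', exists2 C : R, 0 <= C &
    forall x y, lc_in x -> lc_in y ->
      lnorm l (B x y) <= C * (lnorm k x * lnorm k' y).
Proof.
move=> h; elim=> [|j l [k [k' [C C0 hC]]]].
  by exists [::], [::], 0 => // x y _ _; rewrite /lnorm !big_nil mul0r.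
have [k2 [k2' [C2 C20 hC2]]] := h j.
exists (k2 ++ k), (k2' ++ k'), (C2 + C); first exact: addr_ge0.
move=> x y hx hy; rewrite [leLHS]/lnorm big_cons mulrDl; apply: lerD.
  apply: (le_trans (hC2 _ _ hx hy)); rewrite ler_wpM2l//.
  by apply: ler_pM; rewrite ?lnorm_ge0// lnorm_catl.
apply: (le_trans (hC _ _ hx hy)); rewrite ler_wpM2l//.
by apply: ler_pM; rewrite ?lnorm_ge0// lnorm_catr.
Qed.

Lemma cbilinear_mulT a b c :
  @cbilinear R (all_tens a b) (all_tens b c) (all_tens a c) (@mulT R m M).
Proof.
split.
- by move=> A B; exact: smooth_mulT.
- by move=> A A' B; apply/funext => x; exact: mulmxDl.
- by move=> A B B'; apply/funext => x; exact: mulmxDr.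
- by move=> d A B; apply/funext => x; apply/esym; exact: scalemxAl.
- by move=> d A B; apply/funext => x; apply/esym; exact: scalemxAr.
apply: cb_bound_single => [A B|j]; first exact: smooth_mulT.
pose n := size (idx_deriv j).
exists (jet j n), (jet j n), (jet_const n); first exact: jet_const_ge0.
move=> A B sA sB; apply: le_trans (jet_norm_mul j n sA sB).
rewrite /= -[leLHS]Coo_norm_reidx.
apply: jet_norm_ge; last exact: leqnn.
exact: smooth_mulT (sA : smooth_tensor a b A) (sB : smooth_tensor b c B).
Qed.

Lemma clinear_trT a b :
  @clinear R (all_tens a b) (all_tens (~~ b) (~~ a)) (@trT R m M).
Proof.
split.
- by move=> A; exact: smooth_trT.
- by move=> A B; apply/funext => x; exact: raddfD.
- by move=> d A; apply/funext => x; exact: linearZ.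
move=> l; exists l, 1 => // A sA; rewrite mul1r; apply: ler_sum => j _ /=.
apply: Coo_norm_le => [|y Ky]; first exact: Coo_norm_ge0.
rewrite pderiv_loc_tr//; last exact: idx_cimg.
by rewrite mx_norm_trmx; apply: Coo_norm_ge.
Qed.

Lemma clinear_incl a b (P Q : set (tensor M)) : P `<=` Q ->
  @clinear R (tens a b P) (tens a b Q) id.
Proof. by move=> PQ; split=> // [l]; exists l, 1 => // A _; rewrite mul1r. Qed.

Lemma clinear_restrict (E : lcs R) a b (P Q : set (tensor M)) (L : E -> tensor M) :
  @clinear R E (tens a b Q) L -> (forall x, lc_in x -> P (L x)) ->
  @clinear R E (tens a b P) L.
Proof. by move=> [h1 h2 h3 h4] LP; split. Qed.

Section MoreClinear.
Context {E F : lcs R} {LE : seminormed E} {LF : seminormed F}.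

Lemma clinear_addf (L L' : E -> F) : clinear L -> clinear L' ->
  clinear (fun x => L x + L' x).
Proof.
by move=> cL cL'; exact: (clinear_comp (clinear_pair cL cL') clinear_add).
Qed.

Lemma clinear_scale (c : R) : clinear (fun x : E => c *: x).
Proof.
split=> [x|x y|a x|l].
- exact: lc_inZ.
- exact: scalerDr.
- by rewrite !scalerA mulrC.
by exists l, `|c| => // x hx; rewrite lnormZ.
Qed.

Lemma clinear_scalef (c : R) (L : E -> F) : clinear L ->
  clinear (fun x => c *: L x).
Proof.
move=> cL; split=> [x hx|x y|a x|l].
- by apply: lc_inZ; exact: cl_in.
- by rewrite (clD cL) scalerDr.
- by rewrite (clZ cL) !scalerA mulrC.
have [k [C C0 hC]] := cl_bound cL l.
exists k, (`|c| * C); first by rewrite mulr_ge0.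
move=> x hx; rewrite lnormZ; last exact: cl_in.
by rewrite -mulrA ler_wpM2l// hC.
Qed.

Lemma cbilinear_l (G : lcs R) {LG : seminormed G} (B : E -> F -> G) y :
  cbilinear B -> lc_in y -> clinear (B ^~ y).
Proof.
move=> cB hy; split=> [x hx|x x'|a x|l].
- exact: cb_in.
- exact: cbDl.
- exact: cbZl.
have [k [k' [C C0 hC]]] := cb_bound cB l.
exists k, (C * lnorm k' y); first by rewrite mulr_ge0// lnorm_ge0.
by move=> x hx; rewrite -mulrA (mulrC (lnorm k' y)) hC.
Qed.

Lemma cbilinear_r (G : lcs R) {LG : seminormed G} (B : E -> F -> G) x :
  cbilinear B -> lc_in x -> clinear (B x).
Proof.
move=> cB hx; split=> [y hy|y y'|a y|l].
- exact: cb_in.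
- exact: cbDr.
- exact: cbZr.
have [k [k' [C C0 hC]]] := cb_bound cB l.
exists k', (C * lnorm k x); first by rewrite mulr_ge0// lnorm_ge0.
by move=> y hy; rewrite -mulrA hC.
Qed.

Lemma lcontinuous_single (U : set E) (f : E -> F) : U `<=` @lc_in R E ->
  (forall x, U x -> lc_in (f x)) ->
  (forall x, U x -> forall j (e : R), 0 < e -> exists k, exists2 d : R, 0 < d &
    forall y, U y -> lball k d x y -> lc_norm j (f y - f x) < e) ->
  lcontinuous U f.
Proof.
move=> Uin fin h x Ux; elim=> [|j l IH] e e0.
  exists [::], 1 => // y Uy _; split; first exact: fin.
  by rewrite big_nil.
have e20 : 0 < e / 2 by rewrite divr_gt0.
have [k [d d0 hd]] := h x Ux j _ e20; have [k' [d' d'0 hd']] := IH _ e20.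
exists (k ++ k'), (Num.min d d'); first by rewrite lt_min d0.
move=> y Uy hy; split; first exact: fin.
rewrite big_cons (splitr e); apply: ltrD.
  exact: hd Uy (lball_catl (Uin _ Ux) hy).
exact: (hd' _ Uy (lball_catr (Uin _ Ux) hy)).2.
Qed.

Lemma lcontinuous_line (U : set E) (f : E -> F) x v l (e : R) :
  U `<=` @lc_in R E -> lcontinuous U f -> U x -> lc_in v -> 0 < e ->
  exists2 d : R, 0 < d & forall t : R, `|t| < d -> U (x + t *: v) ->
    lball l e (f x) (f (x + t *: v)).
Proof.
move=> Uin cf Ux hv e0; have [k [d d0 hd]] := cf x Ux l e e0.
have c0 : 0 < 1 + lnorm k v by rewrite ltr_pwDl// lnorm_ge0.
exists (d / (1 + lnorm k v)); first by rewrite divr_gt0.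
move=> t; rewrite ltr_pdivlMr// => td Ut; apply: hd => //.
split; first exact: Uin.
rewrite -/(lnorm _ _) addrAC subrr add0r lnormZ//.
by apply: le_lt_trans td; rewrite ler_wpM2l// lerDr.
Qed.
End MoreClinear.

(** A condition on the tensors that is checked at each point of the manifold,
    and open there, is open: cover the manifold by finitely many compact
    subsets of charts. *)
Lemma lopen_pointwise a b (P : set (tensor M)) (hP : tensor_space a b P)
    (U : set (tensor M)) (Gam : atlas M -> V -> 'M[R]_m -> Prop) :
  U `<=` P ->
  (forall A i y, U A -> cimg i y -> Gam i y (loc a b i A y)) ->
  (forall A, P A -> (forall x, exists i,
    cdom i x /\ Gam i (chart i x) (loc a b i A (chart i x))) -> U A) ->
  (forall i y p, cimg i y -> Gam i y p -> exists2 e : R, 0 < e &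
    forall y' p', `|y' - y| < e -> `|p' - p| < e -> Gam i y' p') ->
  @lopen R (tens a b P) U.
Proof.
move=> UP UG GU Gopen; have LP := tens_seminormed hP; split=> // A UA.
have sA := tspace_smooth hP (UP _ UA).
(* Near each point of M the condition holds for all B in a neighbourhood of A,
   that is, eventually along the filter F of neighbourhoods of A. *)
pose F : set_system (tens a b P) :=
  [set S | exists l, exists2 e : R, 0 < e & lball l e A `<=` S].
have FF : Filter F.
  split.
  - by exists [::], 1.
  - move=> S T [l [e e0 h]] [l' [e' e'0 h']].
    exists (l ++ l'), (Num.min e e'); first by rewrite lt_min e0.
    move=> B hB; split; [apply: h|apply: h'].
      exact: (lball_catl (E := tens a b P) (UP _ UA) hB).
    exact: (lball_catr (E := tens a b P) (UP _ UA) hB).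
  - move=> S T ST [l [e e0 h]]; exists l, e => // B /h; exact: ST.
pose good (B : tens a b P) (x : M) := exists i,
  cdom i x /\ Gam i (chart i x) (loc a b i B (chart i x)).
suff : \near F, [set: M] `<=` good F.
  move=> [l [e e0 h]]; exists l, e => // B hB.
  by apply: GU; [case: hB|move=> x; exact: (h B hB x)].
apply: (compact_near_coveringP _).1 => //; first exact: mcompact.
move=> x _; have cx : cdom (chart_at x) x by exact: chart_atP.
move: (chart_at x) cx => i cx; pose y := chart i x.
have cy : cimg i y by exists x.
have [e e0 he] := Gopen i y _ cy (UG A i y UA cy).
have e20 : 0 < e / 2 by rewrite divr_gt0.
have ny1 : \forall z \near y, cimg i z.
  by apply: open_nbhs_nbhs; split=> //; exact: open_cimg.
have ny2 : \forall z \near y, `|loc a b i A y - loc a b i A z| < e / 2.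
  have /cvgrPdist_lt/(_ _ e20) := (sA i [::] y cy).1; exact.
have /nbhs_ballP[d /= d0 hd] : nbhs y [set z | cimg i z /\
    `|loc a b i A y - loc a b i A z| < e / 2].
  exact: filterI ny1 ny2.
pose r := Num.min (d / 2) (e / 2).
have r0 : 0 < r by rewrite lt_min e20 divr_gt0.
pose K := [set z : V | `|z - y| <= r].
have Kd z : K z -> cimg i z /\ `|loc a b i A y - loc a b i A z| < e / 2.
  move=> Kz; apply: hd; rewrite -ball_normE /= distrC; apply: (le_lt_trans Kz).
  apply: (@le_lt_trans _ _ (d / 2)); first by rewrite ge_min lexx.
  by rewrite ltr_pdivrMr// ltr_pMr// ltr1n.
have cK : compact K.
  apply: bounded_closed_compact.
    exists (r + `|y|); split; first exact: num_real.
    move=> c hc z Kz; apply/ltW/(le_lt_trans _ hc).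
    by rewrite -{1}(subrK y z); apply: (le_trans (ler_normD _ _)); rewrite lerD2r.
  apply: (@closed_comp _ _ (fun z : V => `|z - y|) [set t : R | t <= r]).
    move=> z _; apply: (@cvg_norm _ _ _ (nbhs z)); apply: cvgB; first exact: cvg_id.
    exact: cvg_cst.
  exact: closed_le.
have pf : compact K /\ K `<=` cimg i by split=> // z /Kd[].
pose k : idx := exist _ (i, K, [::]) pf.
exists ([set x' | cdom i x' /\ K (chart i x')], @lball R (tens a b P) [:: k] (e / 2) A).
  split=> /=; last by exists [:: k], (e / 2).
  apply: filterI; first by apply: open_nbhs_nbhs; split=> //; exact: cdom_open.
  apply: (chart_continuous cx); apply/nbhs_ballP; exists r => // z.
  by rewrite -ball_normE /= distrC => /ltW.
move=> [x' B] /= [[cx' Kx'] [PB hB]]; exists i; split=> //.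
have [cz lz] := Kd _ Kx'; apply: he.
  apply: (le_lt_trans Kx'); apply: (@le_lt_trans _ _ (e / 2)).
    by rewrite ge_min lexx orbT.
  by rewrite ltr_pdivrMr// ltr_pMr// ltr1n.
have sB := tspace_smooth hP PB.
have sBA : smooth_tensor a b (B - A : tensor M).
  by apply: (tspace_smooth hP); apply: (@lc_inB R (tens a b P)) => //; exact: UP.
have : `|loc a b i (B - A) (chart i x')| < e / 2.
  apply: le_lt_trans hB; rewrite big_seq1.
  exact: (@Coo_norm_ge _ _ _ a b k (B - A) _ sBA Kx').
rewrite (_ : loc a b i (B - A) (chart i x') =
    loc a b i B (chart i x') - loc a b i A (chart i x')); last first.
  by rewrite loc_add -scaleN1r loc_scale scaleN1r.
move=> h; rewrite -(subrKA (loc a b i A (chart i x'))) (splitr e).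
apply: (le_lt_trans (ler_normD _ _)); apply: ltrD; first exact: h.
by rewrite distrC; exact: lz.
Qed.

Definition unitT a b : set (tensor M) :=
  [set A | smooth_tensor a b A /\ forall x, A x \in unitmx].

Lemma lopen_unitT a b : @lopen R (all_tens a b) (unitT a b).
Proof.
apply: (lopen_pointwise (smooth_tensor_space a b)
  (Gam := fun _ _ p => p \in unitmx)) => [A []//|A i y [_ Au] cy|A sA h|].
- by rewrite loc_unit.
- split=> // x; have [i [cx]] := h x.
  by rewrite loc_unit; [rewrite chartK|exists x].
move=> i y p cy pu.
have : \forall q \near p, q \in unitmx.
  exact: (@cvg_near_unitmx _ _ (nbhs p) _ _ id p cvg_id pu).
move=> /nbhs_ballP[e /= e0 he]; exists e => // y' p' _ pp.
by apply: he; rewrite -ball_normE /= distrC.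
Qed.

(** If the norm p satisfies p (A B) <= C p(A) p(B) then the identity
    A'^-1 = A^-1 - A'^-1 (A' - A) A^-1 gives p(A'^-1) <= 2 p(A^-1) as soon as
    C^2 p(A' - A) p(A^-1) <= 1/2. *)
Lemma jet_norm_invT a b k n (A A' : tensor M) : unitT a b A -> unitT a b A' ->
  let C := jet_const n * jet_const n in let p := jet_norm b a k n (invT A) in
  C * (jet_norm a b k n (A' - A) * p) <= 1 / 2 ->
  jet_norm b a k n (invT A' - invT A) <=
    2 * C * (p * p) * jet_norm a b k n (A' - A).
Proof.
move=> [sA Au] [sA' Au'] C p small.
have sI := smooth_invT sA Au; have sI' := smooth_invT sA' Au'.
have sD : smooth_tensor a b (A' - A).
  by apply: (@lc_inB R (all_tens a b)).
have tD c d (X Y : tensor M) : smooth_tensor c d X -> smooth_tensor c d Y ->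
    jet_norm c d k n (X + Y) <= jet_norm c d k n X + jet_norm c d k n Y.
  by move=> sX sY; apply: (@lnormD R (all_tens c d)).
have tN c d (X : tensor M) : smooth_tensor c d X ->
    jet_norm c d k n (- X) = jet_norm c d k n X.
  by move=> sX; apply: (@lnormN R (all_tens c d)).
have E : invT A' - invT A = - mulT (invT A') (mulT (A' - A) (invT A)).
  apply/funext => x.
  change (invmx (A' x) - invmx (A x) =
    - (invmx (A' x) *m ((A' x - A x) *m invmx (A x)))).
  rewrite mulmxBl mulmxBr mulmxV// mulmx1 mulmxA mulVmx// mul1mx.
  by rewrite opprB.
have s3 : smooth_tensor b a (mulT (invT A') (mulT (A' - A) (invT A))).
  exact: smooth_mulT sI' (smooth_mulT sD sI).
set dl := jet_norm a b k n (A' - A) in small *.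
set p' := jet_norm b a k n (invT A').
have dl0 : 0 <= dl by exact: jet_norm_ge0.
have p0 : 0 <= p by exact: jet_norm_ge0.
have p'0 : 0 <= p' by exact: jet_norm_ge0.
have C0 : 0 <= C by rewrite mulr_ge0// jet_const_ge0.
have b1 : jet_norm b a k n (invT A' - invT A) <= C * (dl * p) * p'.
  rewrite E tN//; apply: (le_trans (jet_norm_mul k n sI' (smooth_mulT sD sI))).
  have h2 : jet_norm a a k n (mulT (A' - A) (invT A)) <= jet_const n * (dl * p).
    exact: (jet_norm_mul k n sD sI).
  apply: (@le_trans _ _ (jet_const n * (p' * (jet_const n * (dl * p))))).
    by rewrite ler_wpM2l ?jet_const_ge0// ler_wpM2l.
  by rewrite /C le_eqVlt; apply/orP; left; apply/eqP; lra.
have p'le : p' <= 2 * p.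
  have : p' <= jet_norm b a k n (invT A' - invT A) + p.
    rewrite /p' -[X in jet_norm b a k n X <= _](subrK (invT A)).
    by apply: tD => //; rewrite E; apply: (@lc_inN R (all_tens b a)).
  have : C * (dl * p) * p' <= 1 / 2 * p' by rewrite ler_wpM2r.
  by lra.
apply: (le_trans b1).
apply: (@le_trans _ _ (C * (dl * p) * (2 * p))).
  by apply: ler_wpM2l; [exact: mulr_ge0 C0 (mulr_ge0 dl0 p0)|exact: p'le].
by rewrite le_eqVlt; apply/orP; left; apply/eqP; lra.
Qed.

Lemma lcontinuous_invT a b :
  @lcontinuous R (all_tens a b) (all_tens b a) (unitT a b) invT.
Proof.
apply: lcontinuous_single => [A []//|A []|A UA j e e0]; first exact: smooth_invT.
pose n := size (idx_deriv j).
set C := jet_const n * jet_const n; set p := jet_norm b a j n (invT A).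
have sI : smooth_tensor b a (invT A) by case: UA; exact: smooth_invT.
have C0 : 0 <= C by rewrite mulr_ge0// jet_const_ge0.
have p0 : 0 <= p by exact: jet_norm_ge0.
have Cp0 : 0 <= C * p by exact: mulr_ge0 C0 p0.
have Cpp0 : 0 <= 2 * C * (p * p).
  by apply: mulr_ge0; [exact: (mulr_ge0 _ C0)|exact: (mulr_ge0 p0 p0)].
have c1 : 0 < 2 * (C * p) + 1 by rewrite ltr_wpDl// mulr_ge0.
have c2 : 0 < 2 * C * (p * p) + 1 by rewrite ltr_wpDl.
exists (jet j n), (Num.min (1 / (2 * (C * p) + 1)) (e / (2 * C * (p * p) + 1))).
  by rewrite lt_min !divr_gt0.
move=> A' UA' [sA' hA'].
have {}hA' : jet_norm a b j n (A' - A) <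
  Num.min (1 / (2 * (C * p) + 1)) (e / (2 * C * (p * p) + 1)) := hA'.
have sI' : smooth_tensor b a (invT A') by case: UA'; exact: smooth_invT.
have sD : smooth_tensor a b (A' - A) by apply: (@lc_inB R (all_tens a b)) => //; case: UA.
have dl0 : 0 <= jet_norm a b j n (A' - A) by exact: jet_norm_ge0.
move: hA'; rewrite lt_min !ltr_pdivlMr// => /andP[h1 h2].
have small : C * (jet_norm a b j n (A' - A) * p) <= 1 / 2 by lra.
have h3 := jet_norm_invT UA UA' small.
have h4 : Coo_norm (loc b a) j (invT A' - invT A) <=
    jet_norm b a j n (invT A' - invT A).
  rewrite -[leLHS]Coo_norm_reidx; apply: jet_norm_ge => //.
  by apply: (@lc_inB R (all_tens b a)).
apply: le_lt_trans h4 _; apply: le_lt_trans h3 _; rewrite -/C -/p.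
by apply: le_lt_trans h2; rewrite mulrC mulrDr lerDl mulr1.
Qed.

Lemma is_dderive_invT a b (A B : tensor M) : unitT a b A -> smooth_tensor a b B ->
  @is_dderive R (all_tens a b) (all_tens b a) (unitT a b) invT A B
    ((-1) *: mulT (invT A) (mulT B (invT A))).
Proof.
move=> UA sB; pose T := @all_tens R m M.
have Uin : unitT a b `<=` @lc_in R (T a b) by move=> X [].
have sI X : unitT a b X -> smooth_tensor b a (invT X).
  by move=> [sX Xu]; exact: smooth_invT.
split.
  by apply: (@lc_inZ R (T b a)); apply: smooth_mulT (sI A UA) (smooth_mulT sB (sI A UA)).
move=> l e e0.
(* The difference quotient is a continuous function of A + t B. *)
have cphi : @lcontinuous R (T a b) (T b a) (unitT a b)
    (fun A' => (-1) *: mulT (invT A') (mulT B (invT A))).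
  have cL : @clinear R (T b a) (T b a)
      (fun X => (-1) *: mulT X (mulT B (invT A))).
    have cm : @clinear R (T b a) (T b a) (fun X => mulT X (mulT B (invT A))).
      apply: (cbilinear_l (@cbilinear_mulT b a a)).
      exact: smooth_mulT sB (sI A UA).
    exact: (@clinear_scalef (T b a) (T b a) _ _ _ cm).
  pose proof (clinear_continuous cL (U := @lc_in R (T b a)) (fun X hX => hX)) as cLc.
  exact: (@lcontinuous_comp R (T a b) (T b a) (T b a) (unitT a b) _ invT _ sI
    (@lcontinuous_invT a b) cLc).
pose proof (lcontinuous_line (E := T a b) (F := T b a) l Uin cphi UA sB e0)
  as [d d0 hd].
exists d => // t t0 td Ut.
have -> : t^-1 *: (invT (A + t *: B) - invT A) =
    (-1) *: mulT (invT (A + t *: B)) (mulT B (invT A)).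
  apply/funext => x.
  change (t^-1 *: (invmx (A x + t *: B x) - invmx (A x)) =
    (-1) *: (invmx (A x + t *: B x) *m (B x *m invmx (A x)))).
  have Ax := UA.2 x; have Atx : A x + t *: B x \in unitmx by exact: Ut.2 x.
  rewrite -[in LHS](mulKmx Atx (invmx (A x))) mulmxDl mulmxV// -scalemxAl.
  rewrite mulmxDr mulmx1 opprD addrA subrr add0r scalerN scaleN1r.
  by rewrite -scalemxAr scalerA mulVf// scale1r.
exact: hd.
Qed.

(** The derivative - A^-1 B A^-1 is a polynomial in A^-1, which is C^k by
    induction, and in B. *)
Lemma Ck_invT k a b :
  @Ck R k (all_tens a b) (all_tens b a) (unitT a b) invT.
Proof.
have sI A : unitT a b A -> smooth_tensor b a (invT A).
  by move=> [sA Au]; exact: smooth_invT.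
have oU := lopen_unitT a b.
elim: k => [|k IH]; first by split=> //; exact: lcontinuous_invT.
split=> //; first exact: lcontinuous_invT.
exists (fun A B => (-1) *: mulT (invT A) (mulT B (invT A))).
split; first by move=> A B UA sB; exact: is_dderive_invT.
pose T := @all_tens R m M.
have cT : clinear (fun x : T b a => (-1 : R) *: x) by exact: clinear_scale.
pose W := lprod (T a b) (T a b).
have oW : @lopen R W [set z | unitT a b z.1 /\ lc_in z.2].
  exact: lopen_lprod oU lopen_in.
have Win : [set z : W | unitT a b z.1 /\ lc_in z.2] `<=` @lc_in R W by move=> z [[]].
have cI : @Ck R k W (T b a) [set z | unitT a b z.1 /\ lc_in z.2] (fun z => invT z.1).
  apply: (@Ck_comp R k W (T a b) (T b a) _ _ _ _ (unitT a b) fst invT) => //.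
    by move=> z [].
  by apply: Ck_clinear => //; exact: clinear_fst.
have cS : @Ck R k W (T a b) [set z | unitT a b z.1 /\ lc_in z.2] snd.
  by apply: Ck_clinear => //; exact: clinear_snd.
apply: (Ck_clinear_comp oW cT).
apply: (Ck_cbilinear_comp oW (@cbilinear_mulT b a a) cI).
exact: (Ck_cbilinear_comp oW (@cbilinear_mulT a b a) cS cI).
Qed.

End TensorCalculus.

(** * The Cayley transform at a point *)

Section PointwiseAlgebra.
Context {R : realType} {m : nat}.
Implicit Types (b A P V : 'M[R]_m).

Lemma mx11_tr (B : 'M[R]_1) : B^T = B.
Proof. by apply/matrixP => i j; rewrite mxE !ord1. Qed.

Lemma bil_tr b X Y : bil b X Y = bil b^T Y X.
Proof. by rewrite /bil -(mx11_tr (X^T *m b *m Y)) !trmx_mul trmxK mulmxA. Qed.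

Lemma bil_mul b A A' X Y : bil b (A *m X) (A' *m Y) = bil (A^T *m b *m A') X Y.
Proof. by rewrite /bil trmx_mul !mulmxA. Qed.

Lemma bilP b b' : (forall X Y, bil b X Y = bil b' X Y) -> b = b'.
Proof.
move=> h; apply/matrixP => i j.
have e (c : 'M[R]_m) : bil c (delta_mx i 0) (delta_mx j 0) = c i j.
  by rewrite /bil trmx_delta -rowE -colE !mxE.
by rewrite -!e h.
Qed.

Lemma bilDl b b' X Y : bil (b + b') X Y = bil b X Y + bil b' X Y.
Proof. by rewrite /bil mulmxDr mulmxDl mxE. Qed.

Definition posdef b := forall X, X != 0 -> 0 < bil b X X.

Lemma posdef_unit b : posdef b -> b \in unitmx.
Proof.
move=> pb; rewrite -row_free_unit; apply/inj_row_free => u ub.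
apply/eqP/negPn/negP => u0.
have /pb : u^T != 0 by rewrite -(inj_eq (@trmx_inj _ _ _)) trmxK trmx0.
by rewrite /bil trmxK ub mul0mx mxE ltxx.
Qed.

Lemma posdefD b b' : posdef b -> posdef b' -> posdef (b + b').
Proof. by move=> pb pb' X X0; rewrite bilDl addr_gt0 ?pb ?pb'. Qed.

Lemma posdef_congr b A : A \in unitmx -> posdef b -> posdef (A^T *m b *m A).
Proof.
move=> Au pb X X0; rewrite -bil_mul; apply: pb; apply: contra_neq X0 => AX.
by rewrite -(mulKmx Au X) AX mulmx0.
Qed.

(** The open condition 0 < u b u^T over the compact unit sphere. *)
Lemma posdef_near b : posdef b -> \forall b' \near b, posdef b'.
Proof.
move=> pb; pose S := [set u : 'rV[R]_m | `|u| = 1].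
have cS : compact S.
  apply: bounded_closed_compact.
    by exists 1; split=> [|c c1 u]; [exact: num_real|move=> /= ->; exact: ltW].
  apply: (@closed_comp _ _ (fun u : 'rV[R]_m => `|u|) [set 1 : R]) => [u _|].
    exact: norm_continuous.
  exact: closed_eq.
have : \near b, S `<=` (fun u => 0 < (u *m b *m u^T) 0 0).
  apply: (compact_near_coveringP S).1 cS _ (nbhs b)
    (fun b' u => 0 < (u *m b' *m u^T) 0 0) _ _ => u Su.
  have q0 : 0 < (u *m b *m u^T) 0 0.
    have u0 : u^T != 0.
      rewrite -(inj_eq (@trmx_inj _ _ _)) trmxK trmx0 -normr_eq0 Su.
      exact: oner_neq0.
    by have := pb _ u0; rewrite /bil trmxK.
  have cq : (fun z : 'rV[R]_m * 'M[R]_m => (z.1 *m z.2 *m z.1^T) 0 0) @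
      (u, b) --> (u *m b *m u^T) 0 0.
    have c1 : (fun z : 'rV[R]_m * 'M[R]_m => z.1) @ (u, b) --> u by exact: cvg_fst.
    have c2 : (fun z : 'rV[R]_m * 'M[R]_m => z.2) @ (u, b) --> b by exact: cvg_snd.
    exact: ((cvg_mxP _ _).1 (cvg_mulmx (cvg_mulmx c1 c2) (cvg_trmx c1)) 0 0).
  exact: (cvgr_gt _ cq _ q0).
apply: filterS => b' hb' X X0.
have n0 : 0 < `|X^T|.
  by rewrite normr_gt0 -(inj_eq (@trmx_inj _ _ _)) trmxK trmx0.
have := hb' (`|X^T|^-1 *: X^T).
rewrite /S /= normrZ normfV normr_id mulVf ?gt_eqF// => /(_ erefl).
rewrite linearZ /= trmxK -!scalemxAl -scalemxAr -/(bil _ _ _).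
by rewrite mxE pmulr_rgt0 ?invr_gt0// mxE pmulr_rgt0 ?invr_gt0.
Qed.

Section Compatible.
Variables (w J0 : 'M[R]_m).
Hypothesis (wT : w^T = - w) (J0J0 : J0 *m J0 = - 1%:M).

(** As J^-1 = - J, the equation J^T w J = w means J^T w = - w J. *)
Lemma compatible_symmetric J : J *m J = - 1%:M ->
  J^T *m w *m J = w <-> (w *m J)^T = w *m J.
Proof.
move=> JJ; rewrite trmx_mul wT mulmxN; split=> [h|h].
  by rewrite -[in RHS]h -!mulmxA JJ !mulmxN mulmx1.
by rewrite -[J^T *m w]opprK h mulNmx -mulmxA JJ mulmxN opprK mulmx1.
Qed.

Variable g0 : 'M[R]_m.
Hypotheses (g0E : g0 = w *m J0) (g0T : g0^T = g0) (g0_pos : posdef g0).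

Lemma J0T_g0 : J0^T *m g0 = - (g0 *m J0).
Proof.
by rewrite -[in RHS]g0T g0E trmx_mul wT mulmxN mulNmx opprK mulmxA.
Qed.

Lemma g0_unit : g0 \in unitmx. Proof. exact: posdef_unit. Qed.

Definition in_EndS V := V^T *m g0 = g0 *m V /\ V *m J0 = - (J0 *m V).

Lemma in_EndS_mulJ0 V : in_EndS V -> in_EndS (V *m J0).
Proof.
move=> [sV aV]; split.
  rewrite trmx_mul -mulmxA sV [LHS]mulmxA J0T_g0 mulNmx -[in LHS]mulmxA.
  by rewrite -mulmxN -aV mulmxA.
by rewrite -mulmxA J0J0 mulmxN mulmx1 aV mulmxN mulmxA J0J0 mulNmx mul1mx !opprK.
Qed.

Lemma in_EndS_scale c V : in_EndS V -> in_EndS (c *: V).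
Proof.
move=> [sV aV]; split; first by rewrite linearZ /= -scalemxAl -scalemxAr sV.
by rewrite -scalemxAl -scalemxAr aV scalerN.
Qed.

Lemma in_EndS_add V V' : in_EndS V -> in_EndS V' -> in_EndS (V + V').
Proof.
move=> [sV aV] [sV' aV']; split; first by rewrite linearD mulmxDl mulmxDr sV sV'.
by rewrite mulmxDl mulmxDr aV aV' opprD.
Qed.

Definition symmetrize X := X + invmx g0 *m X^T *m g0.

(** Minus twice the projection onto the g0-symmetric endomorphisms followed by the
    projection onto those that anticommute with J0. The factor is the one that
    makes retract_cayley return P. *)
Definition retract X :=
  (- 2^-1) *: (symmetrize X + J0 *m symmetrize X *m J0).

Lemma symmetrize_sym X : (symmetrize X)^T *m g0 = g0 *m symmetrize X.
Proof.
rewrite /symmetrize linearD /= !trmx_mul trmxK trmx_inv g0T mulmxDl mulmxDr.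
by rewrite -!mulmxA mulVmx ?g0_unit// mulmx1 mulKVmx ?g0_unit// addrC.
Qed.

Lemma retract_in X : in_EndS (retract X).
Proof.
apply: in_EndS_scale; have := symmetrize_sym X; move: (symmetrize X) => S sS.
split.
  rewrite linearD /= mulmxDl mulmxDr sS !trmx_mul -!mulmxA J0T_g0; congr (_ + _).
  rewrite !mulmxN (mulmxA S^T) sS -mulmxA (mulmxA J0^T) J0T_g0 mulNmx opprK.
  by rewrite -!mulmxA.
rewrite mulmxDl mulmxDr -(mulmxA _ J0 J0) J0J0 mulmxN mulmx1 !mulmxA J0J0.
by rewrite mulNmx mul1mx mulNmx opprD opprK addrC.
Qed.

Lemma symmetrize_id V : V^T *m g0 = g0 *m V -> symmetrize V = 2 *: V.
Proof.
by move=> sV; rewrite /symmetrize -mulmxA sV mulKmx ?g0_unit// scaler_nat mulr2n.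
Qed.

Lemma retractB X Y : retract (X - Y) = retract X - retract Y.
Proof.
have sB : symmetrize (X - Y) = symmetrize X - symmetrize Y.
  by rewrite /symmetrize linearB /= mulmxBr mulmxBl opprD addrACA.
rewrite /retract sB mulmxBr mulmxBl -scalerBr.
by move: (symmetrize X) (symmetrize Y) => S S'; rewrite opprD addrACA.
Qed.

Lemma retractZ c X : retract (c *: X) = c *: retract X.
Proof.
have sZ : symmetrize (c *: X) = c *: symmetrize X.
  by rewrite /symmetrize linearZ /= -scalemxAr -scalemxAl -scalerDr.
by rewrite /retract sZ -scalemxAr -scalemxAl -scalerDr !scalerA mulrC.
Qed.

Lemma retract1 : retract 1%:M = 0.
Proof.
rewrite /retract symmetrize_id ?trmx1 ?mul1mx ?mulmx1// -scalemxAr -scalemxAl.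
by rewrite mulmx1 J0J0 scalerN subrr scaler0.
Qed.

Lemma retract_EndS V : in_EndS V -> retract V = (- 2) *: V.
Proof.
move=> [sV aV]; rewrite /retract symmetrize_id// -scalemxAr -scalemxAl.
rewrite -mulmxA aV mulmxN mulmxA J0J0 mulNmx mul1mx opprK -scalerDl scalerA.
by congr (_ *: _); lra.
Qed.

Section Tangent.
Variable P : 'M[R]_m.
Hypothesis (PE : in_EndS P) (P_pos : posdef (g0 *m (1%:M - P *m P))).
Local Notation u := (invmx (1%:M - P)).
Local Notation v := (invmx (1%:M + P)).

Lemma cayley_factor : 1%:M - P *m P = (1%:M + P) *m (1%:M - P).
Proof.
by rewrite mulmxDl mul1mx mulmxBr mulmx1 addrA subrK.
Qed.

Lemma cayley_comm : (1%:M + P) *m (1%:M - P) = (1%:M - P) *m (1%:M + P).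
Proof.
by rewrite -cayley_factor mulmxBl mul1mx mulmxDr mulmx1 opprD addrA addrK.
Qed.

Lemma cayley_units : 1%:M - P \in unitmx /\ 1%:M + P \in unitmx.
Proof.
have := posdef_unit P_pos; rewrite unitmx_mul cayley_factor unitmx_mul.
by move=> /andP[_ /andP[-> ->]].
Qed.

Let um : 1%:M - P \in unitmx. Proof. by case: cayley_units. Qed.
Let up : 1%:M + P \in unitmx. Proof. by case: cayley_units. Qed.

Lemma cayley_u_comm : u *m (1%:M + P) = (1%:M + P) *m u.
Proof.
apply: (can_inj (mulKmx um)).
by rewrite !mulmxA mulmxV// mul1mx -cayley_comm -mulmxA mulmxV// mulmx1.
Qed.

Lemma cayley_affine : (1%:M + P) *m u = 2 *: u - 1%:M.
Proof.
have -> : 1%:M + P = 2 *: 1%:M - (1%:M - P).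
  by rewrite scaler_nat mulr2n opprB [RHS]addrACA subrr addr0.
by rewrite mulmxBl mulmxV// -scalemxAl mul1mx.
Qed.

Variable J : 'M[R]_m.
Hypothesis JE : J = (1%:M - P) *m J0 *m u.

Lemma J0_plus : J0 *m (1%:M + P) = (1%:M - P) *m J0.
Proof. by rewrite mulmxDr mulmxBl mulmx1 mul1mx PE.2 opprK. Qed.

Lemma J0_minus : J0 *m (1%:M - P) = (1%:M + P) *m J0.
Proof. by rewrite mulmxBr mulmxDl mulmx1 mul1mx PE.2. Qed.

(** J is conjugate to J0 by 1 - P. *)
Lemma cayley_J_sq : J *m J = - 1%:M.
Proof.
rewrite JE !mulmxA -(mulmxA _ u) mulVmx// mulmx1.
by rewrite -(mulmxA _ J0 J0) J0J0 mulmxN mulmx1 mulNmx mulmxV.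
Qed.

Lemma cayley_JE : J = J0 *m ((1%:M + P) *m u).
Proof. by rewrite JE -J0_plus mulmxA. Qed.

Lemma wcayley_J : w *m J = g0 *m ((1%:M + P) *m u).
Proof. by rewrite cayley_JE mulmxA g0E. Qed.

Lemma sym_minus : (1%:M - P)^T *m g0 = g0 *m (1%:M - P).
Proof. by rewrite linearB /= trmx1 mulmxBl mulmxBr mul1mx mulmx1 PE.1. Qed.

Lemma sym_u : u^T *m g0 = g0 *m u.
Proof.
have uT : (1%:M - P)^T \in unitmx by rewrite unitmx_tr.
apply: (can_inj (mulKmx uT)); rewrite trmx_inv mulmxA mulmxV// mul1mx.
by rewrite mulmxA sym_minus -mulmxA mulmxV// mulmx1.
Qed.

Lemma cayley_metric_sym : (w *m J)^T = w *m J.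
Proof.
rewrite wcayley_J cayley_affine mulmxBr mulmx1 linearB /= g0T -scalemxAr.
by rewrite linearZ /= trmx_mul g0T sym_u.
Qed.

(** g0 (1 + P) u is congruent to g0 (1 - P^2) through u. *)
Lemma cayley_metric_pos : posdef (w *m J).
Proof.
have -> : w *m J = u^T *m (g0 *m (1%:M - P *m P)) *m u.
  rewrite wcayley_J cayley_factor cayley_comm !mulmxA sym_u.
  by rewrite -!mulmxA (mulmxA u) mulVmx// mul1mx.
by apply: posdef_congr => //; rewrite unitmx_inv.
Qed.

(** (1 + P) (1 - P)^-1 + 1 = 2 (1 - P)^-1, so that P is recovered from the
    metric. *)
Lemma retract_cayley :
  retract (invmx (1%:M + invmx g0 *m (g0 *m ((1%:M + P) *m u)))) = P.
Proof.
rewrite mulKmx ?g0_unit// cayley_affine addrC subrK.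
rewrite invmxZ ?unitmxZ ?unitfE ?pnatr_eq0 ?unitmx_inv// invmxK.
rewrite retractZ retractB retract1 sub0r retract_EndS// scaleNr opprK scalerA.
by rewrite mulVf ?pnatr_eq0// scale1r.
Qed.

Lemma cayley_denominator :
  1%:M + invmx g0 *m (g0 *m ((1%:M + P) *m u)) \in unitmx.
Proof.
rewrite mulKmx ?g0_unit// cayley_affine addrC subrK.
by rewrite unitmxZ ?unitfE ?pnatr_eq0 ?unitmx_inv.
Qed.

Lemma u_J : u *m J = J0 *m u.
Proof. by rewrite JE !mulmxA mulVmx// mul1mx. Qed.

Lemma J_v : J *m v = J0 *m u.
Proof. by rewrite cayley_JE -cayley_u_comm -!mulmxA mulmxV// mulmx1. Qed.

Lemma u_J0 : u *m J0 = J0 *m v.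
Proof.
apply: (can_inj (mulKmx um)).
by rewrite !mulmxA mulmxV// mul1mx -J0_plus -mulmxA mulmxV// mulmx1.
Qed.

Lemma wJ_T : J^T *m w = - (w *m J).
Proof.
by rewrite -[in RHS]cayley_metric_sym trmx_mul wT mulmxN opprK.
Qed.

(** The relations u J = J0 u and J v = J0 u, where v = (1 + P)^-1, move J across
    the product u V u. *)
Lemma dcayley_tangent V : in_EndS V ->
  let h := 2 *: (g0 *m (u *m V *m u)) in
  h^T = h /\ J^T *m h *m J = - h.
Proof.
move=> [sV aV] h; split.
  rewrite /h linearZ /= !trmx_mul g0T; congr (_ *: _).
  by rewrite -!mulmxA sym_u (mulmxA V^T) sV -!mulmxA (mulmxA u^T) sym_u !mulmxA.
rewrite /h -scalemxAr -scalemxAl -scalerN; congr (_ *: _).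
rewrite g0E !mulmxA wJ_T !mulNmx; congr (- _).
rewrite -!mulmxA u_J (mulmxA V) aV mulNmx !mulmxN -!mulmxA (mulmxA u J0) u_J0.
rewrite -!mulmxA (mulmxA J0 J0) J0J0 mulNmx mul1mx !mulmxN opprK.
by rewrite (mulmxA J v) J_v !mulmxA.
Qed.

Lemma dcayley_bigJ V :
  2 *: (g0 *m (u *m (V *m J0) *m u)) = 2 *: (g0 *m (u *m V *m u)) *m J.
Proof. by rewrite -scalemxAl -!mulmxA u_J. Qed.

(** V solves 2 g0 u V u = h. With H = g0^-1 h, the condition on h becomes
    H J = J0 J J0 H, and (1 - P) J0 J J0 = - J0 (1 - P). *)
Lemma dcayley_surj h : h^T = h -> J^T *m h *m J = - h ->
  let V := 2^-1 *: ((1%:M - P) *m (invmx g0 *m h) *m (1%:M - P)) in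
  in_EndS V /\ 2 *: (g0 *m (u *m V *m u)) = h.
Proof.
move=> hT hJ /=; have gu := g0_unit.
have [H HE] : exists H, H = invmx g0 *m h by eexists.
have gH : g0 *m H = h by rewrite HE mulmxA mulmxV// mul1mx.
rewrite -HE; split; last first.
  rewrite -scalemxAr -scalemxAl -scalemxAr scalerA divff ?pnatr_eq0// scale1r.
  by rewrite -!mulmxA mulmxV// mulmx1 (mulmxA u) mulVmx// mul1mx gH.
have sH : H^T *m g0 = g0 *m H by rewrite HE trmx_mul trmx_inv g0T hT mulmxKV// -HE.
split.
  rewrite linearZ /= -scalemxAl -scalemxAr; congr (_ *: _).
  by rewrite !trmx_mul -!mulmxA sym_minus (mulmxA H^T) sH -!mulmxA
    (mulmxA (1%:M - P)^T) sym_minus !mulmxA.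
have wu : w \in unitmx by move: gu; rewrite g0E unitmx_mul => /andP[].
have JJ0 : J *m J0 *m H *m J = J0 *m H.
  apply: (can_inj (mulKmx wu)); apply: oppr_inj.
  by move: hJ; rewrite -gH g0E !mulmxA wJ_T !mulNmx.
have HJ : H *m J = J0 *m J *m J0 *m H.
  have : J0 *m (J *m (J *m J0 *m H *m J)) = J0 *m (J *m (J0 *m H)) by rewrite JJ0.
  rewrite -!mulmxA (mulmxA J J) cayley_J_sq mulNmx mul1mx !mulmxN (mulmxA J0 J0) J0J0.
  by rewrite mulNmx mul1mx opprK.
rewrite -scalemxAl -scalemxAr -scalerN; congr (_ *: _).
have NJ0 : (1%:M - P) *m J0 = J *m (1%:M - P).
  by rewrite JE -mulmxA mulVmx// mulmx1.
have J3 : J0 *m J *m J0 = - (J0 *m (1%:M - P) *m v).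
  rewrite [in LHS]cayley_JE mulmxA J0J0 mulNmx mul1mx mulNmx -(mulmxA _ u J0) u_J0.
  by rewrite mulmxA -J0_minus.
have NJ3 : (1%:M - P) *m (J0 *m J *m J0) = - (J0 *m (1%:M - P)).
  rewrite J3 mulmxN !mulmxA -J0_plus -(mulmxA J0) cayley_comm -!mulmxA.
  by rewrite mulmxV// mulmx1.
by rewrite -!mulmxA NJ0 (mulmxA H) HJ -!mulmxA !mulmxA -(mulmxA _ J) -(mulmxA _ J0 (J *m J0)) (mulmxA J0 J) NJ3 !mulNmx.
Qed.

End Tangent.
Section Surjectivity.
Variable J : 'M[R]_m.
Hypotheses (JJ : J *m J = - 1%:M) (gT : (w *m J)^T = w *m J).
Hypothesis g_pos : posdef (w *m J).
Local Notation A := (- (J0 *m J)).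
Local Notation u := (invmx (1%:M + A)).
Local Notation P := (1%:M - 2 *: u).

Let g0A : g0 *m A = w *m J.
Proof. by rewrite g0E mulmxN !mulmxA -(mulmxA w) J0J0 mulmxN mulmx1 mulNmx opprK. Qed.

Let au : 1%:M + A \in unitmx.
Proof.
have := posdef_unit (posdefD g0_pos g_pos).
by rewrite -g0A -[X in X + _]mulmx1 -mulmxDr unitmx_mul => /andP[].
Qed.

Let AJ0A : A *m J0 *m A = J0.
Proof.
rewrite mulNmx mulmxN mulNmx opprK -!mulmxA (mulmxA J0 J0) J0J0.
by rewrite mulNmx mul1mx !mulmxN JJ mulmxN mulmx1 opprK.
Qed.

Let sym_a : (1%:M + A)^T *m g0 = g0 *m (1%:M + A).
Proof.
rewrite linearD /= trmx1 mulmxDl mulmxDr mul1mx mulmx1 g0A -[in RHS]gT -g0A.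
by rewrite trmx_mul g0T.
Qed.

Let sym_ua : u^T *m g0 = g0 *m u.
Proof.
have aT : (1%:M + A)^T \in unitmx by rewrite unitmx_tr.
apply: (can_inj (mulKmx aT)); rewrite trmx_inv mulmxA mulmxV// mul1mx.
by rewrite mulmxA sym_a -mulmxA mulmxV// mulmx1.
Qed.

Let u_anti : u *m J0 + J0 *m u = J0.
Proof.
have e : (1%:M + A) *m J0 *m (1%:M + A) = J0 *m (1%:M + A) + (1%:M + A) *m J0.
  have -> : (1%:M + A) *m J0 = J0 + A *m J0 by rewrite mulmxDl mul1mx.
  have -> : J0 *m (1%:M + A) = J0 + J0 *m A by rewrite mulmxDr mulmx1.
  by rewrite mulmxDr mulmx1 mulmxDl AJ0A [RHS]addrC [J0 *m A + J0]addrC.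
have : u *m ((1%:M + A) *m J0 *m (1%:M + A)) *m u = J0.
  by rewrite !mulmxA mulVmx// mul1mx -mulmxA mulmxV// mulmx1.
rewrite e mulmxDr mulmxDl !mulmxA mulVmx// mul1mx -(mulmxA _ _ u) mulmxV//.
by rewrite mulmx1.
Qed.

(** The endomorphism A = g0^-1 g = - J0 J satisfies A J0 A = J0, which says that
    its Cayley transform P = (A - 1) (A + 1)^-1 = 1 - 2 u anticommutes with J0. *)
Lemma cayley_inverse_in : in_EndS P.
Proof.
split.
  by rewrite linearB linearZ /= trmx1 mulmxBl mulmxBr mul1mx mulmx1
    -scalemxAl -scalemxAr sym_ua.
rewrite mulmxBl mulmxBr mul1mx mulmx1 -scalemxAl -scalemxAr opprB.
have e : 2 *: (u *m J0) = 2 *: J0 - 2 *: (J0 *m u).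
  by rewrite -[in 2 *: J0]u_anti scalerDr addrK.
have -> : J0 - 2 *: (u *m J0) = J0 - (2 *: J0 - 2 *: (J0 *m u)) by rewrite e.
have -> : 2 *: J0 = J0 + J0 by rewrite scaler_nat mulr2n.
by rewrite opprB addrCA opprD [J0 + _]addrA subrr add0r.
Qed.

Lemma cayley_inverse_minus : 1%:M - P = 2 *: u.
Proof. by rewrite opprB addrC subrK. Qed.

(** 1 - P^2 = 4 u A u, and g0 u A u is congruent to g = g0 A through u. *)
Lemma cayley_inverse_pos : posdef (g0 *m (1%:M - P *m P)).
Proof.
have uA : u *m A = 1%:M - u.
  have := mulVmx au; rewrite mulmxDr mulmx1 => /(canRL (addKr _)) ->.
  by rewrite addrC.
have -> : 1%:M - P *m P = 4 *: (u *m A *m u).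
  rewrite cayley_factor cayley_inverse_minus uA.
  have -> : 1%:M + P = 2 *: (1%:M - u).
    by rewrite scalerBr addrA; congr (_ - _); rewrite scaler_nat mulr2n.
  by rewrite -scalemxAl -scalemxAr scalerA -natrM.
rewrite -scalemxAr !mulmxA -sym_ua -(mulmxA _ g0) g0A => X X0.
rewrite /bil -scalemxAr -scalemxAl mxE pmulr_rgt0//.
by apply: (posdef_congr _ g_pos) X0; rewrite unitmx_inv.
Qed.

Lemma cayley_inverse_J : J = (1%:M - P) *m J0 *m invmx (1%:M - P).
Proof.
rewrite cayley_inverse_minus invmxZ ?unitmxZ ?unitfE ?pnatr_eq0 ?unitmx_inv//.
rewrite invmxK -!scalemxAl -scalemxAr scalerA divff ?pnatr_eq0// scale1r.
apply: (can_inj (mulKmx au)); rewrite !mulmxA mulmxV// mul1mx.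
rewrite mulmxDl mul1mx mulNmx -mulmxA JJ mulmxN mulmx1 opprK.
by rewrite mulmxDr mulmx1 mulmxN mulmxA J0J0 mulNmx mul1mx opprK addrC.
Qed.
End Surjectivity.

End Compatible.
End PointwiseAlgebra.

(** * Inversion between affine maps *)

Section AffineInverse.
Context {R : realType} {m : nat} {M : closedManifold R m} {E F : lcs R}
  {LE : seminormed E} {LF : seminormed F} (a b : bool).
Local Notation T := (@all_tens R m M).
Variables (c : T a b) (L : E -> T a b) (L' : T b a -> F) (c' : F).
Hypotheses (hc : smooth_tensor a b c) (hc' : lc_in c').
Hypotheses (cL : clinear L) (cL' : clinear L').

Lemma Ck_cst (k : nat) (D G : lcs R) {LD : seminormed D} {LG : seminormed G}
  (U : set D) (d : G) : U `<=` @lc_in R D -> lc_in d -> Ck k U (fun _ => d).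
Proof.
have cc (D' : lcs R) (U' : set D') (d' : G) : lc_in d' ->
    lcontinuous U' (fun _ => d').
  move=> hd x Ux l e e0; exists [::], 1 => // y Uy _; split=> //.
  by rewrite -/(lnorm _ _) subrr lnorm0.
elim: k => [|k IH] in D LD U d *; move=> Uin hd; first by split=> //; exact: cc.
split=> //; first exact: cc.
exists (fun _ _ => 0); split=> [x v Ux hv|].
  split; first exact: lc_in0.
  move=> l e e0; exists 1 => // t t0 _ _; rewrite subrr scaler0.
  by split; [exact: lc_in0|rewrite -/(lnorm _ _) subrr lnorm0].
by apply: (IH (lprod D D)); [move=> z [/Uin]|exact: lc_in0].
Qed.

Lemma is_dderive_affine (D G : lcs R) {LD : seminormed D} {LG : seminormed G}
    (K : D -> G) (d : G) (U : set D) x v : clinear K -> lc_in v ->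
  is_dderive U (fun x => d + K x) x v (K v).
Proof.
move=> cK hv; have [hKv hd] := is_dderive_clinear cK U x hv; split=> // l e e0.
have [r r0 {}hd] := hd l e e0; exists r => // t t0 tr Ut.
rewrite opprD addrACA subrr add0r.
exact: hd.
Qed.

Lemma Ck_affine (k : nat) (D G : lcs R) {LD : seminormed D} {LG : seminormed G}
    (K : D -> G) (d : G) (U : set D) : lopen U -> clinear K -> lc_in d ->
  Ck k U (fun x => d + K x).
Proof.
move=> oU cK hd; apply: Ck_add => //; first exact: Ck_cst oU.1 hd.
exact: Ck_clinear oU.1 cK.
Qed.

Variables (U : set E) (oU : lopen U).
Hypothesis hU : forall x, U x -> unitT a b (c + L x).

(** Both Psi and its left inverse on symmetric forms are of this form. *)
Definition affine_inverse (x : E) : F := c' + L' (invT (c + L x)).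

Let cI k : Ck k U (fun x => invT (c + L x) : T b a).
Proof.
apply: (@Ck_comp R k E (T a b) (T b a) _ _ _ U (unitT a b) (fun x => c + L x)).
- exact: oU.
- exact: lopen_unitT.
- exact: hU.
- exact: Ck_affine.
- exact: Ck_invT.
Qed.

Lemma lsmooth_affine_inverse : lsmooth U affine_inverse.
Proof.
move=> k.
apply: (@Ck_comp R k E (T b a) F _ _ _ U (@lc_in R (T b a))
  (fun x => invT (c + L x)) (fun X => c' + L' X)).
- exact: oU.
- exact: lopen_in.
- exact: Ck_lc_in (cI k).
- exact: cI.
- by apply: Ck_affine => //; exact: lopen_in.
Qed.

Lemma is_dderive_affine_inverse x v : U x -> lc_in v ->
  is_dderive U affine_inverse x v
    (L' ((-1) *: mulT (invT (c + L x)) (mulT (L v) (invT (c + L x))))).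
Proof.
move=> Ux hv.
have d1 : is_dderive U (fun x => c + L x) x v (L v) by exact: is_dderive_affine.
have d2 := is_dderive_invT (hU Ux) (cl_in cL hv : smooth_tensor a b (L v)).
have d3 : is_dderive U (fun x => invT (c + L x) : T b a) x v
    ((-1) *: mulT (invT (c + L x)) (mulT (L v) (invT (c + L x)))).
  exact: (@is_dderive_comp R E (T a b) (T b a) _ _ U (unitT a b)
    (fun x => c + L x) invT x v _ _ (@lopen_unitT R m M a b)
    (@Ck_invT R m M 1 a b) hU Ux d1 d2).
have d4 := is_dderive_affine c' (@lc_in R (T b a)) (invT (c + L x)) cL' d3.1.
apply: (@is_dderive_comp R E (T b a) F _ _ U (@lc_in R (T b a))
    (fun x => invT (c + L x)) (fun X => c' + L' X) x v _ _ lopen_in _ _ Ux d3).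
- by apply: Ck_affine => //; exact: lopen_in.
- exact: Ck_lc_in (cI 0).
- exact: d4.
Qed.

End AffineInverse.

(** * The parametrization of associated metrics *)

Section AssociatedMetrics.
Context {R : realType} {m : nat} {M : closedManifold R m}.
Variables (w J0 : tensor M) (hw : symplectic w) (hJ0 : pos_assoc w J0).
Local Notation T := (@all_tens R m M).
Local Notation g0 := (assoc_metric w J0).
Local Notation PE := (@lc_in R (End_S w J0)).
Local Notation PF := (@lc_in R (sym_forms M)).
Local Notation E := (tens true true PE).
Local Notation F := (tens false true PF).

Transparent dtrans frame coframe.
Lemma smooth_endoP (A : tensor M) : smooth_endo A <-> smooth_tensor true true A.
Proof. by split=> [h|[h]]; first split. Qed.

Lemma smooth_formP (A : tensor M) : smooth_form A <-> smooth_tensor false true A.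
Proof. by split=> [h|[h]]; first split. Qed.
Opaque dtrans frame coframe.

Lemma w_tr x : (w x)^T = - w x.
Proof.
case: hw => _ wa _ _; apply: bilP => X Y.
by rewrite bil_tr trmxK wa /bil mulmxN mulNmx [RHS]mxE.
Qed.

Lemma w_unit x : w x \in unitmx.
Proof.
case: hw => _ _ wn _; rewrite -row_free_unit; apply/inj_row_free => u uw.
apply: trmx_inj; rewrite trmx0; apply: (wn x) => Y.
by rewrite /bil trmxK uw mul0mx mxE.
Qed.

Lemma pos_assocP J : pos_assoc w J <-> [/\ smooth_tensor true true J,
  forall x, J x *m J x = - 1%:M, forall x, (w x *m J x)^T = w x *m J x &
  forall x, posdef (w x *m J x)].
Proof.
have posE x X : bil (w x) X (J x *m X) = bil (w x *m J x) X X.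
  by rewrite /bil !mulmxA.
split=> [[/smooth_endoP sJ JJ Jw Jp]|[sJ JJ Jw Jp]]; split=> //.
- move=> x; apply: (compatible_symmetric (w_tr x) (JJ x)).1; apply: bilP => X Y.
  by rewrite -bil_mul Jw.
- by move=> x X X0; rewrite -posE; exact: Jp.
- exact/smooth_endoP.
- move=> x X Y; rewrite bil_mul.
  by rewrite ((compatible_symmetric (w_tr x) (JJ x)).2 (Jw x)).
- by move=> x X X0; rewrite posE; exact: Jp.
Qed.

Lemma acs_of_assoc J : pos_assoc w J -> acs_of w (assoc_metric w J) = J.
Proof.
move=> hJ; rewrite /acs_of; case: xgetP => [J' _ [hJ' e]|/(_ J)[]//].
apply/funext => x; apply: (can_inj (mulKmx (w_unit x))).
exact: (congr1 (fun g : tensor M => g x) e).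
Qed.

Let sw : smooth_tensor false true w.
Proof. by apply/smooth_formP; case: hw. Qed.
Let sJ0 : smooth_tensor true true J0. Proof. by case/pos_assocP: hJ0. Qed.
Let J0J0 x : J0 x *m J0 x = - 1%:M. Proof. by case/pos_assocP: hJ0. Qed.
Let g0T x : (g0 x)^T = g0 x. Proof. by case/pos_assocP: hJ0 => _ _ h _; exact: h. Qed.
Let g0P x : posdef (g0 x). Proof. by case/pos_assocP: hJ0 => _ _ _ h; exact: h. Qed.
Let g0E x : g0 x = w x *m J0 x. Proof. by []. Qed.
Let sg0 : smooth_tensor false true g0. Proof. exact: smooth_mulT sw sJ0. Qed.
Let g0U x : g0 x \in unitmx. Proof. exact: posdef_unit. Qed.
Let sg0i : smooth_tensor true false (invT g0). Proof. exact: smooth_invT. Qed.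

Lemma EndSP P : PE P <->
  smooth_tensor true true P /\ forall x, in_EndS (J0 x) (g0 x) (P x).
Proof.
have symE x X Y : bil (g0 x) (P x *m X) Y = bil ((P x)^T *m g0 x) X Y.
  by rewrite -[Y in LHS]mul1mx bil_mul mulmx1.
have symE' x X Y : bil (g0 x) X (P x *m Y) = bil (g0 x *m P x) X Y.
  by rewrite -[X in LHS]mul1mx bil_mul trmx1 mul1mx.
split=> [[/smooth_endoP sP Ps Pa]|[sP h]].
  split=> // x; split=> //; apply: bilP => X Y.
  by rewrite -symE -symE'; exact: Ps.
split; first exact/smooth_endoP.
  by move=> x X Y; rewrite symE symE' (h x).1.
by move=> x; exact: (h x).2.
Qed.

Lemma symformP h : PF h <-> smooth_tensor false true h /\ forall x, (h x)^T = h x.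
Proof.
split=> [[/smooth_formP sh hs]|[sh hs]].
  by split=> // x; apply: bilP => X Y; rewrite -bil_tr; exact: hs.
by split; [exact/smooth_formP|move=> x X Y; rewrite bil_tr hs].
Qed.

Lemma EndS_tensor_space : tensor_space true true PE.
Proof.
split.
- by move=> P /EndSP[].
- apply/EndSP; split=> [|x]; first exact: smooth_zeroT.
  by split; rewrite /= ?trmx0 ?mul0mx ?mulmx0 ?oppr0.
- move=> A B /EndSP[sA hA] /EndSP[sB hB]; apply/EndSP; split.
    exact: smooth_addT.
  by move=> x; apply: in_EndS_add; [exact: hA|exact: hB].
- move=> c A /EndSP[sA hA]; apply/EndSP; split; first exact: smooth_scaleT.
  by move=> x; apply: in_EndS_scale; exact: hA.
Qed.

Lemma symform_tensor_space : tensor_space false true PF.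
Proof.
split.
- by move=> P /symformP[].
- by apply/symformP; split=> [|x]; [exact: smooth_zeroT|rewrite trmx0].
- move=> A B /symformP[sA hA] /symformP[sB hB]; apply/symformP; split.
    exact: smooth_addT.
  by move=> x; rewrite [LHS]linearD /= hA hB.
- move=> c A /symformP[sA hA]; apply/symformP; split; first exact: smooth_scaleT.
  by move=> x; rewrite [LHS]linearZ /= hA.
Qed.

Instance E_seminormed : seminormed E := tens_seminormed EndS_tensor_space.
Instance F_seminormed : seminormed F := tens_seminormed symform_tensor_space.

Lemma posdef_loc (B : tensor M) i y : cimg i y ->
  posdef (loc false true i B y) <-> posdef (B (cinv i y)).
Proof.
move=> cy; have cx := cimg_cinv cy.
have e1 := frameK true cx; have e2 := coframeK true cx.
have lE : loc false true i B y =
    (coframe true i (cinv i y))^T *m B (cinv i y) *m coframe true i (cinv i y).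
  by rewrite coframe_tr.
rewrite {}lE; move: (coframe true i _) (frame true i _) (B _) e1 e2 => Q Q' B' e1 e2.
have [uQ uQ'] := mulmx1_unit e1.
split=> h; last exact: posdef_congr.
have -> : B' = Q'^T *m (Q^T *m B' *m Q) *m Q'.
  by rewrite -!mulmxA e1 mulmx1 mulmxA -trmx_mul e1 trmx1 mul1mx.
exact: posdef_congr.
Qed.

Lemma PJ0P P : PJ0 w J0 P <->
  PE P /\ forall x, posdef (g0 x *m (1%:M - P x *m P x)).
Proof.
have e x X : bil (g0 x) X ((1%:M - P x *m P x) *m X) =
    bil (g0 x *m (1%:M - P x *m P x)) X X by rewrite /bil !mulmxA.
by split=> [[hP h]|[hP h]]; split=> // x X X0;
  [rewrite -e|rewrite e]; exact: h.
Qed.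

Lemma lopen_PJ0 : @lopen R E (PJ0 w J0).
Proof.
pose Gam i (y : 'rV[R]_m) (p : 'M[R]_m) :=
  posdef (loc false true i g0 y *m (1%:M - p *m p)).
have GE (P : tensor M) i y : cimg i y ->
    Gam i y (loc true true i P y) <->
    posdef (g0 (cinv i y) *m (1%:M - P (cinv i y) *m P (cinv i y))).
  move=> cy; pose B := mulT g0 (oneT + (-1) *: mulT P P).
  have BE : B (cinv i y) = g0 (cinv i y) *m (1%:M - P (cinv i y) *m P (cinv i y)).
    by rewrite -[LHS]/(g0 (cinv i y) *m (1%:M +
      (-1) *: (P (cinv i y) *m P (cinv i y)))) scaleN1r.
  have lB : loc false true i B y = loc false true i g0 y *m
      (1%:M - loc true true i P y *m loc true true i P y).
    apply: (etrans (@loc_mul _ _ _ false true true i g0 _ y cy)); congr (_ *m _).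
    rewrite loc_add loc_one// loc_scale scaleN1r; congr (_ - _).
    exact: (@loc_mul _ _ _ true true true i P P y cy).
  by rewrite /Gam -lB -BE; exact: posdef_loc.
apply: (lopen_pointwise EndS_tensor_space (Gam := Gam)).
- by move=> P /PJ0P[].
- by move=> P i y /PJ0P[_ h] cy; apply/GE.
- move=> P hP h; apply/PJ0P; split=> // x; have [i [cx]] := h x.
  by move/GE; rewrite chartK//; apply; exists x.
move=> i y p cy pp.
pose Q := (fun z : 'rV[R]_m * 'M[R]_m =>
  loc false true i g0 z.1 *m (1%:M - z.2 *m z.2)).
have cQ : Q @ (y, p) --> Q (y, p).
  apply: cvg_mulmx.
    exact: (cvg_comp (@fst 'rV[R]_m 'M[R]_m) _ cvg_fst (sg0 i [::] y cy).1).
  by apply: cvgB; [exact: cvg_cst|apply: cvg_mulmx; exact: cvg_snd].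
have /cQ : nbhs (Q (y, p)) [set b | posdef b] by exact: posdef_near.
move=> /nbhs_ballP[e /= e0 he]; exists e => // y' p' yy pp'.
by apply: (he (y', p')); split; rewrite -ball_normE /= distrC.
Qed.

Definition cayley_acs (P : tensor M) : tensor M :=
  mulT (mulT (oneT + (-1) *: P) J0) (invT (oneT + (-1) *: P)).

Lemma one_minusE (P : tensor M) x : (oneT + (-1) *: P) x = 1%:M - P x.
Proof. by rewrite -[LHS]/(1%:M + (-1) *: P x) scaleN1r. Qed.

Lemma cayley_acsE P x : cayley_acs P x = (1%:M - P x) *m J0 x *m invmx (1%:M - P x).
Proof. by rewrite -one_minusE. Qed.

Lemma one_minus_unitT P : PJ0 w J0 P -> unitT true true (oneT + (-1) *: P).
Proof.
move=> /PJ0P[/EndSP[sP _] pP]; split.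
  by apply: smooth_addT; [exact: smooth_oneT|exact: smooth_scaleT].
by move=> x; rewrite one_minusE; have [] := cayley_units (pP x).
Qed.

Lemma cayley_acs_pos_assoc P : PJ0 w J0 P -> pos_assoc w (cayley_acs P).
Proof.
move=> hP; have [sa ua] := one_minus_unitT hP.
have /PJ0P[/EndSP[sP eP] pP] := hP.
apply/pos_assocP; split.
- exact: smooth_mulT (smooth_mulT sa sJ0) (smooth_invT sa ua).
- move=> x; exact: (cayley_J_sq (J0J0 x) (pP x) (cayley_acsE P x)).
- move=> x; exact: (cayley_metric_sym (g0E x) (g0T x) (eP x) (pP x) (cayley_acsE P x)).
- move=> x; exact: (cayley_metric_pos (g0E x) (eP x) (pP x) (cayley_acsE P x)).
Qed.

Lemma PsiE P : PJ0 w J0 P -> Psi w J0 P = assoc_metric w (cayley_acs P).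
Proof.
move=> /PJ0P[/EndSP[sP eP] pP]; apply/funext => x.
exact: esym (wcayley_J (g0E x) (eP x) (cayley_acsE P x)).
Qed.

Lemma Psi_AM P : PJ0 w J0 P -> AM w (Psi w J0 P).
Proof. by move=> hP; exists (cayley_acs P); [exact: cayley_acs_pos_assoc|rewrite PsiE]. Qed.

Lemma acs_of_Psi P : PJ0 w J0 P -> acs_of w (Psi w J0 P) = cayley_acs P.
Proof. by move=> hP; rewrite PsiE// acs_of_assoc//; exact: cayley_acs_pos_assoc. Qed.

Lemma AM_Psi g : AM w g -> exists2 P, PJ0 w J0 P & Psi w J0 P = g.
Proof.
move=> [J hJ <-]; have [sJ JJ gT gP] := (pos_assocP J).1 hJ.
pose D : tensor M := oneT + (-1) *: mulT J0 J.
have DE x : D x = 1%:M - J0 x *m J x.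
  by rewrite -[LHS]/(1%:M + (-1) *: (J0 x *m J x)) scaleN1r.
pose P : tensor M := oneT + (-2) *: invT D.
have PE' x : P x = 1%:M - 2 *: invmx (1%:M - J0 x *m J x).
  by rewrite -DE -[LHS]/(1%:M + (-2) *: invmx (D x)) scaleNr.
have eP x : in_EndS (J0 x) (g0 x) (P x).
  rewrite PE'.
  exact: (cayley_inverse_in (J0J0 x) (g0E x) (g0T x) (g0P x) (JJ x) (gT x) (gP x)).
have pP x : posdef (g0 x *m (1%:M - P x *m P x)).
  rewrite PE'.
  exact: (cayley_inverse_pos (J0J0 x) (g0E x) (g0T x) (g0P x) (gT x) (gP x)).
have DU x : D x \in unitmx.
  have [] := cayley_units (pP x).
  rewrite PE' opprB addrC subrK -DE => + _.
  by rewrite unitmxZ ?unitfE ?pnatr_eq0// unitmx_inv.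
have sD : smooth_tensor true true D.
  apply: smooth_addT; first exact: smooth_oneT.
  by apply: smooth_scaleT; exact: smooth_mulT sJ0 sJ.
have hP : PJ0 w J0 P.
  apply/PJ0P; split=> //; apply/EndSP; split=> //.
  apply: smooth_addT; first exact: smooth_oneT.
  by apply: smooth_scaleT; exact: smooth_invT.
exists P => //; rewrite PsiE//; congr assoc_metric; apply/funext => x.
rewrite cayley_acsE PE'; apply/esym.
exact: (cayley_inverse_J (J0J0 x) (g0E x) (g0P x) (JJ x) (gP x)).
Qed.

Definition twice_sym_form (X : tensor M) : tensor M := mulT g0 X + trT (mulT g0 X).

Definition retractT (X : tensor M) : tensor M :=
  let S := X + mulT (invT g0) (mulT (trT X) g0) in
  (- 2^-1) *: (S + mulT J0 (mulT S J0)).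

Lemma retractTE X x : retractT X x = retract (J0 x) (g0 x) (X x).
Proof. by rewrite /retract /symmetrize -!mulmxA. Qed.

Lemma clinear_mulTl a b c (A : tensor M) : smooth_tensor a b A ->
  @clinear R (T b c) (T a c) (mulT A).
Proof. by move=> sA; apply: (cbilinear_r (@cbilinear_mulT R m M a b c)). Qed.

Lemma clinear_mulTr a b c (A : tensor M) : smooth_tensor b c A ->
  @clinear R (T a b) (T a c) (mulT ^~ A).
Proof. by move=> sA; apply: (cbilinear_l (@cbilinear_mulT R m M a b c)). Qed.

Lemma clinear_twice_sym_form : @clinear R (T true true) F twice_sym_form.
Proof.
have c1 := clinear_mulTl true sg0.
have c2 : @clinear R (T true true) (T false true) (fun X => trT (mulT g0 X)).
  exact: (clinear_comp c1 (@clinear_trT R m M false true)).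
pose proof (clinear_addf c1 c2) as c3.
apply: (@clinear_restrict R m M (T true true) _ _ PF (smooth_tensor false true) twice_sym_form c3).
move=> X sX; apply/symformP; split; first exact: (cl_in c3 sX).
by move=> x; rewrite [LHS]linearD /= trmxK addrC.
Qed.

Lemma clinear_retractT : @clinear R (T true true) E retractT.
Proof.
pose S (X : tensor M) := X + mulT (invT g0) (mulT (trT X) g0).
have c1 : @clinear R (T true true) (T true true)
    (fun X => mulT (invT g0) (mulT (trT X) g0)).
  have h1 := @clinear_trT R m M true true.
  have h2 := @clinear_mulTr false false true _ sg0.
  have h3 := @clinear_mulTl true false true _ sg0i.
  exact: (clinear_comp (clinear_comp h1 h2) h3).
have cS : @clinear R (T true true) (T true true) S.
  apply: clinear_addf c1; exact: (@clinear_incl R m M true true _ _ (fun x h => h)).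
have cJ : @clinear R (T true true) (T true true) (fun X => mulT J0 (mulT (S X) J0)).
  have h2 := @clinear_mulTr true true true _ sJ0.
  have h3 := @clinear_mulTl true true true _ sJ0.
  exact: (clinear_comp (clinear_comp cS h2) h3).
pose proof (clinear_scalef (- 2^-1) (clinear_addf cS cJ)) as cL.
apply: (@clinear_restrict R m M (T true true) _ _ PE (smooth_tensor true true) retractT cL) => X sX.
apply/EndSP; split; first exact: (cl_in cL sX).
move=> x; change (in_EndS (J0 x) (g0 x) (retractT X x)); rewrite retractTE.
exact: (retract_in (w_tr x) (J0J0 x) (g0E x) (g0T x) (g0P x) _).
Qed.

Let clinear_neg : @clinear R E (T true true) (fun P => (-1) *: P).
Proof.
apply: (@clinear_scalef R E (T true true)).
exact: (@clinear_incl R m M true true PE _ (tspace_smooth EndS_tensor_space)).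
Qed.

Let clinear_g0i : @clinear R F (T true true) (mulT (invT g0)).
Proof.
have h1 := @clinear_incl R m M false true PF _ (tspace_smooth symform_tensor_space).
have h2 := @clinear_mulTl true false true _ sg0i.
exact: (clinear_comp h1 h2).
Qed.

Let PF_g0 : PF ((-1) *: g0).
Proof. by apply: (tspaceZ symform_tensor_space); apply/symformP. Qed.

(** Psi P = g0 (2 u - 1) with u = (1 - P)^-1, where 2 g0 u is replaced by
    g0 u + (g0 u)^T: this is affine in u, agrees with Psi on PJ0, where g0 u is
    symmetric, and takes values in symmetric forms for every u. *)
Definition Psi_sym : E -> F := affine_inverse (E := E) (F := F) (a := true) (b := true)
  oneT (fun P => (-1) *: P) twice_sym_form ((-1) *: g0).

Lemma Psi_symE P : PJ0 w J0 P -> Psi_sym P = Psi w J0 P.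
Proof.
move=> /PJ0P[/EndSP[sP eP] pP]; apply/funext => x.
have -> : Psi_sym P x = (-1) *: g0 x + (g0 x *m invmx ((oneT + (-1) *: P) x) +
  (g0 x *m invmx ((oneT + (-1) *: P) x))^T) by [].
rewrite one_minusE trmx_mul g0T (sym_u (eP x) (pP x)).
have -> : Psi w J0 P x = g0 x *m ((1%:M + P x) *m invmx (1%:M - P x)) by [].
rewrite (cayley_affine (pP x)) mulmxBr mulmx1 -scalemxAr scaler_nat mulr2n.
by rewrite scaleN1r addrC.
Qed.

Lemma lsmooth_Psi : @lsmooth R E F (PJ0 w J0) (Psi w J0).
Proof.
move=> k; apply: (Ck_ext (f := Psi_sym)) => [P|]; first exact: Psi_symE.
exact: (lsmooth_affine_inverse (smooth_oneT true) PF_g0 clinear_neg clinear_twice_sym_form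
  lopen_PJ0 one_minus_unitT).
Qed.

Definition dPsi (P V : tensor M) : tensor M := fun x =>
  2 *: (g0 x *m (invmx (1%:M - P x) *m V x *m invmx (1%:M - P x))).

Lemma is_dderive_Psi P V : PJ0 w J0 P -> PE V ->
  @is_dderive R E F (PJ0 w J0) (Psi w J0) P V (dPsi P V).
Proof.
move=> hP hV.
pose proof (is_dderive_affine_inverse (smooth_oneT true) PF_g0 clinear_neg
  clinear_twice_sym_form lopen_PJ0 one_minus_unitT hP hV) as d.
have {}d := is_dderive_ext (E := E) (F := F) (U := PJ0 w J0) (f := Psi_sym)
  (g := Psi w J0) Psi_symE hP d.
suff e : dPsi P V = twice_sym_form ((-1) *: mulT (invT (oneT + (-1) *: P))
    (mulT ((-1) *: V) (invT (oneT + (-1) *: P)))) by rewrite e.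
have /PJ0P[/EndSP[sP eP] pP] := hP; have /EndSP[sV eV] := hV.
apply/funext => x.
pose Y := g0 x *m ((-1) *: (invmx ((oneT + (-1) *: P) x) *m
  (((-1) *: V x) *m invmx ((oneT + (-1) *: P) x)))).
have -> : twice_sym_form ((-1) *: mulT (invT (oneT + (-1) *: P))
  (mulT ((-1) *: V) (invT (oneT + (-1) *: P)))) x = Y + Y^T by [].
have YE : Y = g0 x *m (invmx (1%:M - P x) *m V x *m invmx (1%:M - P x)).
  by rewrite /Y one_minusE -scalemxAl -!scalemxAr scalerA mulrNN mulr1 scale1r !mulmxA.
have [] := dcayley_tangent (w_tr x) (J0J0 x) (g0E x) (g0T x) (eP x) (pP x)
  (cayley_acsE P x) (eV x).
rewrite -YE /dPsi -YE linearZ /= => YT _.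
have -> : Y^T = Y.
  by rewrite -[LHS]scale1r -[RHS]scale1r -(mulVf (x := 2)) ?pnatr_eq0// -!scalerA YT.
by rewrite scaler_nat mulr2n.
Qed.

Lemma TAMP J h : pos_assoc w J -> TAM w (assoc_metric w J) h <->
  PF h /\ forall x, (J x)^T *m h x *m J x = - h x.
Proof.
move=> hJ; rewrite /TAM /= acs_of_assoc//.
have bN (b : 'M[R]_m) X Y : - bil b X Y = bil (- b) X Y.
  by rewrite /bil mulmxN mulNmx [RHS]mxE.
split=> [[sh hs hJh]|[[sh hs] hJh]]; split=> //.
  by move=> x; apply: bilP => X Y; rewrite -bil_mul hJh bN.
by move=> x X Y; rewrite bil_mul hJh bN.
Qed.

Lemma range_dPsi P : PJ0 w J0 P ->
  [set h | exists2 V, @lc_in R E V &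
    @is_dderive R E F (PJ0 w J0) (Psi w J0) P V h] = TAM w (Psi w J0 P).
Proof.
move=> hP; have /PJ0P[/EndSP[sP eP] pP] := hP.
rewrite PsiE//; apply/seteqP; split=> [h [V hV dh]|h].
  have -> : h = dPsi P V.
    exact: (is_dderive_unique lopen_PJ0 hP hV dh (is_dderive_Psi hP hV)).
  apply/TAMP; first exact: cayley_acs_pos_assoc.
  split; first exact: (is_dderive_Psi hP hV).1.
  move=> x; have /EndSP[_ eV] := hV.
  by have [] := dcayley_tangent (w_tr x) (J0J0 x) (g0E x) (g0T x) (eP x) (pP x)
    (cayley_acsE P x) (eV x).
move=> /(TAMP _ (cayley_acs_pos_assoc hP))[/symformP[sh hT] hJ].
pose N : tensor M := oneT + (-1) *: P.
pose V : tensor M := 2^-1 *: mulT (mulT N (mulT (invT g0) h)) N.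
have VE x : V x = 2^-1 *: ((1%:M - P x) *m (invmx (g0 x) *m h x) *m (1%:M - P x)).
  by rewrite -!one_minusE.
have surj x := dcayley_surj (w_tr x) (J0J0 x) (g0E x) (g0T x) (g0P x) (eP x)
  (pP x) (cayley_acsE P x) (hT x) (hJ x).
have hV : PE V.
  apply/EndSP; split; last by move=> x; rewrite VE; exact: (surj x).1.
  have sN : smooth_tensor true true N by case: (one_minus_unitT hP).
  apply: smooth_scaleT.
  exact: (smooth_mulT (smooth_mulT sN (smooth_mulT sg0i sh)) sN).
exists V => //.
have -> : h = dPsi P V by apply/funext => x; rewrite /dPsi VE (surj x).2.
exact: is_dderive_Psi.
Qed.

Lemma mulJ0_in V : PE V -> PE (mulJ0 J0 V).
Proof.
move=> /EndSP[sV eV]; apply/EndSP; split; first exact: smooth_mulT sV sJ0.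
move=> x; exact: (in_EndS_mulJ0 (w_tr x) (J0J0 x) (g0E x) (g0T x) (eV x)).
Qed.

Lemma J_holomorphic_Psi :
  @J_holomorphic R E (mulJ0 J0) F (bigJ w) (PJ0 w J0) (Psi w J0).
Proof.
move=> P V h hP hV dh.
have -> : h = dPsi P V.
  exact: (is_dderive_unique lopen_PJ0 hP hV dh (is_dderive_Psi hP hV)).
suff -> : bigJ w (Psi w J0 P) (dPsi P V) = dPsi P (mulJ0 J0 V).
  by apply: is_dderive_Psi => //; exact: mulJ0_in.
rewrite /bigJ acs_of_Psi//; have /PJ0P[_ pP] := hP; apply/funext => x.
exact: esym (dcayley_bigJ (pP x) (cayley_acsE P x) (V x)).
Qed.

(** On metrics Psi P the endomorphism (1 + g0^-1 g)^-1 is (1 - P) / 2. The final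
    projection brings the values into End_S for every symmetric form g. *)
Definition retraction : F -> E := affine_inverse (E := F) (F := E) (a := true)
  (b := true) oneT (mulT (invT g0)) retractT 0.

Let Om : set F := [set h | PF h /\ unitT true true (oneT + mulT (invT g0) h)].

Let lopen_Om : lopen Om.
Proof.
have oF : @lopen R F PF by exact: (@lopen_in R F).
have cA : @Ck R 0 F (T true true) PF (fun h => oneT + mulT (invT g0) h).
  exact: (@Ck_affine R 0 F (T true true) _ _ (mulT (invT g0)) oneT PF oF clinear_g0i
    (smooth_oneT true)).
exact: (lopen_preimage oF (Ck_continuous cA) (@lopen_unitT R m M true true)).
Qed.

Let PE0 : @lc_in R E 0. Proof. exact: (tspace0 EndS_tensor_space). Qed.

Lemma lsmooth_retraction : lsmooth Om retraction.
Proof.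
by apply: (lsmooth_affine_inverse (smooth_oneT true) PE0 clinear_g0i clinear_retractT
  lopen_Om) => h [].
Qed.

Lemma Psi_Om P : PJ0 w J0 P -> Om (Psi w J0 P).
Proof.
move=> hP; have /PJ0P[/EndSP[sP eP] pP] := hP.
have hF : PF (Psi w J0 P) := Ck_lc_in (lsmooth_Psi 0) hP.
have /symformP[sF _] := hF.
split=> //; split.
  by apply: smooth_addT; [exact: smooth_oneT|exact: smooth_mulT sg0i sF].
by move=> x; exact: (cayley_denominator (g0P x) (pP x)).
Qed.

Lemma retractionK P : PJ0 w J0 P -> retraction (Psi w J0 P) = P.
Proof.
move=> hP; have /PJ0P[/EndSP[sP eP] pP] := hP; apply/funext => x.
have -> : retraction (Psi w J0 P) x =
  0 + retractT (invT (oneT + mulT (invT g0) (Psi w J0 P))) x by [].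
rewrite add0r retractTE.
exact: (retract_cayley (J0J0 x) (g0P x) (eP x) (pP x)).
Qed.

Lemma smooth_param_Psi :
  @smooth_param R E F (AM w) (TAM w) (PJ0 w J0) (Psi w J0).
Proof.
split; first exact: lopen_PJ0.
- exact: lsmooth_Psi.
- by move=> _ [P hP <-]; exact: Psi_AM.
- move=> P hP; exists Om, retraction; split.
  + exact: lopen_Om.
  + exact: Psi_Om.
  + exact: lsmooth_retraction.
  + by move=> g [/AM_Psi[P' hP' <-] _]; exists P'.
  + by move=> P' hP' _; exact: retractionK.
- exact: range_dPsi.
Qed.

Lemma image_Psi : Psi w J0 @` PJ0 w J0 = AM w.
Proof.
apply/seteqP; split=> [_ [P hP <-]|g /AM_Psi[P hP <-]]; first exact: Psi_AM.
by exists P.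
Qed.

Lemma almost_complex_bigJ : @almost_complex R F (AM w) (TAM w) (bigJ w).
Proof.
move=> g h [J hJ <-] /(TAMP _ hJ)[/symformP[sh hT] hh].
have [sJ JJ gT gP] := (pos_assocP J).1 hJ.
rewrite /bigJ acs_of_assoc//; split; last first.
  apply/funext => x; rewrite -[LHS]/(h x *m J x *m J x) -mulmxA JJ mulmxN mulmx1.
  by [].
apply/TAMP => //; split.
  apply/symformP; split; first exact: smooth_mulT sh sJ.
  move=> x; rewrite -[LHS]/((h x *m J x)^T) trmx_mul hT.
  have : (J x)^T *m h x *m J x *m J x = (- h x) *m J x by rewrite hh.
  by rewrite -(mulmxA _ (J x)) JJ mulmxN mulmx1 mulNmx => /oppr_inj.
by move=> x; rewrite -[form_endo h J x]/(h x *m J x) mulmxA hh mulNmx.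
Qed.

Lemma integrable_and_atlas :
  integrable_acs E (mulJ0 J0) F (AM w) (TAM w) (bigJ w) /\
  acs_atlas E (mulJ0 J0) F (AM w) (TAM w) (bigJ w) =
  param_atlas E (mulJ0 J0) F (AM w) (PJ0 w J0) (Psi w J0).
Proof.
split; last first.
  exact: (acs_atlas_eq_param_atlas mulJ0_in smooth_param_Psi J_holomorphic_Psi
    image_Psi).
split=> [|g /AM_Psi[P hP <-]]; first exact: almost_complex_bigJ.
exists (PJ0 w J0), (Psi w J0); split; first exact: smooth_param_Psi.
  exact: J_holomorphic_Psi.
by exists P.
Qed.

End AssociatedMetrics.

(* Reading tensors in frames gives back End_S and sym_forms by definition. *)
Transparent dtrans frame coframe.

Theorem theorem3p1 (R : realType) (m : nat) (M : closedManifold R m)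
    (w : tensor M) (hw : symplectic w)
    (J0 : tensor M) (hJ0 : pos_assoc w J0) :
  integrable_acs (End_S w J0) (mulJ0 J0) (sym_forms M)
    (AM w) (TAM w) (bigJ w) /\
  acs_atlas (End_S w J0) (mulJ0 J0) (sym_forms M)
    (AM w) (TAM w) (bigJ w) =
  param_atlas (End_S w J0) (mulJ0 J0) (sym_forms M)
    (AM w) (PJ0 w J0) (Psi w J0).
Proof. exact: (integrable_and_atlas hw hJ0). Qed.
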